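(* For a positive integer $N$ let $W_1^{0,\rm G}(x;N)$ be the low temperature limit ($N$ fixed, $\beta\to\infty$) of the one-point function of the Gaussian $\beta$-ensemble with weight $e^{-\beta x^2/2}$, and let $W_1^{0,\rm G^*}(x;\alpha)$ be the scaled high temperature limit ($\beta=2\alpha/N$, $N\to\infty$) of the one-point function of the Gaussian $\beta$-ensemble with weight $e^{-x^2/2}$. Then $$\frac{i}{\sqrt2\,N}\,W_1^{0,\rm G}\big(ix/\sqrt2;N\big)=W_1^{0,\rm G^*}(x;-N).$$ Moreover the corresponding moments, defined by $$W_1^{0,\rm G}(x;N)=\frac1x\sum_{p=0}^\infty\frac{m_{2p}^{0,\rm G}(N)}{x^{2p}},\qquad W_1^{0,\rm G^*}(x;\alpha)=\frac1x\sum_{p=0}^\infty\frac{m_{2p}^{0,\rm G^*}(\alpha)}{x^{2p}},$$ satisfy, for all $p\ge0$, $$\frac{(-2)^p}{N}\,m_{2p}^{0,\rm G}(N)=m_{2p}^{0,\rm G^*}(-N).$$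
   Context: For a weight $w$, ${\rm ME}_{\beta,N}[w]$ is the ensemble with eigenvalue density on $\mathbb R^N$ proportional to $\prod_{l=1}^N w(\lambda_l)\prod_{1\le j<k\le N}|\lambda_k-\lambda_j|^\beta$. Define $$W_1^{0,\rm G}(x;N)=\lim_{\beta\to\infty}\Big\langle\sum_{j=1}^N\frac1{x-\lambda_j}\Big\rangle_{{\rm ME}_{\beta,N}[e^{-\beta\lambda^2/2}]},$$ $$W_1^{0,\rm G^*}(x;\alpha)=\lim_{N\to\infty}\frac1N\Big\langle\sum_{j=1}^N\frac1{x-\lambda_j}\Big\rangle_{{\rm ME}_{\beta,N}[e^{-\lambda^2/2}]}\Big|_{\beta=2\alpha/N}\qquad(\alpha>0).$$ The series in the claim are the large-$x$ expansions (formal/asymptotic in the case of $W_1^{0,\rm G^*}$). The coefficients $m_{2p}^{0,\rm G^*}(\alpha)$ are polynomials in $\alpha$; $m_{2p}^{0,\rm G^*}(-N)$ is the value of this polynomial at $\alpha=-N$, and $W_1^{0,\rm G^*}(x;-N)$ is the series with these coefficients, the first identity being understood as an identity of series in $1/x$. *)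

(* Defs.v *)
From HB Require Import structures.
From mathcomp Require Import all_boot all_order all_algebra.
From mathcomp Require Import complex.
From mathcomp Require Import all_classical all_reals all_analysis.

Set Implicit Arguments.
Unset Strict Implicit.
Unset Printing Implicit Defensive.

Import Order.TTheory GRing.Theory Num.Theory.
Import numFieldNormedType.Exports.

Local Open Scope classical_set_scope.
Local Open Scope ring_scope.
Local Open Scope complex_scope.

Definition tuple_cons {T : Type} {n : nat} (p : T * n.-tuple T) :
  n.+1.-tuple T := [tuple of p.1 :: p.2].

Lemma measurable_tuple_cons {d : measure_display} {T : measurableType d}
  (n : nat) : measurable_fun [set: T * n.-tuple T] (@tuple_cons T n).
Proof. exact: measurable_cons. Qed.

(* One step of the construction of Lebesgue measure on R^n: the image of
   lebesgue_measure \x m under (x, t) |-> x :: t. The carrier measurableTypeR R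
   is R with its Borel sigma-algebra. *)
Section product_step.
Context {R : realType} {n : nat}.
Variable m : {sigma_finite_measure set (n.-tuple (measurableTypeR R)) -> \bar R}.

Definition lebesgue_cons :
    set (n.+1.-tuple (measurableTypeR R)) -> \bar R :=
  pushforward (product_measure1 (@lebesgue_measure R) m) tuple_cons.

HB.instance Definition _ := Measure.copy lebesgue_cons
  (measure_function_pushforward__canonical__measure_function_Measure
    (product_measure1 (@lebesgue_measure R) m) (measurable_tuple_cons (n := n))).

Let lebesgue_cons_sigma_finite : sigma_finite setT lebesgue_cons.
Proof.
have /sigma_finiteP[F [TF ndF Foo]] := sigma_finiteT (@lebesgue_measure R).
have /sigma_finiteP[G [TG ndG Goo]] := sigma_finiteT m.
pose u (t : n.+1.-tuple (measurableTypeR R)) := (thead t, [tuple of behead t]).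
have mu : measurable_fun setT u.
  apply: measurable_fun_pair; first exact: measurable_tnth.
  exact: measurable_behead.
have uK (p : measurableTypeR R * n.-tuple (measurableTypeR R)) :
    u (tuple_cons p) = p.
  by case: p => x t; rewrite /u theadE; congr pair; exact: val_inj.
exists (fun k => u @^-1` (F k `*` G k)).
  rewrite -preimage_bigcup (_ : \bigcup_k _ = setT) ?preimage_setT//.
  rewrite -setXTT TF TG predeqE => -[x y]; split.
    by move=> [k _ []/= ? ?]; split; exists k.
  move=> [/= [k _ Fkx] [l _ Gly]]; exists (maxn k l) => //; split.
  - by move: x Fkx; exact/subsetPset/ndF/leq_maxl.
  - by move: y Gly; exact/subsetPset/ndG/leq_maxr.
move=> k; have [mF Fk] := Foo k; have [mG Gk] := Goo k; split.
  by rewrite -[X in measurable X]setTI; apply: mu => //; exact: measurableX.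
rewrite /lebesgue_cons /pushforward (_ : _ @^-1` _ = F k `*` G k)//.
  by rewrite product_measure1E// lte_mul_pinfty// ge0_fin_numE.
by rewrite -comp_preimage (_ : u \o _ = id) ?preimage_id//; apply/funext.
Qed.

HB.instance Definition _ := Measure_isSigmaFinite.Build _ _ _
  lebesgue_cons lebesgue_cons_sigma_finite.

End product_step.

Fixpoint lebesgue_tuple (R : realType) (n : nat) :
    {sigma_finite_measure set (n.-tuple (measurableTypeR R)) -> \bar R} :=
  match n with
  | 0 => \d_([tuple] : 0.-tuple (measurableTypeR R))
  | n'.+1 => lebesgue_cons (lebesgue_tuple R n')
  end.

Section beta_ensembles.
Context {R : realType}.
Local Notation C := R[i].

(* Unnormalised eigenvalue density of ME_{beta,N}[w]. *)
Definition ME_density (w : R -> R) (beta : R) (N : nat)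
    (t : N.-tuple (measurableTypeR R)) : R :=
  (\prod_(l < N) w (tnth t l)) *
  \prod_(k < N) \prod_(j < N | (j < k)%N) `|tnth t k - tnth t j| `^ beta.

Definition ME_average (w : R -> R) (beta : R) (N : nat)
    (f : N.-tuple (measurableTypeR R) -> R) : R :=
  (\int[lebesgue_tuple R N]_t (f t * ME_density w beta t)) /
  (\int[lebesgue_tuple R N]_t ME_density w beta t).

(* < sum_j 1 / (x - lambda_j) >, the average of a complex function being taken
   on real and imaginary parts; used for non-real x only. *)
Definition one_point (w : R -> R) (beta : R) (N : nat) (x : C) : C :=
  let f (t : N.-tuple (measurableTypeR R)) : C :=
    \sum_(j < N) (x - (tnth t j)%:C)^-1 in
  ME_average w beta (fun t => complex.Re (f t)) +i*
  ME_average w beta (fun t => complex.Im (f t)).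

(* The type R[i]^o carries the usual topology of the complex plane. *)
Definition W1_G (N : nat) (x : C) (beta : R) : C^o :=
  one_point (fun l => expR (- (beta * l ^+ 2 / 2))) beta N x.

Definition W1_G_high (alpha : R) (x : C) (N : nat) : C^o :=
  (N%:R)^-1 *
  one_point (fun l => expR (- (l ^+ 2 / 2))) (2 * alpha / N%:R) N x.

Definition W10_G (N : nat) (x : C) : C^o :=
  lim (W1_G N x beta @[beta --> +oo]).

Definition W10_Gstar (alpha : R) (x : C) : C^o :=
  lim (W1_G_high alpha x N @[N --> \oo]).

(* (1/x) sum_p m p / x^(2p) converges to f x for all large x in D. *)
Definition expands_at_infty (D : set C) (f : C -> C^o) (m : nat -> R) : Prop :=
  exists r : R, forall x : C, D x -> r%:C < `|x| ->
    series (fun p => (m p)%:C / x ^+ (2 * p).+1 : C^o) @ \oo --> f x.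

(* Poincare asymptotic expansion f x ~ (1/x) sum_p m p / x^(2p) as x tends to
   infinity in each of the double sectors |Im x| >= eps |x|, eps > 0. *)
Definition asymptotic_at_infty (f : C -> C^o) (m : nat -> R) : Prop :=
  forall eps : R, 0 < eps -> forall (n : nat) (delta : R), 0 < delta ->
  exists r : R, forall x : C,
    eps%:C * `|x| <= `|complex.Im x|%:C -> r%:C < `|x| ->
    `|(f x : C) - \sum_(p < n.+1) (m p)%:C / x ^+ (2 * p).+1|
      <= delta%:C / `|x| ^+ (2 * n).+1.

Definition is_moments_G (N : nat) (m : nat -> R) : Prop :=
  expands_at_infty [set x | complex.Im x != 0] (W10_G N) m.

Definition is_moments_Gstar (m : nat -> {poly R}) : Prop :=
  forall alpha : R, 0 < alpha ->
    asymptotic_at_infty (W10_Gstar alpha) (fun p => (m p).[alpha]).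

End beta_ensembles.

(* Main.v *)
(* Integrating the derivation sum_l x_l^j d/dx_l against the Gaussian density
   with weight exp(-c x^2 / 2) and exponent b gives loop equations for averages
   of products of normalised power sums. When (1 - b/2)/c -> A, 1/(c n) -> 0 and
   b n/(2c) -> G, they force these averages to factorise in the limit, the
   limiting moments m_k being determined by m_0 = 1 and
     m_(j+1) = A j m_(j-1) + G \sum_(a < j) m_(j-1-a) m_a.
   The low temperature limit is A = -1/2, G = N/2 and the high temperature one
   is A = 1, G = alpha. Hence the low temperature parameters are -1/2 times the
   high temperature ones at alpha = -N, and by homogeneity m_2p is multiplied by
   (-1/2)^p.
   The moments grow slowly enough for Taylor expansion to give convergence of
   characteristic functions; resolvents are uniform-on-average limits of
   trigonometric sums (a discretised Laplace transform), so the one-point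
   functions converge off the real axis, and expanding the resolvent bounds the
   remainder of the moment expansion by the next moment. *)

Require Import Defs.
From mathcomp Require Import all_boot all_order all_algebra.
From mathcomp Require Import complex ring lra zify.
From mathcomp Require Import all_classical all_reals all_analysis.
From mathcomp Require Import measurable_realfun.

Set Implicit Arguments.
Unset Strict Implicit.
Unset Printing Implicit Defensive.

Import Order.TTheory GRing.Theory Num.Theory.
Import numFieldNormedType.Exports.

Local Open Scope classical_set_scope.
Local Open Scope ring_scope.

(** * Gaussian-dominated integrals over tuples *)

Section lebesgue_tuple_integral.
Context {R : realType}.
Local Notation mu := (@lebesgue_measure R).
Local Notation leb n := (lebesgue_tuple R n).
Local Notation RT := (measurableTypeR R).

(** Both limits are instances of one statement in which [c], [b] and [n] vary along a filter [F]: at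
    low temperature [n] is fixed and [c = b] tends to infinity, at high temperature [c = 1] and [n]
    tends to infinity. Factorisation is an induction on total degree: every term on the right of a
    loop equation has smaller degree, and the only term coupling different factors carries the
    coefficient [1 / (c n)]. Passing from moments to resolvents needs control of moment growth. For
    [A = 1] the recursion has positive terms and gives a factorial bound. The limit of the resolvent
    average is never identified, only shown to exist by completeness. The coefficients of an
    expansion are arbitrary in the conclusion, so uniqueness is needed too: the expansion along the
    imaginary axis determines them, and a polynomial known at all positive [alpha] is known at
    [-N]. *)

Lemma ge0_integral_lebesgue_tupleS n (f : n.+1.-tuple RT -> \bar R) :
  measurable_fun setT f -> (forall t, 0 <= f t)%E ->
  (\int[leb n.+1]_t f t = \int[mu]_x \int[leb n]_t f (tuple_cons (x, t)))%E.
Proof.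
move=> mf f0.
transitivity (\int[product_measure1 mu (leb n)]_p f (tuple_cons p))%E.
  apply: (ge0_integral_pushforward (measurable_tuple_cons (n:=n))) => //.
apply: (fubini_tonelli1 (m1 := mu) (m2 := leb n) (fun p => f (tuple_cons p))) => //.
exact: (measurableT_comp mf (measurable_tuple_cons (n:=n))).
Qed.

Lemma integral_prod_tnth n (g : 'I_n -> R -> R) :
  (forall i, measurable_fun setT (g i)) -> (forall i x, 0 <= g i x) ->
  (\int[leb n]_t (\prod_(i < n) g i (tnth t i))%:E =
   \prod_(i < n) \int[mu]_x (g i x)%:E)%E.
Proof.
elim: n g => [|n IH] g mg g0.
  rewrite big_ord0.
  under eq_integral do rewrite big_ord0.
  by rewrite integral_cst// mul1e /= diracT.
have mprod m (h : 'I_m -> R -> R) : (forall i, measurable_fun setT (h i)) ->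
    measurable_fun [set: m.-tuple RT] (fun t => \prod_(i < m) h i (tnth t i)).
  move=> mh; apply: measurable_prod => i _.
  by apply: (measurableT_comp (mh i)); exact: measurable_tnth.
rewrite ge0_integral_lebesgue_tupleS; last 2 first.
- by apply/measurable_EFinP; exact: mprod.
- by move=> t; rewrite lee_fin prodr_ge0.
rewrite big_ord_recl -IH//.
transitivity (\int[mu]_x ((g ord0 x)%:E *
    \int[leb n]_t (\prod_(i < n) g (lift ord0 i) (tnth t i))%:E))%E.
  apply: eq_integral => x _; rewrite -ge0_integralZl//.
  - apply: eq_integral => t _; rewrite big_ord_recl -EFinM.
    by congr (_ * _)%:E; apply: eq_bigr => i _; rewrite tnthS.
  - by apply/measurable_EFinP; apply: (mprod n (fun i => g (lift ord0 i))).
  - by move=> t _; rewrite lee_fin prodr_ge0.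
  - by rewrite lee_fin.
rewrite ge0_integralZr//.
- by apply/measurable_EFinP; exact: mg.
- by move=> x _; rewrite lee_fin.
- by apply: integral_ge0 => t _; rewrite lee_fin prodr_ge0.
Qed.

Definition set_tnth n (t : n.-tuple RT) (l : 'I_n) (s : R) : n.-tuple RT :=
  [tuple if m == l then s else tnth t m | m < n].

Lemma set_tnth_ord0 n (x s : RT) (t : n.-tuple RT) :
  set_tnth (tuple_cons (x, t)) ord0 s = tuple_cons (s, t).
Proof.
apply: eq_from_tnth => i; rewrite tnth_mktuple.
case: (unliftP ord0 i) => [j ->|->]; last by rewrite eqxx !tnth0.
by rewrite eq_sym (negbTE (neq_lift _ _)) !tnthS.
Qed.

Lemma set_tnth_lift n (x s : RT) (t : n.-tuple RT) (l : 'I_n) :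
  set_tnth (tuple_cons (x, t)) (lift ord0 l) s = tuple_cons (x, set_tnth t l s).
Proof.
apply: eq_from_tnth => i; rewrite tnth_mktuple.
case: (unliftP ord0 i) => [j ->|->]; last first.
  by rewrite (negbTE (neq_lift _ _)) !tnth0.
by rewrite !tnthS tnth_mktuple (inj_eq lift_inj).
Qed.

(** Fubini with coordinate [l] integrated innermost: coordinates are peeled off from the left until
    [l] is the head, where the order of integration is exchanged. *)
Lemma integral_tuple_eq0 n (l : 'I_n) (F : n.-tuple RT -> R) :
  (leb n).-integrable setT (EFin \o F) ->
  (forall t, \int[mu]_s (F (set_tnth t l s))%:E = 0)%E ->
  (\int[leb n]_t (F t)%:E = 0)%E.
Proof.
elim: n l F => [[]//|n IH] l F iF F0.
have mF := measurable_int _ iF.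
pose G (p : RT * n.-tuple RT) := (F (tuple_cons p))%:E.
have mG : measurable_fun setT G.
  exact: (measurableT_comp mF (measurable_tuple_cons (n:=n))).
have iG : (product_measure1 mu (leb n)).-integrable setT G.
  apply/integrableP; split => //.
  move/integrableP : iF => [_]; apply: le_lt_trans.
  rewrite (ge0_integral_pushforward (measurable_tuple_cons (n:=n)))//.
  exact: measurableT_comp.
transitivity (\int[product_measure1 mu (leb n)]_p G p)%E.
  exact: (integral_pushforward (measurable_tuple_cons (n:=n))).
case: (unliftP ord0 l) => [j lE|lE].
  rewrite -(integral12_prod_meas1 iG).
  (* Only almost every slice of an integrable function is integrable, so the induction hypothesis
     applies for almost every head [x]. *)
  have := ae_integrable1 iG.
  rewrite -[RHS](integral0 mu setT) => ae1; apply: ae_eq_integral => //.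
  - exact: measurable_fubini_F iG.
  - apply: filterS ae1 => x ix _ /=.
    apply: (IH j (fun t => F (tuple_cons (x, t)))) => // t.
    by under eq_integral do rewrite -set_tnth_lift -lE.
rewrite -(integral21_prod_meas1 iG) -[RHS](integral0 (leb n) setT).
(* The entry [0] is a placeholder: [set_tnth] overwrites the head. *)
apply: eq_integral => t _; rewrite -[RHS](F0 (tuple_cons (0, t))).
by rewrite lE; under [RHS]eq_integral do rewrite set_tnth_ord0.
Qed.

End lebesgue_tuple_integral.

Section gaussian_domination.
Context {R : realType}.
Local Notation mu := (@lebesgue_measure R).
Local Notation leb n := (lebesgue_tuple R n).
Local Notation RT := (measurableTypeR R).

(** A product rather than a norm: its powers dominate every polynomial in the coordinates, and its
    Gaussian integrals factorise over the coordinates. *)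
Definition sqr_weight n (t : n.-tuple RT) : R :=
  \prod_(i < n) (1 + tnth t i ^+ 2).

Definition gauss_weight (c : R) n (t : n.-tuple RT) : R :=
  \prod_(i < n) expR (- (c * tnth t i ^+ 2)).

Lemma gauss_weight_gt0 c n (t : n.-tuple RT) : 0 < gauss_weight c t.
Proof. by apply: prodr_gt0 => i _; exact: expR_gt0. Qed.

Lemma sqr_weight_ge1 n (t : n.-tuple RT) : 1 <= sqr_weight t.
Proof.
rewrite /sqr_weight; elim/big_ind: _ => // [x y|i _].
  exact: mulr_ege1.
by rewrite lerDl sqr_ge0.
Qed.

Lemma sqr_weight_tnth n (t : n.-tuple RT) i : 1 + tnth t i ^+ 2 <= sqr_weight t.
Proof.
rewrite /sqr_weight (bigD1 i)//= ler_peMr ?addr_ge0 ?sqr_ge0//.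
elim/big_ind: _ => // [x y|j _]; first exact: mulr_ege1.
by rewrite lerDl sqr_ge0.
Qed.

Lemma measurable_sqr_weight n : measurable_fun setT (@sqr_weight n).
Proof.
apply: measurable_prod => i _; apply: measurable_funD => //.
by apply: measurable_funX; exact: measurable_tnth.
Qed.

Lemma measurable_gauss_weight c n : measurable_fun setT (@gauss_weight c n).
Proof.
apply: measurable_prod => i _; apply: measurableT_comp => //.
apply: measurable_funN; apply: measurable_funM => //.
by apply: measurable_funX; exact: measurable_tnth.
Qed.

Lemma sqr_pow_gauss_bound (c : R) (K : nat) : 0 < c ->
  exists2 C : R, 0 <= C & forall s : R,
  (1 + s ^+ 2) ^+ K * expR (- (c * s ^+ 2)) <= C * expR (- (c / 2 * s ^+ 2)).
Proof.
move=> c0; have c20 : 0 < c / 2 by rewrite divr_gt0.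
(* Half of the exponent absorbs the polynomial: [e^v >= v^(K+1) / (K+1)!] at [v = (c/2) (1 + s^2)],
   and [e^(c/2)] accounts for the 1 in [v]. *)
exists (K.+1`!%:R * expR (c / 2) * (c / 2) ^- K.+1).
  by rewrite !mulr_ge0 ?expR_ge0// invr_ge0 exprn_ge0 ?ltW.
move=> s; have s1 : 1 <= 1 + s ^+ 2 by rewrite lerDl sqr_ge0.
have -> : - (c * s ^+ 2) = - (c / 2 * s ^+ 2) - c / 2 * s ^+ 2 by field.
rewrite expRD mulrCA mulrC ler_wpM2r ?expR_ge0// expRN.
rewrite ler_pdivrMr ?expR_gt0//.
apply: (@le_trans _ _ ((1 + s ^+ 2) ^+ K.+1)).
  by rewrite ler_weXn2l.
have := @expR_ge1Dxn R (c / 2 * (1 + s ^+ 2)) K.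
rewrite mulr_ge0 ?(ltW c20) ?(le_trans _ s1)// => /(_ isT) H.
have {}H : (c / 2 * (1 + s ^+ 2)) ^+ K.+1 / K.+1`!%:R <= expR (c / 2 * (1 + s ^+ 2)).
  by apply: le_trans H; rewrite lerDr.
rewrite exprMn ler_pdivrMr ?ltr0n ?fact_gt0// in H.
rewrite -(ler_pM2l (exprn_gt0 K.+1 c20)) (le_trans H)//.
rewrite mulrDr mulr1 expRD le_eqVlt; apply/orP; left; apply/eqP.
by field; rewrite gt_eqF// exprn_gt0.
Qed.

Lemma integrable_gauss (c : R) : 0 < c ->
  mu.-integrable setT (fun x => (expR (- (c * x ^+ 2)))%:E).
Proof.
(* The Gaussian is a multiple of the centred normal density of variance [1 / (2 c)]. *)
move=> c0; pose s := Num.sqrt ((2 * c)^-1).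
have c2 : 0 < (2 * c)^-1 by rewrite invr_gt0 mulr_gt0.
have s0 : s != 0 by rewrite gt_eqF// sqrtr_gt0.
have := @integrable_normal_pdf R 0 s.
move=> /(integrableZl measurableT (normal_peak s)^-1).
apply: eq_integrable => // x _.
rewrite /= -EFinM /normal_pdf (negbTE s0) mulKf; last first.
  by rewrite gt_eqF// normal_peak_gt0.
rewrite /normal_fun subr0 sqr_sqrtr ?(ltW c2)//; congr (expR _)%:E.
rewrite -mulr_natr; field; rewrite gt_eqF//.
Qed.

Lemma integrable_gauss_weight (c : R) n : 0 < c ->
  (leb n).-integrable setT (fun t => (gauss_weight c t)%:E).
Proof.
move=> c0; apply/integrableP; split.
  by apply/measurable_EFinP; exact: measurable_gauss_weight.
under eq_integral => t _ do
  rewrite gee0_abs ?lee_fin ?(ltW (gauss_weight_gt0 c t))// /gauss_weight.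
rewrite (integral_prod_tnth (g := fun i x => expR (- (c * x ^+ 2)))) => [||i x].
- have /integrableP[_] := integrable_gauss c0.
  under eq_integral => x _ do rewrite gee0_abs ?lee_fin ?expR_ge0//.
  move=> lty; rewrite ltey_eq; apply/orP; left.
  elim/big_ind: _ => // [x y|i _]; first exact: fin_numM.
  rewrite ge0_fin_numE//; apply: integral_ge0 => x _.
  by rewrite lee_fin expR_ge0.
- move=> _; apply: measurableT_comp => //; apply: measurable_funN.
  by apply: measurable_funM => //; exact: measurable_funX.
- exact: expR_ge0.
Qed.

Lemma integrable_gauss_dominated (c C : R) K n (f : n.-tuple RT -> R) :
  0 < c -> measurable_fun setT f ->
  (forall t, `|f t| <= C * (sqr_weight t ^+ K * gauss_weight c t)) ->
  (leb n).-integrable setT (EFin \o f).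
Proof.
move=> c0 mf fC.
have [D D0 DP] := sqr_pow_gauss_bound K c0.
have C0 : 0 <= C.
  have := le_trans (normr_ge0 _) (fC (nseq_tuple n (0:R))).
  rewrite pmulr_lge0// mulr_gt0 ?gauss_weight_gt0// exprn_gt0//.
  exact: lt_le_trans (sqr_weight_ge1 _).
have c20 : 0 < c / 2 by rewrite divr_gt0.
have := integrableZl measurableT (C * D ^+ n) (integrable_gauss_weight n c20).
apply: le_integrable => //; first exact/measurable_EFinP.
move=> t _ /=; rewrite lee_fin (le_trans (fC t))//.
rewrite ger0_norm; last first.
  by rewrite !mulr_ge0 ?exprn_ge0// ltW// gauss_weight_gt0.
rewrite -mulrA ler_wpM2l// /sqr_weight /gauss_weight -prodrXl -big_split/=.
rewrite -[in D ^+ n](card_ord n) -prodr_const -big_split/=.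
apply: ler_prod => i _; rewrite DP andbT.
by rewrite mulr_ge0 ?expR_ge0// exprn_ge0// addr_ge0// sqr_ge0.
Qed.

(** The other coordinates are frozen, so their factor goes into a constant depending on [t]; this
    suffices to kill boundary terms along a single line. *)
Lemma gauss_slice_bound (c : R) K n (t : n.-tuple RT) l : 0 < c ->
  exists2 D : R, 0 <= D & forall s : R,
  sqr_weight (set_tnth t l s) ^+ K * gauss_weight c (set_tnth t l s) <=
    D * expR (- (c / 2 * s ^+ 2)).
Proof.
move=> c0; have [D D0 DP] := sqr_pow_gauss_bound K c0.
pose A := \prod_(i < n | i != l) ((1 + tnth t i ^+ 2) ^+ K *
  expR (- (c * tnth t i ^+ 2))).
have A0 : 0 <= A.
  apply: prodr_ge0 => i _.
  by rewrite mulr_ge0 ?expR_ge0// exprn_ge0// addr_ge0// sqr_ge0.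
exists (D * A); first exact: mulr_ge0.
move=> s; rewrite /sqr_weight /gauss_weight -prodrXl -big_split/= (bigD1 l)//=.
rewrite tnth_mktuple eqxx [leRHS]mulrAC; apply: ler_pM => //.
- by rewrite mulr_ge0 ?expR_ge0// exprn_ge0// addr_ge0// sqr_ge0.
- apply: prodr_ge0 => i _.
  by rewrite mulr_ge0 ?expR_ge0// exprn_ge0// addr_ge0// sqr_ge0.
- apply: ler_prod => i il; rewrite tnth_mktuple (negbTE il) lexx andbT.
  by rewrite mulr_ge0 ?expR_ge0// exprn_ge0// addr_ge0// sqr_ge0.
Qed.

(** Fundamental theorem of calculus on growing symmetric intervals: the Gaussian bound makes the
    boundary values vanish and dominated convergence passes to the whole line. *)
Lemma integral_derive_eq0 (F f : R -> R) (c C : R) : 0 < c ->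
  (forall s : R, is_derive s 1 F (f s)) -> continuous f ->
  (forall s, `|F s| <= C * expR (- (c * s ^+ 2))) ->
  mu.-integrable setT (EFin \o f) -> (\int[mu]_s (f s)%:E = 0)%E.
Proof.
move=> c0 dF cf FC if_.
(* Endpoints at [k + 1] keep the interval nondegenerate at [k = 0]. *)
pose I k : set R := `[- k.+1%:R, k.+1%:R]%classic.
have mI k : measurable (I k) by exact: measurable_itv.
have FI k : (\int[mu]_(x in I k) (f x)%:E = (F k.+1%:R - F (- k.+1%:R))%:E)%E.
  rewrite EFinB; apply: continuous_FTC2.
  - by rewrite (@lt_trans _ _ 0)// oppr_lt0.
  - by apply: continuous_subspaceT => x; exact: cf.
  - have cF x : {for x, continuous F}.
      apply: differentiable_continuous; apply/derivable1_diffP.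
      by have [] := dF x.
    split.
    + by move=> x _; have [] := dF x.
    + by apply: cvg_at_right_filter; exact: cF.
    + by apply: cvg_at_left_filter; exact: cF.
  - by move=> x _; rewrite derive1E; have [] := dF x.
have := @dominated_convergence _ _ _ mu setT measurableT
  (fun k => (EFin \o f) \_ (I k)) (EFin \o f) (fun x => `|(f x)%:E|)%E.
have mf := measurable_int _ if_.
case.
- move=> k; apply/measurable_restrict => //; first exact: mI.
  by rewrite setTI; exact: measurable_funTS.
- exact: mf.
- apply: aeW => x _; apply: cvg_near_cst.
  near=> k; rewrite patchE mem_set//= /I/= in_itv/= -ler_norml.
  rewrite ltW//; apply: lt_le_trans (_ : k%:R <= _); last by rewrite ler_nat.
  by near: k; exact: nbhs_infty_gtr.
- exact: integrable_abse.
- apply: aeW => x k _; rewrite patchE; case: ifP => _ //=.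
  by rewrite normr0 lee_fin.
move=> _ _ lim1.
have lim2 : (\int[mu]_x ((EFin \o f) \_ (I k)) x @[k --> \oo] --> 0%:E)%E.
  under eq_fun do rewrite -integral_mkcond FI.
  apply/cvg_EFin; first by apply: nearW.
  rewrite (_ : fine \o _ = fun k => F k.+1%:R - F (- k.+1%:R))//.
  have C0 : 0 <= C.
    have := le_trans (normr_ge0 _) (FC 0).
    by rewrite pmulr_lge0// expR_gt0.
  have H : (C / c * harmonic k @[k --> \oo] --> (0:R)).
    by rewrite -[X in _ --> X](mulr0 (C / c)); apply: cvgM; [exact: cvg_cst|exact: cvg_harmonic].
  (* With [m = k + 1], [e^v >= 1 + v] and [m <= m^2] give [e^(-c m^2) <= 1 / (c m)]; this crude
     decay is enough. *)
  have FH k x : x ^+ 2 = k.+1%:R ^+ 2 -> `|F x| <= C / c * harmonic k.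
    move=> xk; rewrite (le_trans (FC x))// -mulrA ler_wpM2l// xk expRN.
    rewrite /harmonic/= -invfM lef_pV2 ?posrE ?expR_gt0 ?mulr_gt0//.
    rewrite (le_trans _ (expR_ge1Dx _))// -[leLHS]add0r lerD// ler_pM2l//.
    by rewrite expr2 ler_peMr// ler1n.
  have cvg0 x : (forall k, x k ^+ 2 = k.+1%:R ^+ 2) ->
      F (x k) @[k --> \oo] --> (0:R).
    move=> xk; apply/norm_cvg0P; apply: (squeeze_cvgr _ (cvg_cst 0) H).
    by apply: nearW => k; rewrite normr_ge0/= FH.
  rewrite -[X in _ --> X](subrr 0); apply: cvgB.
  - exact: cvg0.
  - by apply: cvg0 => k; rewrite sqrrN.
rewrite -[LHS](cvg_lim (@ereal_hausdorff R) lim1).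
exact: (cvg_lim (@ereal_hausdorff R) lim2).
Unshelve. all: by end_near.
Qed.

End gaussian_domination.

(** * Functions of polynomial growth and their partial derivatives *)

Section tame_functions.
Context {R : realType}.
Local Notation mu := (@lebesgue_measure R).
Local Notation leb n := (lebesgue_tuple R n).
Local Notation RT := (measurableTypeR R).

Definition poly_bounded n (f : n.-tuple RT -> R) :=
  exists (C : R) (K : nat), 0 <= C /\ forall t, `|f t| <= C * sqr_weight t ^+ K.

(* Only continuity in each variable separately is required: integration by parts
   is carried out one coordinate at a time. *)
Definition slice_continuous n (f : n.-tuple RT -> R) :=
  forall t l, continuous (fun s : R => f (set_tnth t l s)).

(** Closed under the ring operations and integrable against both the regularised and the limiting
    density, so that the side conditions of the integrations by parts become structural. *)
Definition tame n (f : n.-tuple RT -> R) :=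
  [/\ measurable_fun setT f, slice_continuous f & poly_bounded f].

Lemma tame_cst n (a : R) : tame (fun _ : n.-tuple RT => a).
Proof.
split => //; first by move=> t l; exact: cst_continuous.
by exists `|a|, 0%N; split => // t; rewrite expr0 mulr1.
Qed.

Lemma tame_tnth n (i : 'I_n) : tame (fun t : n.-tuple RT => tnth t i).
Proof.
split; first exact: measurable_tnth.
  move=> t l; under eq_fun do rewrite tnth_mktuple.
  case: eqP => _ s; [exact: cvg_id|exact: cvg_cst].
exists 1, 1%N; split => // t; rewrite mul1r expr1.
apply: le_trans (sqr_weight_tnth t i).
rewrite -real_normK ?num_real//; set a := `|_|.
by have := sqr_ge0 (a - 1 / 2); nra.
Qed.

Lemma tameD n (f g : n.-tuple RT -> R) : tame f -> tame g ->
  tame (fun t => f t + g t).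
Proof.
move=> [mf cf [C [K [C0 fC]]]] [mg cg [D [L [D0 gD]]]]; split.
- exact: measurable_funD.
- by move=> t l s; apply: cvgD; [exact: cf|exact: cg].
- exists (C + D), (K + L)%N; split; first exact: addr_ge0.
  move=> t; rewrite (le_trans (ler_normD _ _))// mulrDl lerD//.
    by rewrite (le_trans (fC t))// ler_wpM2l// ler_weXn2l ?sqr_weight_ge1 ?leq_addr.
  by rewrite (le_trans (gD t))// ler_wpM2l// ler_weXn2l ?sqr_weight_ge1 ?leq_addl.
Qed.

Lemma tameM n (f g : n.-tuple RT -> R) : tame f -> tame g ->
  tame (fun t => f t * g t).
Proof.
move=> [mf cf [C [K [C0 fC]]]] [mg cg [D [L [D0 gD]]]]; split.
- exact: measurable_funM.
- by move=> t l s; apply: cvgM; [exact: cf|exact: cg].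
- exists (C * D), (K + L)%N; split; first exact: mulr_ge0.
  by move=> t; rewrite normrM exprD mulrACA ler_pM.
Qed.

Lemma tameZ n a (f : n.-tuple RT -> R) : tame f -> tame (fun t => a * f t).
Proof. by move=> tf; apply: tameM => //; exact: tame_cst. Qed.

Lemma tameB n (f g : n.-tuple RT -> R) : tame f -> tame g ->
  tame (fun t => f t - g t).
Proof.
move=> tf tg; apply: tameD => //.
by under eq_fun do rewrite -mulN1r; exact: tameZ.
Qed.

Lemma tameX n k (f : n.-tuple RT -> R) : tame f -> tame (fun t => f t ^+ k).
Proof.
move=> tf; elim: k => [|k IH].
  by under eq_fun do rewrite expr0; exact: tame_cst.
by under eq_fun do rewrite exprS; exact: tameM.
Qed.

Lemma tame_sum n I (r : seq I) (P : pred I) (f : I -> n.-tuple RT -> R) :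
  (forall i, P i -> tame (f i)) -> tame (fun t => \sum_(i <- r | P i) f i t).
Proof.
move=> tf; elim: r => [|i r IH].
  by under eq_fun do rewrite big_nil; exact: tame_cst.
under eq_fun do rewrite big_cons.
by case: (P i) (tf i) => // /(_ isT) tfi; exact: tameD.
Qed.

Lemma tame_prod n I (r : seq I) (P : pred I) (f : I -> n.-tuple RT -> R) :
  (forall i, P i -> tame (f i)) -> tame (fun t => \prod_(i <- r | P i) f i t).
Proof.
move=> tf; elim: r => [|i r IH].
  by under eq_fun do rewrite big_nil; exact: tame_cst.
under eq_fun do rewrite big_cons.
by case: (P i) (tf i) => // /(_ isT) tfi; exact: tameM.
Qed.

Lemma tameV n (e : R) (f : n.-tuple RT -> R) : 0 < e -> (forall t, e <= f t) ->
  tame f -> tame (fun t => (f t)^-1).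
Proof.
move=> e0 ef [mf cf _].
have f0 t : 0 < f t by exact: lt_le_trans (ef t).
split.
- under eq_fun => t do rewrite -powR_inv1 ?(ltW (f0 t))//.
  exact: (measurableT_comp (measurable_powR _) mf).
- by move=> t l s; apply: cvgV; [rewrite gt_eqF|exact: cf].
- exists e^-1, 0%N; split; first by rewrite invr_ge0 ltW.
  move=> t; rewrite expr0 mulr1 ger0_norm ?invr_ge0 ?(ltW (f0 t))//.
  by rewrite lef_pV2 ?posrE.
Qed.

Definition pderiv n (l : 'I_n) (F F' : n.-tuple RT -> R) :=
  forall t (s : R), is_derive s 1 (fun u : R => F (set_tnth t l u))
                              (F' (set_tnth t l s)).

Lemma pderiv_eq n (l : 'I_n) (F G F' : n.-tuple RT -> R) :
  pderiv l F F' -> F' =1 G -> pderiv l F G.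
Proof. by move=> dF FG t s; apply: is_derive_eq (dF t s) _. Qed.

Lemma pderiv_cst n (l : 'I_n) a : pderiv l (fun=> a) (fun=> 0).
Proof. by move=> t s; exact: is_derive_cst. Qed.

Lemma pderiv_tnth n (l k : 'I_n) :
  pderiv l (fun t => tnth t k) (fun=> (k == l)%:R).
Proof.
move=> t s; under eq_fun do rewrite tnth_mktuple.
by case: eqP => _; [exact: is_derive_id|exact: is_derive_cst].
Qed.

Lemma pderivD n (l : 'I_n) F G F' G' : pderiv l F F' -> pderiv l G G' ->
  pderiv l (fun t => F t + G t) (fun t => F' t + G' t).
Proof. by move=> dF dG t s; exact: is_deriveD. Qed.

Lemma pderivM n (l : 'I_n) F G F' G' : pderiv l F F' -> pderiv l G G' ->
  pderiv l (fun t => F t * G t) (fun t => F' t * G t + F t * G' t).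
Proof.
move=> dF dG t s; apply: is_derive_eq (is_deriveM (dF t s) (dG t s)) _.
by rewrite addrC; congr (_ + _); exact: mulrC.
Qed.

Lemma pderivZ n (l : 'I_n) a F F' : pderiv l F F' ->
  pderiv l (fun t => a * F t) (fun t => a * F' t).
Proof.
move=> dF; apply: pderiv_eq (pderivM (pderiv_cst l a) dF) _ => t /=.
by rewrite mul0r add0r.
Qed.

Lemma pderivB n (l : 'I_n) F G F' G' : pderiv l F F' -> pderiv l G G' ->
  pderiv l (fun t => F t - G t) (fun t => F' t - G' t).
Proof. by move=> dF dG t s; exact: is_deriveB. Qed.

Lemma pderivX n (l : 'I_n) k F F' : pderiv l F F' ->
  pderiv l (fun t => F t ^+ k) (fun t => k%:R * F t ^+ k.-1 * F' t).
Proof. by move=> dF t s; have := is_deriveX k (dF t s); rewrite exprfctE. Qed.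

Lemma pderiv_sum n (l : 'I_n) I (r : seq I) (P : pred I) (F F' : I -> n.-tuple RT -> R) :
  (forall i, P i -> pderiv l (F i) (F' i)) ->
  pderiv l (fun t => \sum_(i <- r | P i) F i t)
           (fun t => \sum_(i <- r | P i) F' i t).
Proof.
move=> dF; elim: r => [|i r IH] t s.
  by under eq_fun do rewrite big_nil; rewrite big_nil; exact: is_derive_cst.
under eq_fun do rewrite big_cons; rewrite big_cons.
case: (P i) (dF i) => [/(_ isT) dFi|_]; last exact: IH.
exact: is_deriveD (dFi t s) (IH t s).
Qed.

Lemma pderiv_expR n (l : 'I_n) F F' : pderiv l F F' ->
  pderiv l (fun t => expR (F t)) (fun t => F' t * expR (F t)).
Proof.
move=> dF t s.
have := is_derive1_comp (is_derive_expR (F (set_tnth t l s))) (dF t s).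
by move/is_derive_eq; apply; rewrite mulrC.
Qed.

Lemma pderiv_ln n (l : 'I_n) F F' : (forall t, 0 < F t) -> pderiv l F F' ->
  pderiv l (fun t => ln (F t)) (fun t => F' t / F t).
Proof.
move=> F0 dF t s.
have := is_derive1_comp (is_derive1_ln (F0 (set_tnth t l s))) (dF t s).
by move/is_derive_eq; apply; rewrite mulrC.
Qed.

Lemma pderiv_continuous n (l : 'I_n) F F' t : pderiv l F F' ->
  continuous (fun s : R => F (set_tnth t l s)).
Proof.
move=> dF s; apply: differentiable_continuous; apply/derivable1_diffP.
by have [] := dF t s.
Qed.

End tame_functions.

(** * The regularised and the Gaussian beta density *)

Section regularized_density.
Context {R : realType}.
Local Notation mu := (@lebesgue_measure R).
Local Notation leb n := (lebesgue_tuple R n).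
Local Notation RT := (measurableTypeR R).

(* Replacing |x_k - x_j|^b by ((x_k - x_j)^2 + e)^(b/2) makes the density smooth
   for every b > 0, so integration by parts produces no boundary terms at
   collisions; e is sent to 0 afterwards. *)
Definition sqr_gap (e : R) n (k j : 'I_n) (t : n.-tuple RT) : R :=
  (tnth t k - tnth t j) ^+ 2 + e.

(** The double sum runs over ordered pairs, hence [b / 4]: each unordered pair carries the exponent
    [b / 2] on the squared gap, that is [b] on the distance. *)
Definition reg_energy (c b e : R) n (t : n.-tuple RT) : R :=
  \sum_(k < n) (- (c / 2)) * tnth t k ^+ 2 +
  b / 4 * \sum_(k < n) \sum_(j < n | j != k) ln (sqr_gap e k j t).

Definition reg_density (c b e : R) n (t : n.-tuple RT) : R :=
  expR (reg_energy c b e t).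

(** Logarithmic derivative of [reg_density] in coordinate [l], left in the shape the differentiation
    rules produce; [sum_reg_force] sums out the Kronecker deltas. *)
Definition reg_force (c b e : R) n (l : 'I_n) (t : n.-tuple RT) : R :=
  \sum_(k < n) (- (c / 2)) * (2 * tnth t k ^+ 1 * (k == l)%:R) +
  b / 4 * \sum_(k < n) \sum_(j < n | j != k)
    2 * (tnth t k - tnth t j) * ((k == l)%:R - (j == l)%:R) / sqr_gap e k j t.

Lemma sqr_gap_gt0 (e : R) n (k j : 'I_n) t : 0 < e -> 0 < sqr_gap e k j t.
Proof. by move=> e0; rewrite ltr_wpDl ?sqr_ge0. Qed.

Lemma tame_sqr_gap (e : R) n (k j : 'I_n) : tame (sqr_gap e k j).
Proof.
apply: tameD; last exact: tame_cst.
by apply: tameX; apply: tameB; exact: tame_tnth.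
Qed.

Lemma pderiv_reg_density (c b e : R) n (l : 'I_n) : 0 < e ->
  pderiv l (@reg_density c b e n)
    (fun t => reg_force c b e l t * reg_density c b e t).
Proof.
move=> e0; apply: pderiv_expR; apply: pderivD.
  apply: pderiv_sum => k _; apply: pderivZ; apply: (pderivX 2).
  exact: pderiv_tnth.
apply: pderivZ; apply: pderiv_sum => k _; apply: pderiv_sum => j _.
apply: pderiv_ln => [t|]; first exact: sqr_gap_gt0.
apply: pderiv_eq (pderivD (pderivX 2
  (pderivB (pderiv_tnth l k) (pderiv_tnth l j))) (pderiv_cst l e)) _ => t /=.
by rewrite addr0 expr1.
Qed.

Lemma tame_reg_force (c b e : R) n (l : 'I_n) : 0 < e ->
  tame (@reg_force c b e n l).
Proof.
move=> e0; apply: tameD.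
  apply: tame_sum => k _; apply: tameZ; apply: tameM; last exact: tame_cst.
  by apply: tameZ; apply: tameX; exact: tame_tnth.
apply: tameZ; apply: tame_sum => k _; apply: tame_sum => j _.
apply: tameM; last first.
  apply: (tameV e0 (f := sqr_gap e k j)); last exact: tame_sqr_gap.
  by move=> t; rewrite lerDr sqr_ge0.
apply: tameM; last exact: tame_cst.
by apply: tameZ; apply: tameB; exact: tame_tnth.
Qed.

Lemma measurable_reg_density (c b e : R) n : 0 < e ->
  measurable_fun setT (@reg_density c b e n).
Proof.
move=> e0; apply: measurableT_comp => //; apply: measurable_funD.
  apply: measurable_sum => k; apply: measurable_funM => //.
  by apply: measurable_funX; exact: measurable_tnth.
apply: measurable_funM => //.
have -> : (fun t : n.-tuple RT =>
    \sum_(k < n) \sum_(j < n | j != k) ln (sqr_gap e k j t)) =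
  fun t => \sum_(k < n) \sum_(j < n) ln (sqr_gap e k j t) *+ (j != k).
  by apply/funext => t; apply: eq_bigr => k _; rewrite big_mkcond/=;
    apply: eq_bigr => j _; case: (j == k).
apply: measurable_sum => k; apply: measurable_sum => j.
have [mg _ _] := tame_sqr_gap e k j.
under eq_fun do rewrite -mulr_natr.
by apply: measurable_funM => //; exact: (measurableT_comp (@measurable_ln R) mg).
Qed.

(** Constants independent of [e] give a majorant for the limit [e -> 0]. Each squared gap is at most
    [2 (1 + x^2) (1 + y^2) <= 2 S^2] with [S = sqr_weight t], there are at most [n^2] ordered pairs,
    and the resulting real exponent is rounded up to the integer [M]. *)
Lemma reg_density_bound (c b : R) n : 0 <= b ->
  exists (C : R) (K : nat), 0 <= C /\ forall (e : R) (t : n.-tuple RT), 0 < e <= 1 ->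
    reg_density c b e t <= C * (sqr_weight t ^+ K * gauss_weight (c / 2) t).
Proof.
move=> b0; pose a := b / 4 * (n%:R * n%:R).
have a0 : 0 <= a by rewrite mulr_ge0// divr_ge0.
pose M := (Num.truncn a).+1.
have aM : a <= M%:R by rewrite ltW// truncnS_gt.
exists (2 ^+ M), (2 * M)%N; split; first exact: exprn_ge0.
move=> e t /andP[e0 e1]; rewrite /reg_density expRD mulrA mulrC.
rewrite expR_sum; apply: ler_pM.
- by rewrite expR_ge0.
- by apply: prodr_ge0 => i _; exact: expR_ge0.
- rewrite exprM -exprMn -[leRHS]powR_mulrn; last by rewrite mulr_ge0 ?exprn_ge0// (le_trans _ (sqr_weight_ge1 t)).
  set S := sqr_weight t; have S1 : 1 <= S := sqr_weight_ge1 t.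
  have S21 : 1 <= 2 * S ^+ 2.
    by rewrite mulr_ege1 ?ler1n// exprn_ege1.
  rewrite /powR gt_eqF ?(lt_le_trans ltr01)// ler_expR.
  have L0 : 0 <= ln (2 * S ^+ 2) by rewrite ln_ge0.
  apply: (@le_trans _ _ (a * ln (2 * S ^+ 2))); last exact: ler_wpM2r.
  rewrite /a -[leRHS]mulrA ler_wpM2l ?divr_ge0// -mulrA !(mulr_natl _ n).
  have lnS k j : ln (sqr_gap e k j t) <= ln (2 * S ^+ 2).
    rewrite ler_ln ?posrE ?(sqr_gap_gt0 _ _ _ e0) ?(lt_le_trans ltr01)//.
    have := sqr_weight_tnth t k; have := sqr_weight_tnth t j.
    rewrite /sqr_gap -/S; set x := tnth t k; set y := tnth t j => yS xS.
    apply: (@le_trans _ _ (2 * ((1 + x ^+ 2) * (1 + y ^+ 2)))).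
      by have := sqr_ge0 (x + y); have := sqr_ge0 (x * y); nra.
    by rewrite expr2 ler_wpM2l// ler_pM// addr_ge0// sqr_ge0.
  apply: (@le_trans _ _ (\sum_(k < n) \sum_(j < n) ln (2 * S ^+ 2))).
    apply: ler_sum => k _; rewrite [leLHS]big_mkcond/=; apply: ler_sum => j _.
    by case: ifP.
  by rewrite !(sumr_const, card_ord).
- apply: ler_prod => i _; rewrite expR_ge0/= ler_expR.
  by rewrite mulNr.
Qed.

Lemma dominating_const_ge0 (c D : R) L n (f : n.-tuple RT -> R) :
  (forall t, `|f t| <= D * (sqr_weight t ^+ L * gauss_weight c t)) -> 0 <= D.
Proof.
move=> fD; have := le_trans (normr_ge0 _) (fD (nseq_tuple n (0 : R))).
rewrite pmulr_lge0// mulr_gt0 ?gauss_weight_gt0// exprn_gt0//.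
exact: lt_le_trans (sqr_weight_ge1 _).
Qed.

Lemma tame_reg_density_bound (c b e : R) n (f : n.-tuple RT -> R) :
  0 <= b -> 0 < e <= 1 -> tame f -> exists (D : R) (L : nat),
    forall t, `|f t * reg_density c b e t| <=
      D * (sqr_weight t ^+ L * gauss_weight (c / 2) t).
Proof.
move=> b0 e01 [_ _ [D [L [D0 DL]]]].
have [C [K [C0 CK]]] := reg_density_bound c n b0.
exists (D * C), (L + K)%N => t; rewrite normrM (ger0_norm (expR_ge0 _)).
apply: le_trans (ler_pM (normr_ge0 _) (expR_ge0 _) (DL t) (CK e t e01)) _.
by rewrite exprD le_eqVlt; apply/orP; left; apply/eqP; ring.
Qed.

Lemma integrable_tame_reg_density (c b e : R) n (f : n.-tuple RT -> R) :
  0 < c -> 0 <= b -> 0 < e <= 1 -> tame f ->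
  (leb n).-integrable setT (fun t => (f t * reg_density c b e t)%:E).
Proof.
move=> c0 b0 e01 tf; have [D [L DL]] := tame_reg_density_bound c b0 e01 tf.
have c20 : 0 < c / 2 by rewrite divr_gt0.
apply: (integrable_gauss_dominated c20 _ DL).
have [mf _ _] := tf; apply: measurable_funM => //.
by apply: measurable_reg_density; case/andP: e01.
Qed.

Lemma integral_pderiv_reg_density (c b e : R) n (l : 'I_n) F F' :
  0 < c -> 0 <= b -> 0 < e <= 1 -> tame F -> tame F' -> pderiv l F F' ->
  (\int[leb n]_t
    ((F' t + F t * reg_force c b e l t) * reg_density c b e t)%:E = 0)%E.
Proof.
move=> c0 b0 e01 tF tF' dF; have e0 : 0 < e by case/andP: e01.
have c20 : 0 < c / 2 by rewrite divr_gt0.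
have tG : tame (fun t => F' t + F t * reg_force c b e l t).
  by apply: tameD => //; apply: tameM => //; exact: tame_reg_force.
set G := fun t => _ in tG *.
have dG : pderiv l (fun t => F t * reg_density c b e t)
    (fun t => G t * reg_density c b e t).
  apply: pderiv_eq (pderivM dF (pderiv_reg_density c b l e0)) _ => t /=.
  by rewrite mulrA -mulrDl.
have [D [L DL]] := tame_reg_density_bound c b0 e01 tG.
have [mG cG _] := tG.
apply: (integral_tuple_eq0 (l := l) (F := fun t => G t * reg_density c b e t)).
  exact: integrable_tame_reg_density.
move=> t.
have [B B0 BP] := gauss_slice_bound L t l c20.
(* The rate [c / 2] of the density is halved once more, to absorb the polynomial factor on the
   slice. *)
have c40 : 0 < c / 2 / 2 by rewrite divr_gt0.
have cGr : continuous (fun s : R => G (set_tnth t l s) * reg_density c b e (set_tnth t l s)).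
  move=> s; apply: cvgM; first exact: cG.
  exact: (pderiv_continuous (pderiv_reg_density c b l e0)).
have [D' [L' DL']] := tame_reg_density_bound c b0 e01 tF.
have D0 := dominating_const_ge0 DL; have D'0 := dominating_const_ge0 DL'.
have [B' B'0 BP'] := gauss_slice_bound L' t l c20.
apply: (@integral_derive_eq0 _ (fun s => F (set_tnth t l s) * reg_density c b e (set_tnth t l s)) _ _ (D' * B') c40).
- by move=> s; exact: dG.
- exact: cGr.
- by move=> s; rewrite (le_trans (DL' _))// -[leRHS]mulrA ler_wpM2l.
- have := integrableZl measurableT (D * B) (integrable_gauss c40).
  apply: le_integrable => //.
    by apply/measurable_EFinP; exact: continuous_measurable_fun.
  move=> s _; rewrite /= lee_fin [leRHS]ger0_norm ?mulr_ge0 ?expR_ge0//.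
  by rewrite (le_trans (DL _))// -[leRHS]mulrA ler_wpM2l.
Qed.

End regularized_density.

Section beta_density.
Context {R : realType}.
Local Notation mu := (@lebesgue_measure R).
Local Notation leb n := (lebesgue_tuple R n).
Local Notation RT := (measurableTypeR R).

(** Two free parameters cover both ensembles: [c = b] at low temperature, [c = 1] and
    [b = 2 alpha / n] at high temperature. *)
Definition gauss_density (c b : R) n (t : n.-tuple RT) : R :=
  ME_density (fun l => expR (- (c * l ^+ 2 / 2))) b t.

Lemma gauss_density_ge0 c b n (t : n.-tuple RT) : 0 <= gauss_density c b t.
Proof.
rewrite mulr_ge0//; first by apply: prodr_ge0 => i _; exact: expR_ge0.
by apply: prodr_ge0 => i _; apply: prodr_ge0 => j _; exact: powR_ge0.
Qed.

Lemma prod_offdiag n (f : 'I_n -> 'I_n -> R) :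
  \prod_(k < n) \prod_(j < n | j != k) f k j =
  \prod_(k < n) \prod_(j < n | (j < k)%N) (f k j * f j k).
Proof.
under [RHS]eq_bigr do rewrite big_split/=.
rewrite big_split/= [X in _ = _ * X](exchange_big_dep predT)//=.
rewrite -big_split/=; apply: eq_bigr => k _.
rewrite (bigID (fun j : 'I_n => (j < k)%N))/=; congr (_ * _).
  by apply: eq_bigl => j; rewrite -val_eqE /=; case: ltngtP.
by apply: eq_bigl => j; rewrite -val_eqE /=; case: ltngtP.
Qed.

Lemma reg_densityE (c b e : R) n (t : n.-tuple RT) : 0 < e ->
  reg_density c b e t = \prod_(l < n) expR (- (c * tnth t l ^+ 2 / 2)) *
  \prod_(k < n) \prod_(j < n | (j < k)%N) sqr_gap e k j t `^ (b / 2).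
Proof.
move=> e0; rewrite /reg_density /reg_energy expRD expR_sum; congr (_ * _).
  by apply: eq_bigr => l _; congr expR; field.
rewrite mulr_sumr expR_sum.
under eq_bigr do rewrite mulr_sumr expR_sum.
rewrite prod_offdiag; apply: eq_bigr => k _; apply: eq_bigr => j _.
have g0 : 0 < sqr_gap e k j t by exact: sqr_gap_gt0.
have -> : sqr_gap e j k t = sqr_gap e k j t.
  by rewrite /sqr_gap -[in LHS]opprB sqrrN.
by rewrite /powR gt_eqF// -expRD; congr expR; field.
Qed.

(** At [d = 0] the base tends to 0 and the positive exponent sends the power to 0; elsewhere [powR]
    is continuous at [d ^+ 2]. *)
Lemma powR_sqr_gap_cvg (b d : R) : 0 < b ->
  (d ^+ 2 + harmonic k) `^ (b / 2) @[k --> \oo] --> `|d| `^ b.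
Proof.
move=> b0; have b20 : 0 < b / 2 by rewrite divr_gt0.
have -> : `|d| `^ b = (d ^+ 2) `^ (b / 2).
  have bE : b = 2%:R * (b / 2) by field.
  by rewrite [in LHS]bE powRrM powR_mulrn// real_normK// num_real.
have [->|d0] := eqVneq d 0.
  rewrite expr0n/= powR0 ?gt_eqF//.
  under eq_fun do rewrite add0r.
  have /cvg_at_rightP := powR_cvg0 b20; apply; split => [n|].
    exact: harmonic_gt0.
  exact: cvg_harmonic.
have d20 : 0 < d ^+ 2 by rewrite exprn_even_gt0.
have cp : {for d ^+ 2, continuous (@powR R ^~ (b / 2))}.
  apply: differentiable_continuous; apply/derivable1_diffP.
  by apply: derivable_powR; rewrite in_itv/= d20.
apply: (cvg_comp (fun k => d ^+ 2 + harmonic k) (@powR R ^~ (b / 2)) _ cp).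
suff : d ^+ 2 + harmonic k @[k --> \oo] --> d ^+ 2 + 0 by rewrite addr0.
by apply: cvgD; [exact: cvg_cst|exact: cvg_harmonic].
Qed.

Lemma cvg_prodr (T : Type) (F : set_system T) {FF : Filter F} I (r : seq I)
    (P : pred I) (f : I -> T -> R) (l : I -> R) :
  (forall i, P i -> f i x @[x --> F] --> l i) ->
  \prod_(i <- r | P i) f i x @[x --> F] --> \prod_(i <- r | P i) l i.
Proof. by apply: cvg_big; exact: mul_continuous. Qed.

Lemma cvg_sumr (T : Type) (F : set_system T) {FF : Filter F} I (r : seq I)
    (P : pred I) (f : I -> T -> R) (l : I -> R) :
  (forall i, P i -> f i x @[x --> F] --> l i) ->
  \sum_(i <- r | P i) f i x @[x --> F] --> \sum_(i <- r | P i) l i.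
Proof. by apply: cvg_big; exact: add_continuous. Qed.

Lemma reg_density_cvg (c b : R) n (t : n.-tuple RT) : 0 < b ->
  reg_density c b (harmonic k) t @[k --> \oo] --> gauss_density c b t.
Proof.
move=> b0; under eq_fun => k do rewrite reg_densityE ?harmonic_gt0//.
apply: cvgM; first exact: cvg_cst.
apply: cvg_prodr => k _; apply: cvg_prodr => j _.
exact: powR_sqr_gap_cvg.
Qed.

Lemma harmonic_itv01 k : 0 < @harmonic R k <= 1.
Proof. by rewrite harmonic_gt0/= invf_le1// ler1n. Qed.

Lemma tame_norm n (f : n.-tuple RT -> R) : tame f -> tame (fun t => `|f t|).
Proof.
move=> [mf cf [C [K [C0 CK]]]]; split; first exact: measurableT_comp.
  by move=> t l s; apply: cvg_norm; exact: cf.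
by exists C, K; split => // t; rewrite normr_id.
Qed.

(* Only the bound must be uniform in [k]; the limit [f] of the integrands
   may be taken modulo the zeros of the limiting density. *)
Lemma cvg_integral_reg_density (c b : R) n (f_ : nat -> n.-tuple RT -> R)
    (f g : n.-tuple RT -> R) :
  0 < c -> 0 < b -> (forall k, tame (f_ k)) -> tame g ->
  (forall k t, `|f_ k t| <= g t) ->
  (forall t, f_ k t * reg_density c b (harmonic k) t @[k --> \oo] -->
             f t * gauss_density c b t) ->
  (leb n).-integrable setT (fun t => (f t * gauss_density c b t)%:E) /\
  (\int[leb n]_t (f_ k t * reg_density c b (harmonic k) t)%:E @[k --> \oo] -->
   \int[leb n]_t (f t * gauss_density c b t)%:E)%E.
Proof.
move=> c0 b0 tf_ tg fg cvf.
have c20 : 0 < c / 2 by rewrite divr_gt0.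
have [_ _ [D [L [D0 DL]]]] := tg.
have [C [K [C0 CK]]] := reg_density_bound c n (ltW b0).
have mf_ (k : nat) : measurable_fun setT (fun t => f_ k t * reg_density c b (harmonic k) t).
  have [mf _ _] := tf_ k; apply: measurable_funM => //.
  by apply: measurable_reg_density; exact: harmonic_gt0.
pose G (t : n.-tuple RT) := D * C * (sqr_weight t ^+ (L + K) * gauss_weight (c / 2) t).
have G0 t : 0 <= G t.
  rewrite mulr_ge0 ?mulr_ge0 ?exprn_ge0 ?(ltW (gauss_weight_gt0 _ _))//.
  exact: le_trans (sqr_weight_ge1 t).
have iG : (leb n).-integrable setT (EFin \o G).
  apply: (integrable_gauss_dominated c20 (C := D * C) (K := (L + K)%N)).
    apply: measurable_funM => //; apply: measurable_funM.
      by apply: measurable_funX; exact: measurable_sqr_weight.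
    exact: measurable_gauss_weight.
  by move=> t; rewrite ger0_norm.
have [] := @dominated_convergence _ _ _ (leb n) setT measurableT
  (fun k t => (f_ k t * reg_density c b (harmonic k) t)%:E)
  (fun t => (f t * gauss_density c b t)%:E) (EFin \o G).
- by move=> k; apply/measurable_EFinP; exact: mf_.
- apply/measurable_EFinP; apply: (measurable_fun_cvg mf_).
  by move=> t _; exact: cvf.
- by apply: aeW => t _; apply/cvg_EFin; [exact: nearW|exact: cvf].
- exact: iG.
- apply: aeW => t k _ /=; rewrite lee_fin normrM (ger0_norm (expR_ge0 _)).
  have H1 : `|f_ k t| <= D * sqr_weight t ^+ L.
    by rewrite (le_trans (fg k t))// (le_trans (ler_norm _)).
  apply: le_trans (ler_pM (normr_ge0 _) (expR_ge0 _) H1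
    (CK _ t (harmonic_itv01 k))) _.
  by rewrite /G exprD le_eqVlt; apply/orP; left; apply/eqP; ring.
- by [].
Qed.

Lemma integrable_tame_gauss_density (c b : R) n (f : n.-tuple RT -> R) :
  0 < c -> 0 < b -> tame f ->
  (leb n).-integrable setT (fun t => (f t * gauss_density c b t)%:E).
Proof.
move=> c0 b0 tf.
have [] // := @cvg_integral_reg_density c b n (fun=> f) f (fun t => `|f t|) c0 b0.
- exact: tame_norm.
- by move=> t; apply: cvgM; [exact: cvg_cst|exact: reg_density_cvg].
Qed.

End beta_density.

(** * Loop equations *)

Section loop_equation.
Context {R : realType}.
Local Notation mu := (@lebesgue_measure R).
Local Notation leb n := (lebesgue_tuple R n).
Local Notation RT := (measurableTypeR R).

Definition psum (k : nat) n (t : n.-tuple RT) : R := \sum_(i < n) tnth t i ^+ k.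

Definition pprod (ks : seq nat) n (t : n.-tuple RT) : R :=
  \prod_(k <- ks) psum k t.

Fixpoint pprod_pderiv n (l : 'I_n) (ks : seq nat) (t : n.-tuple RT) : R :=
  if ks is k :: ks' then
    k%:R * tnth t l ^+ k.-1 * pprod ks' t + psum k t * pprod_pderiv l ks' t
  else 0.

(* The derivation [\sum_l x_l ^ j d/dx_l] applied to [pprod ks]. *)
Fixpoint pprod_derivation (j : nat) (ks : seq nat) n (t : n.-tuple RT) : R :=
  if ks is k :: ks' then
    k%:R * psum (k + j).-1 t * pprod ks' t + psum k t * pprod_derivation j ks' t
  else 0.

Lemma pprod_cons k ks n (t : n.-tuple RT) :
  pprod (k :: ks) t = psum k t * pprod ks t.
Proof. by rewrite /pprod big_cons. Qed.

Lemma tame_psum k n : tame (@psum k n).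
Proof. by apply: tame_sum => i _; apply: tameX; exact: tame_tnth. Qed.

Lemma tame_pprod ks n : tame (@pprod ks n).
Proof. by apply: tame_prod => k _; exact: tame_psum. Qed.

Lemma tame_pprod_pderiv n l ks : tame (@pprod_pderiv n l ks).
Proof.
elim: ks => [|k ks IH] /=; first exact: tame_cst.
apply: tameD; last by apply: tameM => //; exact: tame_psum.
apply: tameM; last exact: tame_pprod.
by apply: tameZ; apply: tameX; exact: tame_tnth.
Qed.

Lemma tame_pprod_derivation j ks n : tame (@pprod_derivation j ks n).
Proof.
elim: ks => [|k ks IH] /=; first exact: tame_cst.
apply: tameD; last by apply: tameM => //; exact: tame_psum.
by apply: tameM; [apply: tameZ; exact: tame_psum|exact: tame_pprod].
Qed.

Lemma sum_mul_delta n (f : 'I_n -> R) k : \sum_(l < n) f l * (k == l)%:R = f k.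
Proof.
rewrite (bigD1 k)//= eqxx mulr1 big1 ?addr0// => l lk.
by rewrite eq_sym (negbTE lk) mulr0.
Qed.

Lemma pderiv_psum k n (l : 'I_n) :
  pderiv l (@psum k n) (fun t => k%:R * tnth t l ^+ k.-1).
Proof.
apply: pderiv_eq (pderiv_sum _ (fun i _ => pderivX k (pderiv_tnth l i))) _ => t.
by rewrite /= (bigD1 l)//= eqxx mulr1 big1 ?addr0// => i /negbTE ->; rewrite mulr0.
Qed.

Lemma pderiv_pprod n (l : 'I_n) ks :
  pderiv l (@pprod ks n) (pprod_pderiv l ks).
Proof.
elim: ks => [|k ks IH] /=.
  have -> : @pprod [::] n = fun=> 1 by apply/funext => t; rewrite /pprod big_nil.
  exact: pderiv_cst.
have -> : @pprod (k :: ks) n = fun t => psum k t * pprod ks t.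
  by apply/funext => t; rewrite pprod_cons.
exact: pderivM (pderiv_psum k l) IH.
Qed.

Lemma pprod_derivationE j ks n (t : n.-tuple RT) :
  \sum_(l < n) tnth t l ^+ j * pprod_pderiv l ks t = pprod_derivation j ks t.
Proof.
elim: ks => [|k ks IH] /=; first by rewrite big1// => l _; rewrite mulr0.
rewrite -IH /psum !mulr_sumr mulr_suml -big_split/=; apply: eq_bigr => l _.
rewrite mulrDr; congr (_ + _); last by rewrite mulrCA.
rewrite mulrA; congr (_ * _); case: k => [|k]; first by rewrite !mul0r mulr0.
by rewrite mulrCA -exprD addnC.
Qed.

(** The quotient [(x_k^j - x_i^j) / (x_k - x_i)] written as a polynomial, hence defined, and tame,
    where coordinates coincide as well. *)
Definition divided_diff (j : nat) n (k i : 'I_n) (t : n.-tuple RT) : R :=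
  \sum_(a < j) tnth t k ^+ (j.-1 - a) * tnth t i ^+ a.

Lemma tame_divided_diff j n (k i : 'I_n) : tame (divided_diff j k i).
Proof.
by apply: tame_sum => a _; apply: tameM; apply: tameX; exact: tame_tnth.
Qed.

(** Over all pairs, diagonal included, the sum splits into products of power sums; the diagonal
    terms are [j x_k^(j-1)] and are subtracted. *)
Lemma sum_divided_diff j n (t : n.-tuple RT) :
  \sum_(k < n) \sum_(i < n | i != k) divided_diff j k i t =
  \sum_(a < j) psum (j.-1 - a) t * psum a t - j%:R * psum j.-1 t.
Proof.
apply/eqP; rewrite -subr_eq opprK; apply/eqP.
transitivity (\sum_(k < n) \sum_(i < n) divided_diff j k i t).
  rewrite [X in _ + X = _]mulr_sumr -big_split/=; apply: eq_bigr => k _.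
  rewrite [in RHS](bigD1 k)//= addrC; congr (_ + _).
  rewrite /divided_diff -[X in X%:R]card_ord -sumr_const mulr_suml.
  apply: eq_bigr => a _; rewrite mul1r -exprD subnK//.
  by rewrite -ltnS (ltn_predK (ltn_ord a)) ltn_ord.
rewrite /divided_diff; under eq_bigr do rewrite exchange_big/=.
rewrite exchange_big/=; apply: eq_bigr => a _.
by rewrite /psum mulr_suml; apply: eq_bigr => k _; rewrite mulr_sumr.
Qed.

(** Antisymmetry of the pair force pairs [x_k^j] with [x_i^j]: a pair contributes
    [(x_k^j - x_i^j) (x_k - x_i) / gap], a divided difference times a ratio that tends to 1 off the
    collisions as [e -> 0]. *)
Lemma sum_reg_force (c b e : R) j n (t : n.-tuple RT) :
  \sum_(l < n) tnth t l ^+ j * reg_force c b e l t =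
  - c * psum j.+1 t + b / 2 * \sum_(k < n) \sum_(i < n | i != k)
    divided_diff j k i t * ((tnth t k - tnth t i) ^+ 2 / sqr_gap e k i t).
Proof.
under eq_bigr do rewrite /reg_force mulrDr.
rewrite big_split/=; congr (_ + _).
  under eq_bigr do rewrite mulr_sumr.
  rewrite exchange_big/= /psum mulr_sumr; apply: eq_bigr => k _.
  under eq_bigr => l _ do rewrite !mulrA.
  rewrite (sum_mul_delta (fun l => _ ^+ j * _ * _ * _)).
  by rewrite expr1 exprS; field.
transitivity (\sum_(l < n) \sum_(k < n) \sum_(i < n | i != k)
    b / 4 * 2 * (tnth t k - tnth t i) / sqr_gap e k i t *
    (tnth t l ^+ j * (k == l)%:R - tnth t l ^+ j * (i == l)%:R)).
  apply: eq_bigr => l _; rewrite mulrCA !mulr_sumr; apply: eq_bigr => k _.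
  rewrite !mulr_sumr; apply: eq_bigr => i _.
  by set g := (sqr_gap _ _ _ _)^-1; ring.
rewrite exchange_big/= mulr_sumr; apply: eq_bigr => k _.
rewrite exchange_big/= mulr_sumr; apply: eq_bigr => i _.
rewrite -mulr_sumr sumrB !(sum_mul_delta (fun l => tnth t l ^+ j)) subrXX.
rewrite -/(divided_diff j k i t).
by set g := (sqr_gap _ _ _ _)^-1; field.
Qed.

(** Divergence of the field [x_l^j * pprod ks] with respect to the density, the interaction being
    already at [e = 0]. The terms come, in order, from differentiating [x_l^j], [pprod ks] and the
    logarithm of the density. *)
Definition loop_integrand (c b : R) j ks n (t : n.-tuple RT) : R :=
  j%:R * psum j.-1 t * pprod ks t + pprod_derivation j ks t +
  pprod ks t * (- c * psum j.+1 t + b / 2 *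
    (\sum_(a < j) psum (j.-1 - a) t * psum a t - j%:R * psum j.-1 t)).

Lemma integral_reg_loop (c b e : R) j ks n : 0 < c -> 0 < b -> 0 < e <= 1 ->
  (\int[leb n]_t ((j%:R * psum j.-1 t * pprod ks t + pprod_derivation j ks t +
    pprod ks t * (- c * psum j.+1 t + b / 2 *
      \sum_(k < n) \sum_(i < n | i != k)
      divided_diff j k i t * ((tnth t k - tnth t i) ^+ 2 / sqr_gap e k i t))) *
    reg_density c b e t)%:E = 0)%E.
Proof.
move=> c0 b0 e01; have e0 : 0 < e by case/andP: e01.
pose F' l (t : n.-tuple RT) := j%:R * tnth t l ^+ j.-1 * pprod ks t +
  tnth t l ^+ j * pprod_pderiv l ks t.
pose F l (t : n.-tuple RT) := tnth t l ^+ j * pprod ks t.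
have tF l : tame (F l).
  by apply: tameM; [apply: tameX; exact: tame_tnth|exact: tame_pprod].
have tF' l : tame (F' l).
  apply: tameD; apply: tameM; last exact: tame_pprod_pderiv.
  - by apply: tameZ; apply: tameX; exact: tame_tnth.
  - exact: tame_pprod.
  - by apply: tameX; exact: tame_tnth.
have dF l : pderiv l (F l) (F' l).
  apply: pderiv_eq (pderivM (pderivX j (pderiv_tnth l l)) (pderiv_pprod l ks)) _.
  by move=> t; rewrite /= eqxx mulr1.
transitivity (\int[leb n]_t (\sum_(l < n)
    ((F' l t + F l t * reg_force c b e l t) * reg_density c b e t)%:E))%E.
  apply: eq_integral => t _; rewrite sumEFin; congr EFin.
  rewrite -mulr_suml; congr (_ * _); rewrite big_split/=; congr (_ + _).
    rewrite /F' big_split/= pprod_derivationE -mulr_suml -mulr_sumr.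
    by [].
  rewrite -sum_reg_force mulr_sumr; apply: eq_bigr => l _.
  by rewrite /F mulrCA mulrA.
rewrite integral_sum//; last first.
  move=> l; apply: integrable_tame_reg_density => //; first exact: ltW.
  by apply: tameD => //; apply: tameM => //; exact: tame_reg_force.
apply: big1 => l _; apply: integral_pderiv_reg_density => //; exact: ltW.
Qed.

Lemma gauss_density_eq0 (c b : R) n (t : n.-tuple RT) k i : 0 < b -> i != k ->
  tnth t k = tnth t i -> gauss_density c b t = 0.
Proof.
move=> b0; wlog ik : i k / (i < k)%N => [H|] neq tki.
  move: (neq); rewrite -val_eqE neq_ltn => /orP[|] /H; apply => //.
  by rewrite eq_sym.
rewrite /gauss_density /ME_density [X in _ * X](bigD1 k)//=
  [X in _ * (X * _)](bigD1 i)//= tki subrr normr0.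
by rewrite powR0 ?gt_eqF// !(mul0r, mulr0).
Qed.

Lemma sqr_gap_ratio_le1 (e : R) n k i (t : n.-tuple RT) : 0 < e ->
  `|(tnth t k - tnth t i) ^+ 2 / sqr_gap e k i t| <= 1.
Proof.
move=> e0; have g0 := sqr_gap_gt0 k i t e0.
rewrite ger0_norm ?divr_ge0 ?sqr_ge0 ?(ltW g0)//.
by rewrite ler_pdivrMr// mul1r lerDl ltW.
Qed.

Lemma sqr_gap_ratio_cvg n k i (t : n.-tuple RT) : tnth t k != tnth t i ->
  (tnth t k - tnth t i) ^+ 2 / sqr_gap (harmonic m) k i t @[m --> \oo] --> (1 : R).
Proof.
move=> ki; have d0 : (tnth t k - tnth t i) ^+ 2 != 0.
  by rewrite sqrf_eq0 subr_eq0.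
set d := _ ^+ 2 in d0 *.
suff : d / (d + harmonic m) @[m --> \oo] --> d / (d + 0) by rewrite addr0 divff.
apply: cvgM; first exact: cvg_cst.
apply: cvgV; first by rewrite addr0.
by apply: cvgD; [exact: cvg_cst|exact: cvg_harmonic].
Qed.

(* At a configuration with a double point the density vanishes; elsewhere the
   regularised interaction converges to the divided differences. *)
Lemma integral_loop (c b : R) j ks n : 0 < c -> 0 < b ->
  (\int[leb n]_t (loop_integrand c b j ks t * gauss_density c b t)%:E = 0)%E.
Proof.
move=> c0 b0.
pose A (t : n.-tuple RT) := j%:R * psum j.-1 t * pprod ks t + pprod_derivation j ks t.
pose f_ m (t : n.-tuple RT) := A t +
    pprod ks t * (- c * psum j.+1 t + b / 2 *
      \sum_(k < n) \sum_(i < n | i != k) divided_diff j k i t *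
      ((tnth t k - tnth t i) ^+ 2 / sqr_gap (harmonic m) k i t)).
(* A majorant independent of [m], since the interaction ratio is at most 1. *)
pose g (t : n.-tuple RT) : R := `|A t| +
    `|pprod ks t| * (`|- c * psum j.+1 t| + b / 2 *
      \sum_(k < n) \sum_(i < n | i != k) `|divided_diff j k i t|).
have tp := tame_psum; have tP := tame_pprod ks n.
have tA : tame A.
  apply: tameD; last exact: tame_pprod_derivation.
  by apply: tameM => //; exact: tameZ.
have tg : tame g.
  apply: tameD; first exact: tame_norm.
  apply: tameM; first exact: tame_norm.
  apply: tameD; first by apply: tame_norm; exact: tameZ.
  apply: tameZ; apply: tame_sum => k _; apply: tame_sum => i _.
  by apply: tame_norm; exact: tame_divided_diff.
have tf_ m : tame (f_ m).
  apply: tameD => //; apply: tameM => //; apply: tameD; first exact: tameZ.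
  apply: tameZ; apply: tame_sum => k _; apply: tame_sum => i _.
  apply: tameM; first exact: tame_divided_diff.
  apply: tameM; first by apply: tameX; apply: tameB; exact: tame_tnth.
  apply: (tameV (e := harmonic m) (f := sqr_gap (harmonic m) k i)).
  - exact: harmonic_gt0.
  - by move=> t; rewrite lerDr sqr_ge0.
  - exact: tame_sqr_gap.
have fg m t : `|f_ m t| <= g t.
  rewrite (le_trans (ler_normD _ _))// lerD2l normrM ler_wpM2l//.
  rewrite (le_trans (ler_normD _ _))// lerD2l normrM ger0_norm; last first.
    by rewrite divr_ge0// ltW.
  rewrite ler_wpM2l ?divr_ge0 ?(ltW b0)// (le_trans (ler_norm_sum _ _ _))//.
  apply: ler_sum => k _; rewrite (le_trans (ler_norm_sum _ _ _))//.
  apply: ler_sum => i _; rewrite normrM ler_piMr// sqr_gap_ratio_le1//.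
  exact: harmonic_gt0.
have [] // := cvg_integral_reg_density
  (f := @loop_integrand c b j ks n) c0 b0 tf_ tg fg.
- move=> t; have [[k [i [ik tki]]]|inj] :=
      pselect (exists k i, i != k /\ tnth t k = tnth t i).
    rewrite (gauss_density_eq0 _ b0 ik tki) mulr0.
    have H : g t * reg_density c b (harmonic m) t @[m --> \oo] --> (0 : R).
      rewrite -[X in _ --> X](mulr0 (g t)); apply: cvgM; first exact: cvg_cst.
      rewrite -(gauss_density_eq0 c b0 ik tki); exact: reg_density_cvg.
    apply/norm_cvg0P; apply: (squeeze_cvgr _ (cvg_cst 0) H).
    apply: nearW => m; rewrite normr_ge0/= normrM (ger0_norm (expR_ge0 _)).
    by rewrite ler_wpM2r ?expR_ge0.
  apply: cvgM; last exact: reg_density_cvg.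
  rewrite /loop_integrand -sum_divided_diff.
  apply: cvgD; first exact: cvg_cst.
  apply: cvgM; first exact: cvg_cst.
  apply: cvgD; first exact: cvg_cst.
  apply: cvgM; first exact: cvg_cst.
  apply: cvg_sumr => k _; apply: cvg_sumr => i ik.
  rewrite -[X in _ --> X]mulr1; apply: cvgM; first exact: cvg_cst.
  apply: sqr_gap_ratio_cvg; apply/eqP => tki; apply: inj.
  by exists k, i.
move=> _; under eq_fun => m do rewrite integral_reg_loop ?harmonic_itv01//.
by move=> /(cvg_lim (@ereal_hausdorff R)) <-; rewrite lim_cst//; exact: ereal_hausdorff.
Qed.

End loop_equation.

(** * Averages in the Gaussian beta ensemble *)

Section gaussian_average.
Context {R : realType}.
Local Notation mu := (@lebesgue_measure R).
Local Notation leb n := (lebesgue_tuple R n).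
Local Notation RT := (measurableTypeR R).

Definition gauss_avg (c b : R) n (f : n.-tuple RT -> R) : R :=
  ME_average (fun l => expR (- (c * l ^+ 2 / 2))) b f.

Lemma gauss_avgE c b n (f : n.-tuple RT -> R) : gauss_avg c b f =
  (\int[leb n]_t (f t * gauss_density c b t)) / \int[leb n]_t gauss_density c b t.
Proof. by []. Qed.

(* On the box [\prod_l [3 l, 3 l + 1]] all gaps are at least 1. *)
Lemma gauss_density_box (c b : R) n (t : n.-tuple RT) : 0 < c -> 0 < b ->
  \prod_(l < n) (expR (- (c * (3 * n.+1%:R) ^+ 2 / 2)) *
    \1_(`[3 * l%:R, 3 * l%:R + 1]%classic) (tnth t l)) <= gauss_density c b t.
Proof.
move=> c0 b0.
have [tin|/existsNP[l /negP tl]] :=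
    pselect (forall l : 'I_n, 3 * l%:R <= tnth t l <= 3 * l%:R + 1); last first.
  rewrite (bigD1 l)//= indicE memNset ?mulr0 ?mul0r ?gauss_density_ge0//=.
  by rewrite in_itv/=; exact/negP.
rewrite -[leLHS]mulr1; apply: ler_pM => //.
- apply: prodr_ge0 => l _; rewrite mulr_ge0 ?expR_ge0//.
- apply: ler_prod => l _; rewrite indicE mem_set ?mulr1 ?expR_ge0//=; last first.
    by rewrite in_itv/=; exact: tin.
  rewrite ler_expR lerN2 ler_wpM2r ?invr_ge0// ler_wpM2l ?(ltW c0)//.
  have /andP[t1 t2] := tin l.
  have l0 : 0 <= 3 * l%:R :> R by rewrite mulr_ge0.
  rewrite ler_sqr ?nnegrE ?(le_trans l0 t1) ?mulr_ge0// (le_trans t2)//.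
  have : l%:R + 1 <= n.+1%:R :> R by rewrite natr1 ler_nat ltnS ltnW.
  by lra.
- elim/big_ind: _ => // [x y|k _]; first exact: mulr_ege1.
  elim/big_ind: _ => // [x y|j jk]; first exact: mulr_ege1.
  have d1 : 1 <= `|tnth t k - tnth t j|.
    have /andP[k1 _] := tin k; have /andP[_ j2] := tin j.
    have : j%:R + 1 <= k%:R :> R by rewrite natr1 ler_nat.
    by move=> jk1; rewrite ger0_norm; lra.
  by rewrite -(powRr0 `|tnth t k - tnth t j|) ler_powR// ltW.
Qed.

(** [gauss_avg] divides by this integral, so normalisation and monotonicity of averages rest on it.
    The box gives a minorant whose integral is an explicit positive product. *)
Lemma integral_gauss_density_gt0 (c b : R) n : 0 < c -> 0 < b ->
  0 < \int[leb n]_t gauss_density c b t.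
Proof.
move=> c0 b0.
have := integrable_tame_gauss_density c0 b0 (tame_cst n (1 : R)).
under [X in _.-integrable _ X]eq_fun do rewrite mul1r.
move=> idens; apply: fine_gt0; apply/andP; split; last first.
  by have := integrable_fin_num measurableT idens; rewrite ge0_fin_numE// integral_ge0// => t _; rewrite lee_fin gauss_density_ge0.
pose a := expR (- (c * (3 * n.+1%:R) ^+ 2 / 2)).
apply: (@lt_le_trans _ _ (\int[leb n]_t (\prod_(l < n) (a *
    \1_(`[3 * l%:R, 3 * l%:R + 1]%classic) (tnth t l)))%:E)%E); last first.
  apply: ge0_le_integral => //.
  - move=> t _; rewrite lee_fin; apply: prodr_ge0 => l _.
    by rewrite mulr_ge0 ?expR_ge0.
  - apply/measurable_EFinP; apply: measurable_prod => l _.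
    apply: measurable_funM => //.
    apply: (measurableT_comp (measurable_indic _)); last exact: measurable_tnth.
    exact: measurable_itv.
  - exact: measurable_int idens.
  - by move=> t _; rewrite lee_fin gauss_density_box.
rewrite (integral_prod_tnth (g := fun l x => a *
  \1_(`[3 * (l : nat)%:R, 3 * (l : nat)%:R + 1]%classic) x)).
- rewrite (eq_bigr (fun=> a%:E)) => [|l _].
    by rewrite prodEFin lte_fin prodr_gt0// => l _; exact: expR_gt0.
  under eq_integral do rewrite EFinM.
  rewrite ge0_integralZl//.
  - rewrite integral_indic//= setIT lebesgue_measure_itv/= lte_fin ltrDl ltr01.
    by rewrite -EFinB addrAC subrr add0r mule1.
  - by apply/measurable_EFinP; exact: measurable_indic.
  - by rewrite lee_fin expR_ge0.
- move=> l; apply: measurable_funM => //; exact: measurable_indic.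
- by move=> l x; rewrite mulr_ge0 ?expR_ge0.
Qed.

Section fixed_parameters.
Context (c b : R) (n : nat) (c0 : 0 < c) (b0 : 0 < b).
Implicit Types f g : n.-tuple RT -> R.

Lemma gauss_avg_cst a : gauss_avg c b (fun _ : n.-tuple RT => a) = a.
Proof.
have Z0 := integral_gauss_density_gt0 n c0 b0.
have := integrable_tame_gauss_density c0 b0 (tame_cst n (1 : R)).
under [X in _.-integrable _ X]eq_fun do rewrite mul1r.
by move=> idens; rewrite gauss_avgE RintegralZl// mulfK// gt_eqF.
Qed.

Lemma gauss_avgD f g : tame f -> tame g ->
  gauss_avg c b (fun t => f t + g t) = gauss_avg c b f + gauss_avg c b g.
Proof.
move=> tf tg; rewrite !gauss_avgE -mulrDl; congr (_ / _).
under eq_Rintegral do rewrite mulrDl.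
by rewrite RintegralD//; exact: integrable_tame_gauss_density.
Qed.

Lemma gauss_avgZ a f : tame f ->
  gauss_avg c b (fun t => a * f t) = a * gauss_avg c b f.
Proof.
move=> tf; rewrite !gauss_avgE mulrA; congr (_ / _).
under eq_Rintegral do rewrite -mulrA.
by rewrite RintegralZl//; exact: integrable_tame_gauss_density.
Qed.

Lemma gauss_avgB f g : tame f -> tame g ->
  gauss_avg c b (fun t => f t - g t) = gauss_avg c b f - gauss_avg c b g.
Proof.
move=> tf tg; have := gauss_avgD tf (tameZ (-1) tg).
rewrite gauss_avgZ// mulN1r => <-; congr gauss_avg.
by apply/funext => t; rewrite mulN1r.
Qed.

Lemma gauss_avg_sum I (r : seq I) (P : pred I) (f : I -> n.-tuple RT -> R) :
  (forall i, P i -> tame (f i)) ->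
  gauss_avg c b (fun t => \sum_(i <- r | P i) f i t) =
  \sum_(i <- r | P i) gauss_avg c b (f i).
Proof.
move=> tf; elim: r => [|i r IH].
  by under eq_fun do rewrite big_nil; rewrite gauss_avg_cst big_nil.
under eq_fun do rewrite big_cons; rewrite big_cons.
case: (P i) (tf i) => [/(_ isT) tfi|_]; last exact: IH.
by rewrite gauss_avgD ?IH//; exact: tame_sum.
Qed.

Lemma le_gauss_avg f g : tame f -> tame g -> (forall t, f t <= g t) ->
  gauss_avg c b f <= gauss_avg c b g.
Proof.
move=> tf tg fg; have Z0 := integral_gauss_density_gt0 n c0 b0.
rewrite !gauss_avgE ler_wpM2r ?invr_ge0 ?(ltW Z0)//.
apply: le_Rintegral => //; try exact: integrable_tame_gauss_density.
by move=> t _; rewrite ler_wpM2r ?gauss_density_ge0.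
Qed.

Lemma gauss_avg_dist f g h : tame f -> tame g -> tame h ->
  (forall t, `|f t - g t| <= h t) ->
  `|gauss_avg c b f - gauss_avg c b g| <= gauss_avg c b h.
Proof.
move=> tf tg th fgh; rewrite -gauss_avgB// ler_norml -mulN1r -gauss_avgZ//.
apply/andP; split; apply: le_gauss_avg => //.
- exact: tameZ.
- exact: tameB.
- by move=> t; rewrite mulN1r; have := fgh t; rewrite ler_norml => /andP[].
- exact: tameB.
- by move=> t; have := fgh t; rewrite ler_norml => /andP[].
Qed.

Lemma gauss_avg_loop j ks :
  gauss_avg c b (@loop_integrand R c b j ks n) = 0.
Proof. by rewrite gauss_avgE /Rintegral integral_loop// fine0 mul0r. Qed.

End fixed_parameters.

End gaussian_average.

(** * Limiting moments *)

Section limit_moments.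
Context {S : comNzRingType}.
Implicit Types A G : S.

(** Course-of-values recursion: a step needs all earlier moments, so the whole list is carried. At
    [j = 0] the truncated predecessor is multiplied by 0 and the sum is empty. A general coefficient
    ring allows [G = 'X], which yields the moments as polynomials in [alpha]. *)
Fixpoint moment_seq A G (n : nat) : seq S :=
  if n is j.+1 then
    let s := moment_seq A G j in
    rcons s (A * j%:R * s`_j.-1 + G * \sum_(a < j) s`_(j.-1 - a) * s`_a)
  else [:: 1].

Definition moment A G k : S := (moment_seq A G k)`_k.

Lemma size_moment_seq A G n : size (moment_seq A G n) = n.+1.
Proof. by elim: n => //= n IH; rewrite size_rcons IH. Qed.

Lemma nth_moment_seq A G n k : (k <= n)%N -> (moment_seq A G n)`_k = moment A G k.
Proof.
elim: n => [|n IH]; first by rewrite leqn0 => /eqP ->.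
rewrite leq_eqVlt => /orP[/eqP -> //|kn].
by rewrite /= nth_rcons size_moment_seq kn IH.
Qed.

Lemma moment0 A G : moment A G 0 = 1.
Proof. by []. Qed.

Lemma momentS A G j : moment A G j.+1 = A * j%:R * moment A G j.-1 +
  G * \sum_(a < j) moment A G (j.-1 - a) * moment A G a.
Proof.
rewrite {1}/moment /= nth_rcons size_moment_seq ltnn eqxx.
rewrite nth_moment_seq ?leq_pred//; congr (_ + _ * _).
apply: eq_bigr => a _; rewrite !nth_moment_seq//; first exact: ltnW.
by rewrite (leq_trans (leq_subr _ _))// leq_pred.
Qed.

(** The recursion preserves parity: the indices in each product sum to [j - 1], so when this is odd
    one of the two factors has odd index. *)
Lemma moment_odd A G k : odd k -> moment A G k = 0.
Proof.
elim/ltn_ind: k => -[//|k] IH /= ok; rewrite momentS.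
have [->|k0] := posnP k; first by rewrite mulr0 mul0r add0r big_ord0 mulr0.
have ok1 : odd k.-1 by case: k ok k0 {IH} => //= k; rewrite negbK.
rewrite IH ?prednK// mulr0 add0r big1 ?mulr0// => a _.
have ak : (a <= k.-1)%N by rewrite -ltnS prednK.
case: (boolP (odd a)) => oa.
  by rewrite (IH a) ?mulr0//; exact: (leq_trans (ltn_ord a)).
rewrite IH ?mul0r//; last by rewrite oddB// ok1 (negbTE oa).
by rewrite ltnS (leq_trans (leq_subr _ _))// leq_pred.
Qed.

(* The recursion raises the degree by two and both coefficients enter once. *)
Lemma momentZ s A G k : moment (s * A) (s * G) k = s ^+ k./2 * moment A G k.
Proof.
elim/ltn_ind: k => -[|k] IH; first by rewrite moment0 mul1r.
case: (boolP (odd k.+1)) => ok; first by rewrite !moment_odd// mulr0.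
rewrite /= negbK in ok; case: k ok IH => // k /= ok IH.
rewrite !momentS /= IH//.
rewrite exprS mulrDr mulr_sumr; congr (_ + _); first by ring.
rewrite !mulr_sumr; apply: eq_bigr => a _.
have ak : (a <= k)%N by rewrite -ltnS.
rewrite IH ?(leq_ltn_trans (leq_subr _ _)) ?(IH a) ?(leq_trans (ltn_ord a))//.
case: (boolP (odd a)) => oa; first by rewrite !(moment_odd A G oa) !mulr0.
have -> : k./2 = ((k - a)./2 + a./2)%N.
  have oka : ~~ odd (k - a) by rewrite oddB// (negbTE ok) (negbTE oa).
  by apply: double_inj; rewrite doubleD !even_halfK// subnK.
by rewrite exprD; ring.
Qed.

End limit_moments.

(** Applied to evaluation at a point, to read off the values of the polynomial moments. *)
Lemma rmorph_moment (S S' : comNzRingType) (f : {rmorphism S -> S'}) A G k :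
  f (moment A G k) = moment (f A) (f G) k.
Proof.
elim/ltn_ind: k => -[|k] IH; first by rewrite !moment0 rmorph1.
rewrite !momentS rmorphD !rmorphM rmorph_nat rmorph_sum IH; last first.
  by rewrite ltnS leq_pred.
congr (_ + _ * _); apply: eq_bigr => a _; rewrite rmorphM !IH//.
  by rewrite (leq_trans (ltn_ord a)).
by rewrite ltnS (leq_trans (leq_subr _ _))// leq_pred.
Qed.

(** * Growth of the limiting moments *)

Section moment_growth.
Context {R : realType}.

(* At [a = 0] these are the Gaussian moments, so geometric growth fails. *)
Lemma moment_factorial_bound (a : R) k : 0 <= a ->
  0 <= moment 1 a k <= (2 * (1 + a)) ^+ k./2 * k./2`!%:R.
Proof.
move=> a0; elim/ltn_ind: k => -[|k] IH; first by rewrite moment0 ler01 mul1r lexx.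
have B0 : 0 <= 2 * (1 + a) by rewrite mulr_ge0// addr_ge0.
case: (boolP (odd k.+1)) => ok.
  by rewrite moment_odd// lexx mulr_ge0// exprn_ge0.
rewrite /= negbK in ok; case: k ok IH => // k /= ok IH.
rewrite momentS mul1r /=; apply/andP; split.
  rewrite addr_ge0// mulr_ge0//; first by have /andP[] := IH k (leqW (leqnn _)).
  apply: sumr_ge0 => i _; apply: mulr_ge0.
    by have /andP[] := IH (k - i)%N (leqW (leq_ltn_trans (leq_subr _ _) (ltnSn _))).
  by have /andP[] := IH i (leqW (ltn_ord i)).
set q := k./2; have kE : k = q.*2 by rewrite even_halfK.
set B := 2 * (1 + a) in B0 IH *.
(* For even [i] the half-indices add up to [q], and [p! r! <= (p + r)!] because a binomial
   coefficient is at least 1; for odd [i] the product vanishes. *)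
have termle (i : 'I_k.+1) : moment 1 a (k - i) * moment 1 a i <= B ^+ q * q`!%:R.
  have ik : (i <= k)%N by rewrite -ltnS.
  have /andP[m1 m1'] := IH (k - i)%N (leqW (leq_ltn_trans (leq_subr _ _) (ltnSn _))).
  have /andP[m2 m2'] := IH i (leqW (ltn_ord i)).
  case: (boolP (odd i)) => oi.
    by rewrite (moment_odd _ _ oi) mulr0 mulr_ge0// exprn_ge0.
  have qE : q = ((k - i)./2 + i./2)%N.
    have oki : ~~ odd (k - i) by rewrite oddB// (negbTE ok) (negbTE oi).
    by apply: double_inj; rewrite doubleD !even_halfK// subnK.
  apply: (le_trans (ler_pM m1 m2 m1' m2')).
  rewrite mulrACA -exprD -qE ler_wpM2l ?exprn_ge0// -natrM ler_nat.
  rewrite [in leqRHS]qE -(bin_fact (leq_addl _ i./2)) addnK.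
  by rewrite mulnC leq_pmull// bin_gt0 leq_addl.
apply: (@le_trans _ _ (k.+1%:R * (B ^+ q * q`!%:R) +
    a * \sum_(i < k.+1) (B ^+ q * q`!%:R))).
  apply: lerD; first by rewrite ler_wpM2l//; have /andP[] := IH k (leqW (leqnn _)).
  by rewrite ler_wpM2l//; apply: ler_sum => i _; exact: termle.
rewrite [X in a * X](_ : _ = k.+1%:R * (B ^+ q * q`!%:R)); last first.
  by rewrite sumr_const card_ord mulr_natl.
rewrite exprS factS natrM.
(* Here [k + 1 = 2 q + 1], which is the origin of the factor 2 in the base [2 (1 + a)]. *)
have kq : k.+1%:R <= 2 * q.+1%:R :> R.
  by rewrite -natrM ler_nat kE -mul2n mulnS ltnS leqW.
have X0 : 0 <= B ^+ q * q`!%:R by rewrite mulr_ge0// exprn_ge0.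
rewrite [leRHS](_ : _ = (1 + a) * (2 * q.+1%:R) * (B ^+ q * q`!%:R)); last first.
  by rewrite /B; ring.
rewrite [leLHS](_ : _ = (1 + a) * k.+1%:R * (B ^+ q * q`!%:R)); last by ring.
by rewrite ler_wpM2r// ler_wpM2l// addr_ge0.
Qed.

(** With [p = j - 1 - a], the left side collects [t p * t a] over the pairs with [p + a + 1 < m],
    the right side over all pairs below [m]. *)
Lemma conv_le (t : nat -> R) m : (forall k, 0 <= t k) ->
  \sum_(j < m) \sum_(a < j) t (j.-1 - a)%N * t a <=
  (\sum_(k < m) t k) * \sum_(k < m) t k.
Proof.
move=> t0.
have -> : \sum_(j < m) \sum_(a < j) t (j.-1 - a)%N * t a =
    \sum_(a < m) \sum_(j < m | (a < j)%N) t (j.-1 - a)%N * t a.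
  under eq_bigr => j _ do rewrite (big_ord_widen m
    (fun a => t (j.-1 - a)%N * t a) (ltnW (ltn_ord j))).
  by rewrite (exchange_big_dep predT).
rewrite mulr_sumr; apply: ler_sum => a _; rewrite -mulr_suml ler_wpM2r//.
have := big_geq_mkord a.+1 m xpredT (fun j => t (j.-1 - a)%N) => /= <-.
rewrite -[X in \sum_(X <= _ < _) _]add0n big_addn.
under eq_bigr do rewrite addnS /= addnK.
rewrite big_mkord (big_ord_widen m _ (leq_subr _ _)) [leRHS](bigID
  (fun k : 'I_m => (k < m - a.+1)%N))/= lerDl.
by apply: sumr_ge0.
Qed.

(* The truncated generating function [s m = \sum_(k < m) mom k * x ^+ k]
   satisfies [s m.+1 <= 1 + g x^2 (s m)^2], hence stays below 2 when
   [4 g x^2 <= 1]. *)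
Lemma moment_geometric_bound (A g x : R) : A <= 0 -> 0 <= g -> 0 <= x ->
  4 * g * x ^+ 2 <= 1 -> (forall k, 0 <= moment A g k) ->
  forall k, moment A g k * x ^+ k <= 2.
Proof.
move=> A0 g0 x0 gx m0.
pose s m := \sum_(k < m) moment A g k * x ^+ k.
have t0 k : 0 <= moment A g k * x ^+ k by rewrite mulr_ge0// exprn_ge0.
suff s2 m : 0 <= s m <= 2.
  move=> k; have /andP[_] := s2 k.+1; apply: le_trans.
  by rewrite /s big_ord_recr/= lerDr sumr_ge0.
elim: m => [|m /andP[sm0 sm2]]; first by rewrite /s big_ord0 lexx/=.
rewrite {1}/s sumr_ge0//= /s big_ord_recl moment0 expr0 mulr1.
have step : \sum_(i < m) moment A g (lift ord0 i) * x ^+ lift ord0 i <=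
    g * x ^+ 2 * (s m * s m).
  apply: (@le_trans _ _ (\sum_(j < m) g * x ^+ 2 * \sum_(a < j)
     (moment A g (j.-1 - a) * x ^+ (j.-1 - a)) * (moment A g a * x ^+ a))).
    apply: ler_sum => j _; rewrite lift0 momentS mulrDl.
    (* The [A] term is nonpositive, as [A <= 0] and the moments are nonnegative, and is dropped. *)
    apply: (@le_trans _ _ (g * (\sum_(a < j) moment A g (j.-1 - a) * moment A g a) * x ^+ j.+1)).
      by rewrite gerDr mulr_le0_ge0 ?exprn_ge0// mulr_le0_ge0// mulr_le0_ge0.
    rewrite -mulrA -mulrA ler_wpM2l// mulr_suml mulr_sumr.
    apply: ler_sum => a _.
    have -> : x ^+ j.+1 = x ^+ 2 * (x ^+ (j.-1 - a) * x ^+ a).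
      rewrite -!exprD subnK; last by rewrite -ltnS (ltn_predK (ltn_ord a)).
      by rewrite addSn add1n (ltn_predK (ltn_ord a)).
    by rewrite le_eqVlt; apply/orP; left; apply/eqP; ring.
  rewrite -mulr_sumr ler_wpM2l ?mulr_ge0 ?exprn_ge0//.
  exact: (conv_le m t0).
apply: (le_trans (lerD (lexx 1) step)).
have : s m * s m <= 4 by nra.
have : 0 <= g * x ^+ 2 by rewrite mulr_ge0 ?exprn_ge0.
nra.
Qed.

End moment_growth.

(** * Loop equations for normalised power sums *)

Section normalized_loop.
Context {R : realType}.
Local Notation RT := (measurableTypeR R).

Definition npsum (k : nat) n (t : n.-tuple RT) : R := n%:R^-1 * psum k t.

Definition nprod (ks : seq nat) n (t : n.-tuple RT) : R :=
  \prod_(k <- ks) npsum k t.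

(** The derivation trades one power sum for another and keeps the number of factors, so the
    normalisation of each term is that of the original product. *)
Fixpoint nprod_derivation (j : nat) (ks : seq nat) n (t : n.-tuple RT) : R :=
  if ks is k :: ks' then
    k%:R * (npsum (k + j).-1 t * nprod ks' t) + npsum k t * nprod_derivation j ks' t
  else 0.

Lemma nprod_cons k ks n (t : n.-tuple RT) :
  nprod (k :: ks) t = npsum k t * nprod ks t.
Proof. by rewrite /nprod big_cons. Qed.

Lemma tame_npsum k n : tame (@npsum k n).
Proof. by apply: tameZ; exact: tame_psum. Qed.

Lemma tame_nprod ks n : tame (@nprod ks n).
Proof. by apply: tame_prod => k _; exact: tame_npsum. Qed.

Lemma tame_nprod_derivation j ks n : tame (@nprod_derivation j ks n).
Proof.
elim: ks => [|k ks IH] /=; first exact: tame_cst.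
apply: tameD; last by apply: tameM => //; exact: tame_npsum.
by apply: tameZ; apply: tameM; [exact: tame_npsum|exact: tame_nprod].
Qed.

Lemma psum_npsum k n (t : n.-tuple RT) : (0 < n)%N ->
  psum k t = n%:R * npsum k t.
Proof. by move=> n0; rewrite /npsum mulVKf// pnatr_eq0 -lt0n. Qed.

Lemma pprod_nprod ks n (t : n.-tuple RT) : (0 < n)%N ->
  pprod ks t = n%:R ^+ size ks * nprod ks t.
Proof.
move=> n0; elim: ks => [|k ks IH].
  by rewrite /pprod /nprod !big_nil mul1r.
by rewrite pprod_cons nprod_cons IH psum_npsum// exprS; ring.
Qed.

Lemma pprod_nprod_derivation j ks n (t : n.-tuple RT) : (0 < n)%N ->
  pprod_derivation j ks t = n%:R ^+ size ks * nprod_derivation j ks t.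
Proof.
move=> n0; elim: ks => [|k ks IH] /=; first by rewrite mulr0.
by rewrite IH pprod_nprod// !psum_npsum// exprS; ring.
Qed.

(** The loop equation divided by [c n^(size ks + 1)] and solved for the highest moment. The
    derivation term has one factor too few, whence [1 / (c n)], the quadratic term one too many,
    whence [b n / (2 c)], and the diagonal correction merges with the derivative of [x_l^j] into
    [1 - b / 2]. *)
Lemma gauss_avg_nloop (c b : R) n j ks : 0 < c -> 0 < b -> (0 < n)%N ->
  gauss_avg c b (@nprod (j.+1 :: ks) n) =
  j%:R * ((1 - b / 2) / c) * gauss_avg c b (@nprod (j.-1 :: ks) n) +
  (c * n%:R)^-1 * gauss_avg c b (@nprod_derivation j ks n) +
  b * n%:R / (2 * c) * \sum_(a < j)
    gauss_avg c b (@nprod ((j.-1 - a)%N :: (a : nat) :: ks) n).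
Proof.
move=> c0 b0 n0; have := @gauss_avg_loop R c b n c0 b0 j ks.
have nn0 : n%:R != 0 :> R by rewrite pnatr_eq0 -lt0n.
have tn := tame_nprod; have td := tame_nprod_derivation.
rewrite (_ : @loop_integrand _ _ _ _ _ n = fun t => n%:R ^+ (size ks).+1 *
  ((j%:R * (1 - b / 2) * nprod (j.-1 :: ks) t + n%:R^-1 * nprod_derivation j ks t) +
   (b / 2 * n%:R * \sum_(a < j) nprod ((j.-1 - a)%N :: (a : nat) :: ks) t +
    - c * nprod (j.+1 :: ks) t))); last first.
  apply/funext => t; rewrite /loop_integrand pprod_nprod// pprod_nprod_derivation//.
  rewrite !psum_npsum// !nprod_cons exprS.
  have -> : \sum_(a < j) psum (j.-1 - a) t * psum a t = n%:R ^+ 2 *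
      \sum_(a < j) npsum (j.-1 - a) t * npsum a t.
    by rewrite mulr_sumr; apply: eq_bigr => a _; rewrite !psum_npsum//; ring.
  under [in RHS]eq_bigr do rewrite !nprod_cons mulrA.
  rewrite -mulr_suml.
  set x := \sum_(_ < _) _; set y := _ ^+ size ks; set m := _%:R in nn0 *.
  by field.
have ts : tame (fun t : n.-tuple RT =>
    \sum_(a < j) nprod ((j.-1 - a)%N :: (a : nat) :: ks) t).
  by apply: tame_sum => a _.
have t1 : tame (fun t : n.-tuple RT => j%:R * (1 - b / 2) * nprod (j.-1 :: ks) t +
    n%:R^-1 * nprod_derivation j ks t) by apply: tameD; exact: tameZ.
have t2 : tame (fun t : n.-tuple RT => b / 2 * n%:R *
    \sum_(a < j) nprod ((j.-1 - a)%N :: (a : nat) :: ks) t +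
    - c * nprod (j.+1 :: ks) t) by apply: tameD; exact: tameZ.
rewrite gauss_avgZ//; last exact: tameD.
rewrite gauss_avgD// gauss_avgD; [|by []|by []|exact: tameZ|exact: tameZ].
rewrite gauss_avgD; [|by []|by []|exact: tameZ|exact: tameZ].
rewrite !gauss_avgZ// gauss_avg_sum//.
move/eqP; rewrite mulf_eq0 expf_eq0 (negbTE nn0) andbF/= => /eqP H.
set X0 := gauss_avg c b (@nprod (j.+1 :: ks) n).
set X1 := gauss_avg c b (@nprod (j.-1 :: ks) n).
set X2 := gauss_avg c b _; set X3 := \sum_(_ < _) _.
have {}H : j%:R * (1 - b / 2) * X1 + n%:R^-1 * X2 +
    (b / 2 * n%:R * X3 + - c * X0) = 0 := H.
have c_neq0 := lt0r_neq0 c0; set m := n%:R in nn0 H *.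
apply: (mulfI c_neq0); apply/eqP; rewrite -subr_eq0; apply/eqP.
rewrite -[RHS]oppr0 -H; field.
by rewrite nn0 c_neq0.
Qed.

End normalized_loop.

(** * Factorisation of the limiting averages *)

Section moment_convergence.
Context {R : realType} {T : Type} {F : set_system T} {FF : ProperFilter F}.
Context (c b : T -> R) (n : T -> nat) (A G : R).
Hypotheses (c0 : \forall x \near F, 0 < c x) (b0 : \forall x \near F, 0 < b x)
  (n0 : \forall x \near F, (0 < n x)%N).
Hypotheses (cA : (1 - b x / 2) / c x @[x --> F] --> A)
  (cB : (c x * (n x)%:R)^-1 @[x --> F] --> (0 : R))
  (cG : b x * (n x)%:R / (2 * c x) @[x --> F] --> G).

Let M ks x := gauss_avg (c x) (b x) (@nprod R ks (n x)).

(** Existence of a limit is enough here, since the term is later multiplied by [1 / (c n)], which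
    tends to 0. Every product that occurs has total degree below [D]; [ks1] accumulates the factors
    already passed, and [k = 0] is separate because the truncated index does not lower the
    degree. *)
Let cvg_derivation D : (forall ks, (sumn ks < D)%N -> cvg (M ks x @[x --> F])) ->
  forall j ks2 ks1, (sumn ks1 + sumn ks2 + j < D)%N ->
  cvg (gauss_avg (c x) (b x)
    (fun t : (n x).-tuple (measurableTypeR R) =>
      nprod ks1 t * nprod_derivation j ks2 t) @[x --> F]).
Proof.
move=> cM j; elim => [|k ks2 IH] ks1 /= lt.
  apply: (cvgP 0); apply: cvg_near_cst; near=> x.
  rewrite (_ : (fun t => _) = fun=> 0); last by apply/funext => t; rewrite mulr0.
  by apply: gauss_avg_cst; near: x.
pose ks' := ((k + j).-1 :: ks1 ++ ks2).
have c1 : cvg ((k%:R * M ks' x) @[x --> F]).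
  have [->|k0] := posnP k.
    by under eq_fun do rewrite mul0r; exact: is_cvg_cst.
  apply: is_cvgM; first exact: is_cvg_cst.
  by apply: cM; rewrite /ks' /= sumn_cat; lia.
have c2 : cvg (gauss_avg (c x) (b x)
    (fun t : (n x).-tuple (measurableTypeR R) =>
      nprod (k :: ks1) t * nprod_derivation j ks2 t) @[x --> F]).
  by apply: IH => /=; lia.
apply: cvgP; apply: cvg_trans (is_cvgD c1 c2); apply: near_eq_cvg; near=> x.
have cx : 0 < c x by near: x.
have bx : 0 < b x by near: x.
have tn := @tame_nprod R; have td := @tame_nprod_derivation R.
rewrite addrfctE /M -gauss_avgZ// -gauss_avgD//.
- congr gauss_avg; apply/funext => t; rewrite /ks' !nprod_cons /= /nprod big_cat/=.
  by ring.
- exact: tameZ.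
- exact: tameM.
Unshelve. all: by end_near.
Qed.

(** Induction on total degree, with an inner induction on the list that strips the zeros, for which
    the normalised power sum is 1. A positive head is rewritten by the loop equation, whose terms
    all have smaller degree. *)
Lemma cvg_nprod ks : M ks x @[x --> F] --> \prod_(k <- ks) moment A G k.
Proof.
move: {2}(sumn ks).+1 (ltnSn (sumn ks)) => D.
elim: D ks => // D IH; elim => [|[|j] ks IHks] /= ksD.
- rewrite big_nil; apply: cvg_near_cst; near=> x.
  rewrite /M (_ : nprod [::] (n := n x) = fun=> 1); last first.
    by apply/funext => t; rewrite /nprod big_nil.
  by apply: gauss_avg_cst; near: x.
- rewrite big_cons moment0 mul1r; apply: cvg_trans (IHks ksD).
  apply: near_eq_cvg; near=> x; rewrite /M; congr gauss_avg; apply/funext => t.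
  rewrite nprod_cons /npsum /psum; under eq_bigr do rewrite expr0.
  rewrite sumr_const card_ord mulVf ?mul1r// pnatr_eq0 -lt0n.
  by near: x.
have {}ksD : (j + sumn ks < D)%N by lia.
have IHc ks' : (sumn ks' < D)%N -> cvg (M ks' x @[x --> F]).
  by move=> /IH /cvgP.
have cl : cvg (gauss_avg (c x) (b x)
    (fun t : (n x).-tuple (measurableTypeR R) =>
      nprod [::] t * nprod_derivation j ks t) @[x --> F]).
  by apply: (cvg_derivation IHc) => /=; lia.
pose rhs x := j%:R * ((1 - b x / 2) / c x) * M (j.-1 :: ks) x +
  (c x * (n x)%:R)^-1 * gauss_avg (c x) (b x)
    (fun t : (n x).-tuple (measurableTypeR R) =>
      nprod [::] t * nprod_derivation j ks t) +
  b x * (n x)%:R / (2 * c x) * \sum_(a < j) M ((j.-1 - a)%N :: (a : nat) :: ks) x.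
apply: (@cvg_trans _ (rhs x @[x --> F])).
  apply: near_eq_cvg; near=> x.
  rewrite /M gauss_avg_nloop; [|by near: x|by near: x|by near: x].
  rewrite /rhs; congr (_ + _ * gauss_avg _ _ _ + _).
  by apply/funext => t; rewrite /nprod big_nil mul1r.
set L := lim _ in cl.
(* The product of the limiting moments satisfies the limiting loop equation: this is [momentS] for
   the head, times the remaining factors. *)
have E : j%:R * A * \prod_(k <- j.-1 :: ks) moment A G k + 0 * L +
    G * \sum_(a < j) \prod_(k <- (j.-1 - a)%N :: (a : nat) :: ks) moment A G k =
    \prod_(k <- j.+1 :: ks) moment A G k.
  rewrite !big_cons momentS mul0r addr0 [RHS]mulrDl; congr (_ + _); first by ring.
  rewrite -mulrA mulr_suml; congr (_ * _); apply: eq_bigr => a _.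
  by rewrite !big_cons mulrA.
rewrite -E; apply: cvgD; first apply: cvgD.
- apply: cvgM; first by apply: cvgM => //; exact: cvg_cst.
  by apply: IH => /=; lia.
- exact: cvgM.
- apply: cvgM => //; apply: cvg_sumr => a _; apply: IH => /=.
  by have := ltn_ord a; lia.
Unshelve. all: by end_near.
Qed.

End moment_convergence.

(** * Convergence of resolvent averages *)

Section trigonometric_taylor.
Context {R : realType}.

(** The derivatives of [cos] at 0, and below those of [sin]. *)
Definition cos_sign (k : nat) : R := (~~ odd k)%:R * (-1) ^+ k./2.
Definition sin_sign (k : nat) : R := (odd k)%:R * (-1) ^+ k./2.

Definition taylor (a : nat -> R) (m : nat) (x : R) : R :=
  \sum_(k < m) a k / k`!%:R * x ^+ k.

Lemma is_derive_taylor (a : nat -> R) m (x : R) :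
  is_derive x 1 (taylor a m.+1) (taylor (a \o succn) m x).
Proof.
have -> : taylor a m.+1 = \sum_(k < m.+1) (fun x : R => a k / k`!%:R * x ^+ k).
  by apply/funext => z; rewrite fct_sumE.
have dk (k : 'I_m.+1) : is_derive x 1 (fun x : R => a k / k`!%:R * x ^+ k)
    (a k / k`!%:R * (k%:R * x ^+ k.-1)).
  have := is_deriveZ (a k / k`!%:R) (is_deriveX k (is_derive_id x 1)).
  by rewrite exprfctE => /is_derive_eq; apply; rewrite /GRing.scale /= mulr1.
apply: is_derive_eq (is_derive_sum dk) _.
rewrite big_ord_recl /= mul0r mulr0 add0r; apply: eq_bigr => k _.
rewrite /bump leq0n add1n add0n /= factS natrM; field.
by rewrite addrC natr1 !pnatr_eq0 -lt0n fact_gt0.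
Qed.

(** The mean value theorem applied to [g + f] and [g - f], both with nonnegative derivative on the
    half-line. *)
Lemma derive_bound (f g f' g' : R -> R) (x : R) : 0 <= x -> f 0 = 0 -> g 0 = 0 ->
  (forall z, is_derive (z : R) 1 f (f' z)) -> (forall z, is_derive (z : R) 1 g (g' z)) ->
  (forall z : R, 0 <= z -> `|f' z| <= g' z) -> `|f x| <= g x.
Proof.
rewrite le_eqVlt => /orP[/eqP <- f0 g0 _ _ _|x0 f0 g0 df dg fg].
  by rewrite f0 g0 normr0.
have pos (h h' : R -> R) : h 0 = 0 -> (forall z, is_derive (z : R) 1 h (h' z)) ->
    (forall z : R, 0 <= z -> 0 <= h' z) -> 0 <= h x.
  move=> h0 dh h'0.
  have [|c] := @MVT R h h' 0 x x0.
    apply: continuous_subspaceT => z; apply: differentiable_continuous.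
    by apply/derivable1_diffP; have [] := dh z.
  rewrite in_itv/= h0 !subr0 => /andP[c0 _] ->.
  by rewrite mulr_ge0 ?h'0 ?ltW.
rewrite ler_norml; apply/andP; split.
  rewrite -subr_ge0 opprK; apply: (pos (f + g) (f' \+ g')).
  - by rewrite addrfctE f0 g0 addr0.
  - by move=> z /fg; rewrite ler_norml => /andP[? _] /=; lra.
rewrite -subr_ge0; apply: (pos (g - f) (g' \- f')).
- by rewrite addrfctE opprfctE f0 g0 subr0.
- by move=> z /fg; rewrite ler_norml => /andP[_ ?] /=; rewrite subr_ge0.
Qed.

Lemma taylor0 a m : taylor a m.+1 0 = a 0%N.
Proof.
rewrite /taylor big_ord_recl /= expr0 mulr1 divr1 big1 ?addr0// => k _.
by rewrite /bump leq0n add1n expr0n mulr0.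
Qed.

Lemma eq_taylor a b m x : a =1 b -> taylor a m x = taylor b m x.
Proof. by move=> ab; apply: eq_bigr => k _; rewrite ab. Qed.

Lemma taylorN a m x : taylor (fun k => - a k) m x = - taylor a m x.
Proof. by rewrite -sumrN; apply: eq_bigr => k _; rewrite !mulNr. Qed.

Lemma sin_signS k : sin_sign k.+1 = cos_sign k.
Proof.
rewrite /sin_sign /cos_sign /=; case: (boolP (odd k)) => ok; first by rewrite !mul0r.
by rewrite uphalf_half (negbTE ok).
Qed.

Lemma cos_signS k : cos_sign k.+1 = - sin_sign k.
Proof.
rewrite /sin_sign /cos_sign /= negbK; case: (boolP (odd k)) => ok; last by rewrite !mul0r oppr0.
by rewrite uphalf_half ok exprS mulN1r mulrN.
Qed.

(** Both functions at once, by induction on the order: the derivative of one remainder is, up to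
    sign, the other remainder at the previous order. *)
Let taylor_bound_ge0 m x : 0 <= x ->
  `|cos x - taylor cos_sign m x| <= x ^+ m / m`!%:R /\
  `|sin x - taylor sin_sign m x| <= x ^+ m / m`!%:R.
Proof.
elim: m x => [|m IH] x x0.
  by rewrite /taylor !big_ord0 !subr0 expr0 divr1 cos_max sin_max.
have dg z : is_derive (z : R) 1 (fun x : R => x ^+ m.+1 / m.+1`!%:R) (z ^+ m / m`!%:R).
  have := is_deriveZ (m.+1`!%:R^-1) (is_deriveX m.+1 (is_derive_id z 1)).
  rewrite exprfctE => /is_derive_eq H.
  under eq_fun do rewrite mulrC; apply: H.
  rewrite /GRing.scale /= mulr1 factS natrM; field.
  by rewrite addrC natr1 !pnatr_eq0 -lt0n fact_gt0.
split.
  apply: (derive_bound (f := cos - taylor cos_sign m.+1)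
    (f' := fun z => - sin z - taylor (cos_sign \o succn) m z) x0 _ _ _ dg).
  - rewrite addrfctE opprfctE taylor0 cos0 /cos_sign /= mul1r subrr //.
  - by rewrite expr0n mul0r.
  - by move=> z; apply: is_deriveB; exact: is_derive_taylor.
  - move=> z z0; rewrite (eq_taylor (b := fun k => - sin_sign k)); last exact: cos_signS.
    by rewrite taylorN -opprD normrN; have [] := IH z z0.
apply: (derive_bound (f := sin - taylor sin_sign m.+1)
  (f' := fun z => cos z - taylor (sin_sign \o succn) m z) x0 _ _ _ dg).
- by rewrite addrfctE opprfctE taylor0 sin0 /sin_sign /= mul0r subrr.
- by rewrite expr0n mul0r.
- by move=> z; apply: is_deriveB; exact: is_derive_taylor.
- move=> z z0; rewrite (eq_taylor (b := cos_sign)); last exact: sin_signS.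
  by have [] := IH z z0.
Qed.

Lemma taylor_cosN m x : taylor cos_sign m (- x) = taylor cos_sign m x.
Proof.
apply: eq_bigr => k _; rewrite /cos_sign; case: (boolP (odd k)) => ok.
  by rewrite !mul0r.
by rewrite (exprNn x) -(signr_odd _ k) (negbTE ok) expr0 !mul1r.
Qed.

Lemma taylor_sinN m x : taylor sin_sign m (- x) = - taylor sin_sign m x.
Proof.
rewrite -sumrN; apply: eq_bigr => k _; rewrite /sin_sign; case: (boolP (odd k)) => ok.
  by rewrite (exprNn x) -(signr_odd _ k) ok expr1 mulN1r mulrN.
by rewrite !mul0r oppr0.
Qed.

Lemma cos_taylor_bound m x :
  `|cos x - taylor cos_sign m x| <= `|x| ^+ m / m`!%:R.
Proof.
have [x0|x0] := leP 0 x; first by rewrite (ger0_norm x0); have [] := taylor_bound_ge0 m x0.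
have x0' : 0 <= - x by rewrite oppr_ge0 ltW.
have [] := taylor_bound_ge0 m x0'.
by rewrite cosN taylor_cosN [in X in _ -> X](ltr0_norm x0).
Qed.

Lemma sin_taylor_bound m x :
  `|sin x - taylor sin_sign m x| <= `|x| ^+ m / m`!%:R.
Proof.
have [x0|x0] := leP 0 x; first by rewrite (ger0_norm x0); have [] := taylor_bound_ge0 m x0.
have x0' : 0 <= - x by rewrite oppr_ge0 ltW.
have [_] := taylor_bound_ge0 m x0'.
by rewrite sinN taylor_sinN -opprD normrN [in X in _ -> X](ltr0_norm x0).
Qed.

End trigonometric_taylor.

Section resolvent_approximation.
Context {R : realType}.

(** Real and imaginary parts of the finite geometric sum with ratio [r e^(i p)]. *)
Lemma geometric_cos_sin (r p : R) K :
  let C := \sum_(k < K) r ^+ k * cos (k%:R * p) in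
  let D := \sum_(k < K) r ^+ k * sin (k%:R * p) in
  (1 - r * cos p) * C + r * sin p * D = 1 - r ^+ K * cos (K%:R * p) /\
  (1 - r * cos p) * D - r * sin p * C = - (r ^+ K * sin (K%:R * p)).
Proof.
elim: K => [|K [IH1 IH2]] /=.
  by rewrite !big_ord0 !mulr0 mul0r cos0 sin0 expr0 mul1r subrr !mulr0 addr0 subr0 oppr0.
have E : K.+1%:R * p = K%:R * p + p by rewrite -natr1 mulrDl mul1r.
rewrite !big_ord_recr /= E cosD sinD exprSr; split.
  rewrite mulrDr mulrDr addrACA IH1; ring.
rewrite mulrDr mulrDr opprD addrACA IH2; ring.
Qed.

(** The hypotheses say [(a - i s) (e1 + i e2) = X + i Y], and [|a - i s| >= a >= d]. *)
Lemma rotation_bound (a s e1 e2 X Y d : R) : 0 < d -> d <= a ->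
  a * e1 + s * e2 = X -> a * e2 - s * e1 = Y ->
  `|e1| <= (`|X| + `|Y|) / d /\ `|e2| <= (`|X| + `|Y|) / d.
Proof.
move=> d0 da <- <-; have a0 : 0 < a := lt_le_trans d0 da.
set X' := a * e1 + s * e2; set Y' := a * e2 - s * e1.
have q0 : 0 < a ^+ 2 + s ^+ 2 by rewrite ltr_pwDl ?sqr_ge0 ?exprn_gt0.
have key u v w : w * (a ^+ 2 + s ^+ 2) = a * u + s * v -> `|w| <= (`|u| + `|v|) / d.
  move=> wE; rewrite ler_pdivlMr//.
  apply: (@le_trans _ _ (`|w| * a)); first by rewrite ler_wpM2l.
  have : (`|w| * a) * (a ^+ 2 + s ^+ 2) <= (`|u| + `|v|) * (a ^+ 2 + s ^+ 2).
    have -> : `|w| * a * (a ^+ 2 + s ^+ 2) = `|a * (a * u + s * v)|.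
      by rewrite -wE !normrM (gtr0_norm a0) (gtr0_norm q0); ring.
    rewrite normrM (gtr0_norm a0).
    have := ler_normD (a * u) (s * v); rewrite !normrM (gtr0_norm a0) => H.
    apply: (le_trans (ler_wpM2l (ltW a0) H)).
    rewrite -[s ^+ 2]real_normK ?num_real//.
    have := normr_ge0 u; have := normr_ge0 v; have := normr_ge0 s.
    set U := `|u|; set V := `|v|; set S := `|s| => S0 V0 U0.
    rewrite -subr_ge0 (_ : _ - _ = U * S ^+ 2 + V * ((a - S / 2) ^+ 2 + 3 / 4 * S ^+ 2)); last by field.
    by rewrite addr_ge0 ?mulr_ge0 ?addr_ge0 ?sqr_ge0 ?mulr_ge0 ?divr_ge0 ?sqr_ge0.
  by rewrite ler_pM2r.
split; last by rewrite addrC; apply: key; rewrite /X' /Y'; ring.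
by rewrite -(normrN Y'); apply: key; rewrite /X' /Y'; ring.
Qed.

Lemma expRN_bounds (s : R) : 0 < s ->
  s / (1 + s) <= 1 - expR (- s) /\ `|1 - expR (- s) - s| <= s ^+ 2.
Proof.
move=> s0; have s1 : 0 < 1 + s by rewrite addr_gt0.
have e1 : expR (- s) <= (1 + s)^-1.
  by rewrite expRN lef_pV2 ?posrE ?expR_gt0// expR_ge1Dx.
have e2 := @expR_ge1Dx R (- s).
have E : (1 + s)^-1 = 1 - s / (1 + s) by field; rewrite gt_eqF.
split; first by lra.
have : s - s / (1 + s) <= s ^+ 2.
  rewrite -subr_ge0 (_ : _ - _ = s ^+ 3 / (1 + s)).
    by rewrite divr_ge0 ?exprn_ge0// ltW.
  by field; rewrite gt_eqF.
rewrite ler_norml => H; apply/andP; split; lra.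
Qed.

Lemma taylor_cos2 (p : R) : taylor cos_sign 2 p = 1.
Proof.
rewrite /taylor !big_ord_recl big_ord0 /cos_sign /= expr0 mul0r !mul1r mul0r !addr0.
by rewrite fact0 invr1 mul0r addr0 mul1r.
Qed.

Lemma taylor_sin1 (p : R) : taylor sin_sign 1 p = 0.
Proof. by rewrite /taylor big_ord_recl big_ord0 /sin_sign /= !mul0r addr0. Qed.

Lemma taylor_sin2 (p : R) : taylor sin_sign 2 p = p.
Proof.
rewrite /taylor !big_ord_recl big_ord0 /sin_sign /= !mul0r add0r addr0.
by rewrite expr0 mul1r factS fact0 divr1 mul1r expr1.
Qed.

Lemma resolvent_parts_le (y u : R) : 0 < y ->
  `|y / (u ^+ 2 + y ^+ 2)| <= y^-1 /\ `|u / (u ^+ 2 + y ^+ 2)| <= y^-1.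
Proof.
move=> y0; have q0 : 0 < u ^+ 2 + y ^+ 2 by rewrite ltr_wpDl ?sqr_ge0 ?exprn_gt0.
split.
  rewrite ger0_norm ?divr_ge0 ?(ltW y0) ?(ltW q0)// ler_pdivrMr// mulrC ler_pdivlMr//.
  by rewrite -expr2 lerDr sqr_ge0.
rewrite normrM normfV (gtr0_norm q0) ler_pdivrMr// mulrC ler_pdivlMr//.
rewrite -[u ^+ 2]real_normK ?num_real//.
have := sqr_ge0 (`|u| - y); have := sqr_ge0 (`|u| + y); nra.
Qed.

(* Riemann sum of step h for
   [1 / (y - i u) = \int_0^oo exp(- t y) (cos (t u) + i sin (t u)) dt]. *)
Lemma resolvent_trig_approx (y u h : R) K : 0 < y -> 0 < h ->
  let r := expR (- (h * y)) in
  let err := (1 + h * y) / y *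
    (4 * h * (y ^+ 2 + u ^+ 2) / y + 2 * r ^+ K) in
  `|y / (u ^+ 2 + y ^+ 2) - h * \sum_(k < K) r ^+ k * cos (k%:R * (h * u))| <= err /\
  `|u / (u ^+ 2 + y ^+ 2) - h * \sum_(k < K) r ^+ k * sin (k%:R * (h * u))| <= err.
Proof.
move=> y0 h0 r err; have hy0 : 0 < h * y by rewrite mulr_gt0.
have [g1 g2] := geometric_cos_sin r (h * u) K.
have [d1 d2] := expRN_bounds hy0; rewrite -/r in d1 d2.
set p := h * u in g1 g2 *.
set C := \sum_(_ < _) _ in g1 g2 *; set D := \sum_(_ < _) _ in g1 g2 *.
set P := y / _; set Q := u / _.
have q0 : 0 < u ^+ 2 + y ^+ 2 by rewrite ltr_wpDl ?sqr_ge0 ?exprn_gt0.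
(* Together with [PQ2] this is [(y - i u) (P + i Q) = 1]. *)
have PQ1 : y * P + u * Q = 1 by rewrite /P /Q; field; rewrite gt_eqF.
have PQ2 : y * Q - u * P = 0 by rewrite /P /Q; field; rewrite gt_eqF.
have r0 : 0 < r := expR_gt0 _.
have r1 : r <= 1 by rewrite -expR0 ler_expR oppr_le0 ltW.
have a1 : 1 - r <= 1 - r * cos p.
  by rewrite lerD2l lerN2 ler_piMr ?(ltW r0)// cos_le1.
have d0 : 0 < 1 - r.
  by apply: lt_le_trans d1; rewrite divr_gt0// addr_gt0.
set a := 1 - r * cos p in g1 g2 a1 *; set s := r * sin p in g1 g2 *.
(* [E1] and [E2] express the error multiplied by [a - i s = 1 - r e^(i p)], which is close to
   [h (y - i u)]. *)
have E1 : a * (P - h * C) + s * (Q - h * D) =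
    (a - h * y) * P + (s - h * u) * Q + h * (r ^+ K * cos (K%:R * p)).
  transitivity (a * P + s * Q - h * (a * C + s * D)); first by ring.
  rewrite g1; transitivity (a * P + s * Q - h * (y * P + u * Q) + h * (r ^+ K * cos (K%:R * p))).
    by rewrite PQ1; ring.
  by ring.
have E2 : a * (Q - h * D) - s * (P - h * C) =
    (a - h * y) * Q - (s - h * u) * P + h * (r ^+ K * sin (K%:R * p)).
  transitivity (a * Q - s * P - h * (a * D - s * C)); first by ring.
  rewrite g2; transitivity (a * Q - s * P - h * (y * Q - u * P) + h * (r ^+ K * sin (K%:R * p))).
    by rewrite PQ2; ring.
  by ring.
have [Pb Qb] := resolvent_parts_le u y0.
have p2 : p ^+ 2 = h ^+ 2 * u ^+ 2 by rewrite /p exprMn.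
have ab : `|a - h * y| <= h ^+ 2 * (y ^+ 2 + u ^+ 2).
  have c2 : `|cos p - 1| <= p ^+ 2.
    have := cos_taylor_bound 2 p.
    rewrite taylor_cos2.
    rewrite real_normK ?num_real// => /le_trans; apply.
    rewrite (_ : 2`! = 2%N)//.
    by have := sqr_ge0 p; lra.
  have -> : a - h * y = (1 - r - h * y) - r * (cos p - 1) by rewrite /a; ring.
  apply: (le_trans (ler_normB _ _)); rewrite [leRHS]mulrDr lerD//.
    by rewrite -exprMn.
  rewrite normrM (gtr0_norm r0) -p2 -[leRHS]mul1r.
  by apply: ler_pM => //; exact: ltW.
have sb : `|s - h * u| <= h ^+ 2 * (y ^+ 2 + u ^+ 2).
  have s1 : `|sin p| <= `|p|.
    have := sin_taylor_bound 1 p.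
    by rewrite taylor_sin1 subr0 expr1 divr1.
  have s2 : `|sin p - p| <= p ^+ 2 / 2.
    have := sin_taylor_bound 2 p.
    by rewrite taylor_sin2 real_normK ?num_real.
  have -> : s - h * u = (sin p - p) - (1 - r) * sin p by rewrite /s -/p; ring.
  apply: (le_trans (ler_normB _ _)).
  have rb : `|1 - r| <= h * y.
    by rewrite ger0_norm ?(ltW d0)//; have := @expR_ge1Dx R (- (h * y)); rewrite -/r; lra.
  apply: (@le_trans _ _ (p ^+ 2 / 2 + h * y * `|p|)).
    by rewrite lerD// normrM ler_pM.
  rewrite /p normrM (gtr0_norm h0) exprMn -[u ^+ 2]real_normK ?num_real//.
  have := sqr_ge0 (`|u| - y); have := sqr_ge0 h; set w := `|u|.
  move=> hh uy; have := mulr_ge0 hh uy; have := mulr_ge0 hh (sqr_ge0 y).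
  by lra.
have trigK (z : R) : `|z| <= 1 -> `|h * (r ^+ K * z)| <= h * r ^+ K.
  have hr : 0 <= h * r ^+ K by rewrite mulr_ge0 ?exprn_ge0 ?(ltW r0) ?(ltW h0).
  by move=> z1; rewrite mulrA normrM (ger0_norm hr) ler_piMr.
set M := h ^+ 2 * (y ^+ 2 + u ^+ 2) in ab sb.
have Xb (X : R) : X = (a - h * y) * P + (s - h * u) * Q + h * (r ^+ K * cos (K%:R * p)) ->
    `|X| <= 2 * M / y + h * r ^+ K.
  move=> ->; apply: (le_trans (ler_normD _ _)); apply: lerD; last exact/trigK/cos_max.
  apply: (le_trans (ler_normD _ _)); rewrite (normrM _ P) (normrM _ Q).
  apply: (@le_trans _ _ (M / y + M / y)); last by lra.
  by apply: lerD; apply: ler_pM.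
have Yb (X : R) : X = (a - h * y) * Q - (s - h * u) * P + h * (r ^+ K * sin (K%:R * p)) ->
    `|X| <= 2 * M / y + h * r ^+ K.
  move=> ->; apply: (le_trans (ler_normD _ _)); apply: lerD; last exact/trigK/sin_max.
  apply: (le_trans (ler_normB _ _)); rewrite (normrM _ P) (normrM _ Q).
  apply: (@le_trans _ _ (M / y + M / y)); last by lra.
  by apply: lerD; apply: ler_pM.
(* The lower bound [h y / (1 + h y)] on [1 - r] is the source of the prefactor [(1 + h y) / y]; it
   cancels the common factor [h] of the numerator. *)
have errb : (2 * M / y + h * r ^+ K + (2 * M / y + h * r ^+ K)) / (1 - r) <= err.
  rewrite ler_pdivrMr//; apply: (@le_trans _ _ (err * (h * y / (1 + h * y)))); last first.
    rewrite ler_wpM2l// /err mulr_ge0//.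
      by rewrite divr_ge0 ?addr_ge0 ?(ltW hy0) ?(ltW y0).
    by rewrite addr_ge0 ?mulr_ge0 ?divr_ge0 ?mulr_ge0 ?addr_ge0 ?sqr_ge0 ?exprn_ge0
      ?invr_ge0 ?(ltW h0) ?(ltW y0) ?(ltW r0).
  rewrite /err /M; set rK := r ^+ K.
  have rK0 : 0 <= rK by rewrite exprn_ge0 ?(ltW r0).
  rewrite le_eqVlt; apply/orP; left; apply/eqP; field.
  by rewrite !gt_eqF// addr_gt0.
have [Z1 Z2] := rotation_bound d0 a1 E1 E2.
have ZZ := lerD (Xb _ erefl) (Yb _ erefl).
have di : 0 <= (1 - r)^-1 by rewrite invr_ge0 ltW.
have ZE := le_trans (ler_wpM2r di ZZ) errb.
by split; [exact: le_trans Z1 ZE|exact: le_trans Z2 ZE].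
Qed.

End resolvent_approximation.

(** * Averages against the mean empirical measure *)

Section empirical_average.
Context {R : realType}.
Local Notation RT := (measurableTypeR R).

(** One-variable counterpart of [tame]: a moderate function of any single eigenvalue is tame. *)
Definition moderate (g : R -> R) := continuous g /\
  exists (C : R) (K : nat), 0 <= C /\ forall s, `|g s| <= C * (1 + s ^+ 2) ^+ K.

Lemma moderate_tame (g : R -> R) n (i : 'I_n) : moderate g ->
  tame (fun t : n.-tuple RT => g (tnth t i)).
Proof.
move=> [cg [C [K [C0 gC]]]]; split.
- apply: (measurableT_comp (continuous_measurable_fun cg)).
  exact: measurable_tnth.
- move=> t l; under eq_fun do rewrite tnth_mktuple.
  by case: eqP => _ s; [exact: cg|exact: cvg_cst].
- exists C, K; split => // t; apply: (le_trans (gC _)).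
  rewrite ler_wpM2l// lerXn2r ?sqr_weight_tnth// nnegrE.
    by rewrite addr_ge0// sqr_ge0.
  by rewrite (le_trans _ (sqr_weight_ge1 t)).
Qed.

Lemma moderate_bounded (g : R -> R) (M : R) : continuous g ->
  (forall s, `|g s| <= M) -> moderate g.
Proof.
move=> cg gM; split=> //; exists M, 0%N; split.
  exact: le_trans (normr_ge0 _) (gM 0).
by move=> s; rewrite expr0 mulr1.
Qed.

Lemma moderate_cst (a : R) : moderate (fun=> a).
Proof. by apply: (moderate_bounded (M := `|a|)) => //; exact: cst_continuous. Qed.

Lemma moderateX k : moderate (fun s => s ^+ k).
Proof.
split; first by move=> s; exact: exprn_continuous.
exists 1, k; split => // s; rewrite mul1r normrX lerXn2r ?nnegrE//.
  by rewrite addr_ge0// sqr_ge0.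
rewrite -[s ^+ 2]real_normK ?num_real//.
by have := sqr_ge0 (`|s| - 1 / 2); nra.
Qed.

Lemma moderateD f g : moderate f -> moderate g -> moderate (fun s => f s + g s).
Proof.
move=> [cf [C [K [C0 fC]]]] [cg [D [L [D0 gD]]]]; split.
  by move=> s; apply: cvgD; [exact: cf|exact: cg].
exists (C + D), (K + L)%N; split; first exact: addr_ge0.
move=> s; have s1 : 1 <= 1 + s ^+ 2 by rewrite lerDl sqr_ge0.
rewrite (le_trans (ler_normD _ _))// mulrDl lerD//.
  by rewrite (le_trans (fC s))// ler_wpM2l// ler_weXn2l ?leq_addr.
by rewrite (le_trans (gD s))// ler_wpM2l// ler_weXn2l ?leq_addl.
Qed.

Lemma moderateZ a f : moderate f -> moderate (fun s => a * f s).
Proof.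
move=> [cf [C [K [C0 fC]]]]; split.
  by move=> s; apply: cvgM; [exact: cvg_cst|exact: cf].
exists (`|a| * C), K; split; first exact: mulr_ge0.
by move=> s; rewrite normrM -mulrA ler_wpM2l.
Qed.

Lemma moderate_sum I (r : seq I) (g : I -> R -> R) :
  (forall i, moderate (g i)) -> moderate (fun s => \sum_(i <- r) g i s).
Proof.
move=> mg; elim: r => [|i r IH].
  by under eq_fun do rewrite big_nil; exact: moderate_cst.
by under eq_fun do rewrite big_cons; exact: moderateD.
Qed.

Lemma moderate_cos w : moderate (fun s => cos (w * s)).
Proof.
apply: (moderate_bounded (M := 1)); last by move=> s; exact: cos_max.
move=> s; apply: (cvg_comp (fun s => w * s) cos).
  by apply: cvgM; [exact: cvg_cst|exact: cvg_id].
exact: continuous_cos.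
Qed.

Lemma moderate_sin w : moderate (fun s => sin (w * s)).
Proof.
apply: (moderate_bounded (M := 1)); last by move=> s; exact: sin_max.
move=> s; apply: (cvg_comp (fun s => w * s) sin).
  by apply: cvgM; [exact: cvg_cst|exact: cvg_id].
exact: continuous_sin.
Qed.

Definition emp_avg (c b : R) n (g : R -> R) : R :=
  gauss_avg c b (fun t : n.-tuple RT => n%:R^-1 * \sum_(i < n) g (tnth t i)).

Section fixed_parameters.
Context (c b : R) (n : nat) (c0 : 0 < c) (b0 : 0 < b) (n0 : (0 < n)%N).

Let tame_emp g : moderate g ->
  tame (fun t : n.-tuple RT => n%:R^-1 * \sum_(i < n) g (tnth t i)).
Proof.
by move=> mg; apply: tameZ; apply: tame_sum => i _; exact: moderate_tame.
Qed.

Lemma emp_avg_cst a : emp_avg c b n (fun=> a) = a.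
Proof.
rewrite /emp_avg sumr_const card_ord -(mulr_natl a n).
by rewrite mulKf ?gauss_avg_cst// pnatr_eq0 -lt0n.
Qed.

Lemma emp_avgZ a g : moderate g ->
  emp_avg c b n (fun s => a * g s) = a * emp_avg c b n g.
Proof.
move=> mg; rewrite /emp_avg -gauss_avgZ//; last exact: tame_emp.
by congr gauss_avg; apply/funext => t; rewrite -mulr_sumr mulrCA.
Qed.

Lemma emp_avgD f g : moderate f -> moderate g ->
  emp_avg c b n (fun s => f s + g s) = emp_avg c b n f + emp_avg c b n g.
Proof.
move=> mf mg; rewrite /emp_avg -gauss_avgD//; [|exact: tame_emp|exact: tame_emp].
by congr gauss_avg; apply/funext => t; rewrite big_split/= mulrDr.
Qed.

Lemma emp_avg_sum I (r : seq I) (g : I -> R -> R) : (forall i, moderate (g i)) ->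
  emp_avg c b n (fun s => \sum_(i <- r) g i s) = \sum_(i <- r) emp_avg c b n (g i).
Proof.
move=> mg; elim: r => [|i r IH].
  by under eq_fun do rewrite big_nil; rewrite emp_avg_cst big_nil.
under eq_fun do rewrite big_cons; rewrite big_cons emp_avgD ?IH//.
exact: moderate_sum.
Qed.

Lemma emp_avg_dist f g h : moderate f -> moderate g -> moderate h ->
  (forall s, `|f s - g s| <= h s) ->
  `|emp_avg c b n f - emp_avg c b n g| <= emp_avg c b n h.
Proof.
move=> mf mg mh fgh; apply: gauss_avg_dist => //; try exact: tame_emp.
move=> t; rewrite -mulrBr -sumrB normrM ger0_norm ?invr_ge0// ler_wpM2l ?invr_ge0//.
by rewrite (le_trans (ler_norm_sum _ _ _))//; apply: ler_sum => i _.
Qed.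

Lemma emp_avgX k : emp_avg c b n (fun s => s ^+ k) = gauss_avg c b (@nprod R [:: k] n).
Proof.
by congr gauss_avg; apply/funext => t; rewrite /nprod big_cons big_nil mulr1.
Qed.

End fixed_parameters.

End empirical_average.

(** Convergence passes to approximation within every [e] near [F], by the Cauchy criterion, so no
    candidate for the limit has to be named. *)
Lemma cvg_approx {R : realType} {T : Type} {F : set_system T} {FF : ProperFilter F}
    (f : T -> R) :
  (forall e : R, 0 < e -> exists2 a : T -> R, cvg (a x @[x --> F]) &
    \forall x \near F, `|f x - a x| <= e) -> cvg (f x @[x --> F]).
Proof.
move=> H; apply: cauchy_cvg; apply: cauchy_exP => e e0.
have e20 : 0 < e / 2 by rewrite divr_gt0.
have e40 : 0 < e / 4 by rewrite divr_gt0.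
have [a ca fa] := H _ e40.
exists (lim (a x @[x --> F])).
have /cvgrPdist_lt/(_ _ e20) la := ca.
move: fa la; apply: filterS2 => x fa la; rewrite /ball/=.
set l := lim _ in la *.
have -> : l - f x = (l - a x) - (f x - a x) by ring.
rewrite (le_lt_trans (ler_normB _ _))// (lt_le_trans (ltr_leD la fa))//.
lra.
Qed.

Section emp_avg_convergence.
Context {R : realType} {T : Type} {F : set_system T} {FF : ProperFilter F}.
Context (c b : T -> R) (n : T -> nat) (A G : R).
Hypotheses (c0 : \forall x \near F, 0 < c x) (b0 : \forall x \near F, 0 < b x)
  (n0 : \forall x \near F, (0 < n x)%N).
Hypotheses (cA : (1 - b x / 2) / c x @[x --> F] --> A)
  (cB : (c x * (n x)%:R)^-1 @[x --> F] --> (0 : R))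
  (cG : b x * (n x)%:R / (2 * c x) @[x --> F] --> G).
(* Makes the Taylor remainders of [cos (w s)] and [sin (w s)] small on average,
   uniformly near [F]. *)
Hypothesis growth : forall w : R,
  w ^+ (2 * k) / (2 * k)`!%:R * moment A G (2 * k) @[k --> \oo] --> (0 : R).

Local Notation E g := (fun x => emp_avg (c x) (b x) (n x) g).

Lemma cvg_emp_avgX k : E (fun s => s ^+ k) x @[x --> F] --> moment A G k.
Proof.
under eq_fun do rewrite emp_avgX.
have := cvg_nprod (ks := [:: k]) c0 b0 n0 cA cB cG.
by rewrite big_cons big_nil mulr1 => /(_ FF).
Qed.

(** Averages of Taylor polynomials converge with the moments. The truncation order is even, so the
    remainder [|w s|^m] is a monomial whose average tends to a moment, made small by [growth]. *)
Let cvg_taylor (g : R -> R) (a : nat -> R) (w : R) : moderate g ->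
  (forall m s, `|g s - taylor a m (w * s)| <= `|w * s| ^+ m / m`!%:R) ->
  cvg (E g x @[x --> F]).
Proof.
move=> mg gT; apply: cvg_approx => e e0.
have /cvgrPdist_lt/(_ _ e0)[k _ /(_ k (leqnn k))/=] := growth w.
rewrite sub0r normrN => small.
pose m := (2 * k)%N.
exists (fun x => \sum_(j < m) (a j / j`!%:R * w ^+ j) * E (fun s => s ^+ j) x).
  apply: (cvgP (\sum_(j < m) (a j / j`!%:R * w ^+ j) * moment A G j)).
  apply: cvg_sumr => j _; apply: cvgM; first exact: cvg_cst.
  exact: cvg_emp_avgX.
have cR : (w ^+ m / m`!%:R) * E (fun s => s ^+ m) x @[x --> F] -->
    w ^+ m / m`!%:R * moment A G m.
  by apply: cvgM; [exact: cvg_cst|exact: cvg_emp_avgX].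
near=> x.
have cx : 0 < c x by near: x.
have bx : 0 < b x by near: x.
have nx : (0 < n x)%N by near: x.
have mX (j : nat) (z : R) : moderate (fun s : R => z * s ^+ j).
  by apply: moderateZ; exact: moderateX.
have -> : \sum_(j < m) (a j / j`!%:R * w ^+ j) * E (fun s => s ^+ j) x =
    emp_avg (c x) (b x) (n x) (fun s => \sum_(j < m) a j / j`!%:R * w ^+ j * s ^+ j).
  rewrite emp_avg_sum//; apply: eq_bigr => j _.
  by rewrite emp_avgZ//; exact: moderateX.
apply: (@le_trans _ _ (emp_avg (c x) (b x) (n x) (fun s => w ^+ m / m`!%:R * s ^+ m))).
  apply: emp_avg_dist => //.
    exact: moderate_sum.
  have w0 s : `|w * s| ^+ m = w ^+ m * s ^+ m.
    by rewrite -exprMn -normrX ger0_norm// /m mulnC exprM sqr_ge0.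
  move=> s; have := gT m s; rewrite w0.
  rewrite mulrAC => /(le_trans _); apply.
  rewrite le_eqVlt; apply/orP; left; apply/eqP; congr (`|_ - _|).
  by apply: eq_bigr => j _; rewrite exprMn mulrA.
rewrite emp_avgZ//; last exact: moderateX.
have : `|w ^+ m / m`!%:R * E (fun s => s ^+ m) x| < e.
  by near: x; apply: (cvgr_lt _ (cvg_norm cR)); exact: small.
by move=> /ltW; apply: le_trans; exact: ler_norm.
Unshelve. all: by end_near.
Qed.

Lemma is_cvg_emp_avg_cos w : cvg (E (fun s => cos (w * s)) x @[x --> F]).
Proof.
apply: (cvg_taylor (a := cos_sign) (w := w)); first exact: moderate_cos.
by move=> m s; exact: cos_taylor_bound.
Qed.

Lemma is_cvg_emp_avg_sin w : cvg (E (fun s => sin (w * s)) x @[x --> F]).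
Proof.
apply: (cvg_taylor (a := sin_sign) (w := w)); first exact: moderate_sin.
by move=> m s; exact: sin_taylor_bound.
Qed.

Lemma is_cvg_emp_avg_cosB (w a : R) : cvg (E (fun s => cos (w * (a - s))) x @[x --> F]).
Proof.
have H : cvg ((cos (w * a) * E (fun s => cos (w * s)) x +
    sin (w * a) * E (fun s => sin (w * s)) x) @[x --> F]).
  apply: is_cvgD; apply: is_cvgM; try exact: is_cvg_cst.
    exact: is_cvg_emp_avg_cos.
  exact: is_cvg_emp_avg_sin.
apply: cvgP; apply: cvg_trans H; apply: near_eq_cvg; near=> x.
have cx : 0 < c x by near: x.
have bx : 0 < b x by near: x.
have nx : (0 < n x)%N by near: x.
have mc := moderate_cos w; have ms := moderate_sin w.
rewrite -!emp_avgZ// -emp_avgD//; try exact: moderateZ.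
by congr emp_avg; apply/funext => s; rewrite mulrBr cosB.
Unshelve. all: by end_near.
Qed.

Lemma is_cvg_emp_avg_sinB (w a : R) : cvg (E (fun s => sin (w * (a - s))) x @[x --> F]).
Proof.
have H : cvg ((sin (w * a) * E (fun s => cos (w * s)) x +
    - cos (w * a) * E (fun s => sin (w * s)) x) @[x --> F]).
  apply: is_cvgD; apply: is_cvgM; try exact: is_cvg_cst.
    exact: is_cvg_emp_avg_cos.
  exact: is_cvg_emp_avg_sin.
apply: cvgP; apply: cvg_trans H; apply: near_eq_cvg; near=> x.
have cx : 0 < c x by near: x.
have bx : 0 < b x by near: x.
have nx : (0 < n x)%N by near: x.
have mc := moderate_cos w; have ms := moderate_sin w.
rewrite -!emp_avgZ// -emp_avgD//; try exact: moderateZ.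
by congr emp_avg; apply/funext => s; rewrite mulrBr sinB mulNr.
Unshelve. all: by end_near.
Qed.

(** Stated for abstract [g] and [trig] to serve the [cos] and [sin] parts alike. The approximation
    error grows quadratically in [u], so it is controlled on average by the second moment. *)
Let cvg_resolvent (g trig : R -> R) (y a : R) : 0 < y ->
  moderate (fun s => g (a - s)) -> (forall w, moderate (fun s => trig (w * (a - s)))) ->
  (forall w, cvg (E (fun s => trig (w * (a - s))) x @[x --> F])) ->
  (forall h K u, 0 < h ->
    `|g u - h * \sum_(k < K) expR (- (h * y)) ^+ k * trig (k%:R * (h * u))| <=
    (1 + h * y) / y * (4 * h * (y ^+ 2 + u ^+ 2) / y + 2 * expR (- (h * y)) ^+ K)) ->
  cvg (E (fun s => g (a - s)) x @[x --> F]).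
Proof.
move=> y0 mg mtrig ctrig gapprox; apply: cvg_approx => e e0.
have mX (j : nat) (z : R) : moderate (fun s : R => z * s ^+ j).
  by apply: moderateZ; exact: moderateX.
(* Spelled out in monomials so that linearity and the convergence of the moments apply directly. *)
pose q (s : R) := (y ^+ 2 + a ^+ 2) * s ^+ 0 + ((- 2 * a) * s ^+ 1 + 1 * s ^+ 2).
have mq : moderate q by apply: moderateD => //; exact: moderateD.
have qE s : q s = y ^+ 2 + (a - s) ^+ 2 by rewrite /q expr0 expr1; ring.
have [V cV] : exists V : R, E q x @[x --> F] --> V.
  exists ((y ^+ 2 + a ^+ 2) * moment A G 0 + ((- 2 * a) * moment A G 1 + 1 * moment A G 2)).
  have cX z j : z * E (fun s => s ^+ j) x @[x --> F] --> z * moment A G j.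
    by apply: cvgM; [exact: cvg_cst|exact: cvg_emp_avgX].
  apply: cvg_trans (cvgD (cX _ 0%N) (cvgD (cX _ 1%N) (cX _ 2%N))).
  apply: near_eq_cvg; near=> x.
  have cx : 0 < c x by near: x.
  have bx : 0 < b x by near: x.
  have nx : (0 < n x)%N by near: x.
  have mX1 := @moderateX R.
  by rewrite !addrfctE -!emp_avgZ// -emp_avgD// -emp_avgD//; exact: moderateD.
pose B := (1 + y) / y * (4 * (`|V| + 1) / y).
have V1 : 0 < `|V| + 1 by rewrite ltr_wpDl.
have B0 : 0 < B.
  by rewrite mulr_gt0// divr_gt0// ?addr_gt0// mulr_gt0.
(* The step is fixed before [K]: [h <= 1] replaces [1 + h y] by [1 + y], and [h B <= e / 2] handles
   the quadratic part. The truncation error [r^K] depends on [h] and is handled afterwards. *)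
pose h := Num.min 1 (e / (2 * B)).
have h0 : 0 < h by rewrite lt_min ltr01 divr_gt0// mulr_gt0.
have h1 : h <= 1 by rewrite ge_min lexx.
have hB : h * B <= e / 2.
  have : h <= e / (2 * B) by rewrite ge_min lexx orbT.
  have B20 : 0 < 2 * B by rewrite pmulr_rgt0.
  rewrite (ler_pdivlMr _ _ B20) => hBe.
  by rewrite ler_pdivlMr// -mulrA (mulrC B).
pose r := expR (- (h * y)).
have r0 : 0 <= r := expR_ge0 _.
have r1 : r < 1 by rewrite expR_lt1 oppr_lt0 mulr_gt0.
pose D := (1 + y) / y * 2.
have D0 : 0 < D by rewrite mulr_gt0// divr_gt0// addr_gt0.
have [K rK] : exists K, D * r ^+ K <= e / 2.
  have : r ^+ k @[k --> \oo] --> (0 : R) by apply: cvg_expr; rewrite ger0_norm.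
  have eD : 0 < e / 2 / D by rewrite !divr_gt0.
  move=> /cvgrPdist_lt/(_ _ eD)[K _ /(_ K (leqnn K))/=].
  rewrite sub0r normrN ger0_norm ?exprn_ge0// => H.
  by exists K; rewrite mulrC -ler_pdivlMr// ltW.
exists (fun x => \sum_(k < K) (h * r ^+ k) * E (fun s => trig (k%:R * h * (a - s))) x).
  apply: (cvgP (\sum_(k < K) (h * r ^+ k) *
    lim (E (fun s => trig (k%:R * h * (a - s))) x @[x --> F]))).
  apply: cvg_sumr => k _; apply: cvgM; first exact: cvg_cst.
  exact: ctrig.
near=> x.
have cx : 0 < c x by near: x.
have bx : 0 < b x by near: x.
have nx : (0 < n x)%N by near: x.
have mt (k : nat) (z : R) : moderate (fun s => z * trig (k%:R * h * (a - s))).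
  by apply: moderateZ; exact: mtrig.
have -> : \sum_(k < K) (h * r ^+ k) * E (fun s => trig (k%:R * h * (a - s))) x =
    emp_avg (c x) (b x) (n x)
      (fun s => \sum_(k < K) (h * r ^+ k) * trig (k%:R * h * (a - s))).
  rewrite emp_avg_sum//; apply: eq_bigr => k _.
  by rewrite emp_avgZ//; exact: mtrig.
pose z1 := (1 + y) / y * (4 * h / y).
have z10 : 0 <= z1.
  by rewrite !mulr_ge0 ?addr_ge0 ?invr_ge0 ?(ltW y0) ?(ltW h0).
apply: (@le_trans _ _ (emp_avg (c x) (b x) (n x) (fun s => z1 * q s + D * r ^+ K))).
  apply: emp_avg_dist => //.
  - exact: moderate_sum.
  - apply: moderateD; [exact: moderateZ|exact: moderate_cst].
  move=> s; have := gapprox h K (a - s) h0; rewrite -/r.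
  have -> : h * \sum_(k < K) r ^+ k * trig (k%:R * (h * (a - s))) =
      \sum_(k < K) h * r ^+ k * trig (k%:R * h * (a - s)).
    by rewrite mulr_sumr; apply: eq_bigr => k _; rewrite !mulrA.
  move=> /le_trans; apply; rewrite -qE.
  have qs0 : 0 <= q s by rewrite qE addr_ge0// sqr_ge0.
  apply: (@le_trans _ _ ((1 + y) / y * (4 * h * q s / y + 2 * r ^+ K))).
    apply: ler_wpM2r.
      by rewrite addr_ge0 ?mulr_ge0 ?invr_ge0 ?exprn_ge0 ?(ltW y0) ?(ltW h0).
    by rewrite ler_wpM2r ?invr_ge0 ?(ltW y0)// lerD2l ler_piMl// ltW.
  by rewrite le_eqVlt; apply/orP; left; apply/eqP; rewrite /z1 /D; ring.
rewrite emp_avgD ?emp_avg_cst ?emp_avgZ//; last 2 first.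
- exact: moderateZ.
- exact: moderate_cst.
have Vx : E q x <= `|V| + 1.
  apply: ltW; near: x; apply: (cvgr_lt _ cV).
  by rewrite (le_lt_trans (ler_norm V))// ltrDl.
rewrite (splitr e) lerD// (le_trans (ler_wpM2l z10 Vx))// (le_trans _ hB)//.
by rewrite le_eqVlt; apply/orP; left; apply/eqP; rewrite /z1 /B; ring.
Unshelve. all: by end_near.
Qed.

Lemma continuous_resolvent_denominator (y a : R) : 0 < y ->
  continuous (fun s : R => ((a - s) ^+ 2 + y ^+ 2)^-1).
Proof.
move=> y0 s; apply: cvgV.
  by rewrite gt_eqF// ltr_wpDl ?sqr_ge0// exprn_gt0.
apply: cvgD; last exact: cvg_cst.
apply: (cvg_comp (fun s => a - s) (fun s => s ^+ 2)); last exact: exprn_continuous.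
by apply: cvgB; [exact: cvg_cst|exact: cvg_id].
Qed.

Lemma moderate_resolvent (y a : R) : 0 < y ->
  moderate (fun s : R => y / ((a - s) ^+ 2 + y ^+ 2)) /\
  moderate (fun s : R => (a - s) / ((a - s) ^+ 2 + y ^+ 2)).
Proof.
move=> y0; have cd := @continuous_resolvent_denominator y a y0; split.
  apply: (moderate_bounded (M := y^-1)).
    by move=> s; apply: cvgM; [exact: cvg_cst|exact: cd].
  by move=> s; have [] := resolvent_parts_le (a - s) y0.
apply: (moderate_bounded (M := y^-1)).
  move=> s; apply: cvgM; last exact: cd.
  by apply: cvgB; [exact: cvg_cst|exact: cvg_id].
by move=> s; have [] := resolvent_parts_le (a - s) y0.
Qed.

Lemma is_cvg_emp_avg_resolvent (y a : R) : 0 < y ->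
  cvg (E (fun s => y / ((a - s) ^+ 2 + y ^+ 2)) x @[x --> F]) /\
  cvg (E (fun s => (a - s) / ((a - s) ^+ 2 + y ^+ 2)) x @[x --> F]).
Proof.
move=> y0; have [m1 m2] := moderate_resolvent a y0; split.
  apply: (cvg_resolvent (g := fun u => y / (u ^+ 2 + y ^+ 2)) (trig := cos) y0) => //.
  - move=> w; apply: (moderate_bounded (M := 1)); last by move=> s; exact: cos_max.
    move=> s; apply: (cvg_comp (fun s => w * (a - s)) cos); last exact: continuous_cos.
    apply: cvgM; [exact: cvg_cst|]; apply: cvgB; [exact: cvg_cst|exact: cvg_id].
  - by move=> w; exact: is_cvg_emp_avg_cosB.
  - by move=> h K u h0; have [] := resolvent_trig_approx u K y0 h0.
apply: (cvg_resolvent (g := fun u => u / (u ^+ 2 + y ^+ 2)) (trig := sin) y0) => //.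
- move=> w; apply: (moderate_bounded (M := 1)); last by move=> s; exact: sin_max.
  move=> s; apply: (cvg_comp (fun s => w * (a - s)) sin); last exact: continuous_sin.
  apply: cvgM; [exact: cvg_cst|]; apply: cvgB; [exact: cvg_cst|exact: cvg_id].
- by move=> w; exact: is_cvg_emp_avg_sinB.
- by move=> h K u h0; have [] := resolvent_trig_approx u K y0 h0.
Qed.

End emp_avg_convergence.

Local Open Scope complex_scope.

(** * Complex resolvents and their expansion *)

Section complex_parts.
Context {R : realType}.
Local Notation C := R[i].

Lemma Re_add (u v : C) : complex.Re (u + v) = complex.Re u + complex.Re v.
Proof. by case: u v => [a b] [c d]. Qed.

Lemma Im_add (u v : C) : complex.Im (u + v) = complex.Im u + complex.Im v.
Proof. by case: u v => [a b] [c d]. Qed.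

Lemma Re_scale (r : R) (z : C) : complex.Re (r%:C * z) = r * complex.Re z.
Proof. by case: z => [a b] /=; rewrite mul0r subr0. Qed.

Lemma Im_scale (r : R) (z : C) : complex.Im (r%:C * z) = r * complex.Im z.
Proof. by case: z => [a b] /=; rewrite mul0r addr0. Qed.

Lemma normc_ge_Im (z : C) : `|complex.Im z|%:C <= `|z|.
Proof.
have := normc_ge_Re (z * 'i%C); rewrite ReiNIm normrN normrM.
rewrite [`|'i%C|]normc_def /= expr0n expr1n add0r sqrtr1.
by rewrite mulr1.
Qed.

Lemma normc_real (r : R) : `|r%:C| = `|r|%:C :> C.
Proof. by rewrite normc_def /= expr0n addr0 sqrtr_sqr. Qed.

Lemma normc_le_ReIm (z : C) :
  `|z| <= (`|complex.Re z| + `|complex.Im z|)%:C.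
Proof.
rewrite {1}[z]complexE (le_trans (ler_normD _ _))// normrM !normc_real.
rewrite [`|'i%C|]normc_def /= expr0n expr1n add0r sqrtr1 mul1r.
by rewrite -rmorphD.
Qed.

Lemma normcE_real (z : C) : `|z| = (complex.Re `|z|)%:C.
Proof. by rewrite RRe_real// ger0_real. Qed.

Lemma cvg_complex (T : Type) (F : set_system T) {FF : ProperFilter F}
    (f g : T -> R) (lf lg : R) :
  f x @[x --> F] --> lf -> g x @[x --> F] --> lg ->
  ((f x +i* g x)%C : C^o) @[x --> F] --> ((lf +i* lg)%C : C^o).
Proof.
move=> cf cg; apply/cvgrPdist_lt => e e0.
have eE : e = (complex.Re e)%:C by rewrite RRe_real// ger0_real// ltW.
have e1 : 0 < complex.Re e / 2.
  by rewrite divr_gt0// -ltcR -eE.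
have /cvgrPdist_lt/(_ _ e1) H1 := cf.
have /cvgrPdist_lt/(_ _ e1) H2 := cg.
near=> x; apply: (le_lt_trans (normc_le_ReIm _)).
rewrite [ltRHS]eE ltcR /= (splitr (complex.Re e)) ltrD//.
  by near: x.
by near: x.
Unshelve. all: by end_near.
Qed.

Lemma Re_resolvent (x : C) (s : R) : complex.Re (x - s%:C)^-1 =
  (complex.Re x - s) / ((complex.Re x - s) ^+ 2 + `|complex.Im x| ^+ 2).
Proof. by case: x => [a y] /=; rewrite subr0 real_normK ?num_real. Qed.

Lemma Im_resolvent (x : C) (s : R) : complex.Im x != 0 ->
  complex.Im (x - s%:C)^-1 = - (complex.Im x / `|complex.Im x|) *
  (`|complex.Im x| / ((complex.Re x - s) ^+ 2 + `|complex.Im x| ^+ 2)).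
Proof.
case: x => [a y] /= y0; rewrite subr0 real_normK ?num_real//.
by rewrite mulrA mulNr divfK ?normr_eq0// mulNr.
Qed.

Lemma resolvent_expansion (x s : C) m : x != 0 -> x != s ->
  (x - s)^-1 - \sum_(k < m) s ^+ k * x ^- k.+1 = s ^+ m * (x ^- m * (x - s)^-1).
Proof.
move=> x0; rewrite -subr_eq0 => xs; elim: m => [|m IH].
  by rewrite big_ord0 subr0 !expr0 invr1 !mul1r.
rewrite big_ord_recr/= opprD addrA IH !exprS; field.
by rewrite xs x0 expf_neq0.
Qed.

End complex_parts.

Section resolvent_limit.
Context {R : realType} {T : Type} {F : set_system T} {FF : ProperFilter F}.
Context (c b : T -> R) (n : T -> nat) (A G : R).
Hypotheses (c0 : \forall x \near F, 0 < c x) (b0 : \forall x \near F, 0 < b x)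
  (n0 : \forall x \near F, (0 < n x)%N).
Hypotheses (cA : (1 - b x / 2) / c x @[x --> F] --> A)
  (cB : (c x * (n x)%:R)^-1 @[x --> F] --> (0 : R))
  (cG : b x * (n x)%:R / (2 * c x) @[x --> F] --> G).
Hypothesis growth : forall w : R,
  w ^+ (2 * k) / (2 * k)`!%:R * moment A G (2 * k) @[k --> \oo] --> (0 : R).

Local Notation C := R[i].
Local Notation E g := (fun x => emp_avg (c x) (b x) (n x) g).

Context (z : C) (z0 : complex.Im z != 0).

Let nu := complex.Re `|z|.

Let zneq0 : z != 0.
Proof. by apply: contraNneq z0 => ->. Qed.

Let zneqr (s : R) : z != s%:C.
Proof. by apply: contraNneq z0 => ->. Qed.

Let nu_gt0 : 0 < nu.
Proof. by rewrite -ltcR -normcE_real normr_gt0. Qed.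

(** [l] stands for the real or the imaginary part. The remainder of the geometric expansion is
    [s^m / (z^m (z - s))] with [|z - s| >= |Im z|]; as [m] is even, [s^m] is nonnegative and its
    average is a moment. The bound passes to the limit along [F] since it is a closed condition. *)
Let remainder_limit (l : C -> R) (L : R) q :
  (forall u v, l (u + v) = l u + l v) -> (forall r u, l (r%:C * u) = r * l u) ->
  (forall u, `|l u|%:C <= `|u|) -> moderate (fun s => l (z - s%:C)^-1) ->
  E (fun s => l (z - s%:C)^-1) x @[x --> F] --> L ->
  `|L - \sum_(k < 2 * q) l (z ^- k.+1) * moment A G k| <=
    (nu ^+ (2 * q) * `|complex.Im z|)^-1 * moment A G (2 * q).
Proof.
move=> lD lZ lb ml cL; set B := (_ * _)^-1; set m := (2 * q)%N in B *.
have mX (j : nat) (a : R) : moderate (fun s : R => a * s ^+ j).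
  by apply: moderateZ; exact: moderateX.
have l0 : l 0 = 0 by rewrite -(mul0r 0) -[X in X * _]/(0%:C) lZ mul0r.
have lN u : l (- u) = - l u.
  by apply/eqP; rewrite -addr_eq0 -lD addNr l0.
have lsum (I : Type) (r : seq I) (f : I -> C) :
    l (\sum_(i <- r) f i) = \sum_(i <- r) l (f i) by exact: big_morph.
have c1 : `|E (fun s => l (z - s%:C)^-1) x -
    \sum_(k < m) l (z ^- k.+1) * E (fun s => s ^+ k) x| @[x --> F] -->
    `|L - \sum_(k < m) l (z ^- k.+1) * moment A G k|.
  apply: cvg_norm; apply: cvgB => //; apply: cvg_sumr => k _.
  apply: cvgM; first exact: cvg_cst.
  exact: cvg_emp_avgX.
have c2 : B * E (fun s => s ^+ m) x @[x --> F] --> B * moment A G m.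
  apply: cvgM; first exact: cvg_cst.
  exact: cvg_emp_avgX.
rewrite -subr_ge0.
apply: (@closed_cvg _ _ F FF _ (fun y : R => 0 <= y) (@closed_ge R 0)); last first.
  by apply: cvgB; [exact: c2|exact: c1].
near=> x; rewrite /= subr_ge0.
have cx : 0 < c x by near: x.
have bx : 0 < b x by near: x.
have nx : (0 < n x)%N by near: x.
have -> : \sum_(k < m) l (z ^- k.+1) * E (fun s => s ^+ k) x =
    emp_avg (c x) (b x) (n x) (fun s => \sum_(k < m) l (z ^- k.+1) * s ^+ k).
  rewrite emp_avg_sum//; apply: eq_bigr => k _.
  by rewrite emp_avgZ//; exact: moderateX.
rewrite -emp_avgZ//; last exact: moderateX.
apply: emp_avg_dist => //; first exact: moderate_sum.
move=> s; have := resolvent_expansion m zneq0 (zneqr s).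
move=> /(congr1 l); rewrite lD lN lsum.
have -> : \sum_(k < m) l (s%:C ^+ k * z ^- k.+1) = \sum_(k < m) l (z ^- k.+1) * s ^+ k.
  by apply: eq_bigr => k _; rewrite -rmorphXn lZ mulrC.
move=> ->; rewrite -lecR (le_trans (lb _))// !normrM !normfV !normrX normc_real.
have s0 : 0 <= s ^+ m by rewrite exprM exprn_ge0// sqr_ge0.
have nE : `|s|%:C ^+ m = (s ^+ m)%:C :> C.
  by rewrite -(ger0_norm s0) normrX rmorphXn.
rewrite nE.
have zs : `|complex.Im z|%:C <= `|z - s%:C|.
  apply: le_trans (normc_ge_Im _); rewrite lecR Im_add.
  by rewrite [X in _ + X](_ : _ = 0) ?addr0//= oppr0.
rewrite mulrC rmorphM /= ler_wpM2r ?ler0c//.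
have nuE : (nu ^+ m)%:C = `|z| ^+ m by rewrite rmorphXn /= -normcE_real.
have -> : B%:C = `|z| ^- m / `|complex.Im z|%:C.
  by rewrite /B invfM rmorphM /= !fmorphV /= nuE.
rewrite ler_wpM2l ?invr_ge0 ?exprn_ge0//.
have p1 : 0 < `|z - s%:C| by rewrite normr_gt0 subr_eq0.
have p2 : 0 < `|complex.Im z|%:C :> C by rewrite (ltcR 0) normr_gt0.
by rewrite lef_pV2.
Unshelve. all: by end_near.
Qed.

Lemma even_sum (V : zmodType) (f : nat -> V) q : (forall k, odd k -> f k = 0) ->
  \sum_(k < 2 * q) f k = \sum_(p < q) f (2 * p)%N.
Proof.
move=> fodd; elim: q => [|q IH]; first by rewrite !big_ord0.
rewrite mulnS big_ord_recr big_ord_recr/= IH [in RHS]big_ord_recr/=.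
by rewrite (fodd (_.+1)) ?addr0//= mul2n odd_double.
Qed.

(** One [W] satisfies the bound for every order [q], so the estimate serves both convergent and
    merely asymptotic expansions. The factor 2 comes from adding the bounds for the two parts. *)
Lemma emp_avg_resolvent_limit : exists W : C,
  (((E (fun s => complex.Re (z - s%:C)^-1) x +i*
     E (fun s => complex.Im (z - s%:C)^-1) x)%C : C^o) @[x --> F] --> (W : C^o)) /\
  forall q, `|W - \sum_(p < q) (moment A G (2 * p))%:C / z ^+ (2 * p).+1| <=
    (2 * moment A G (2 * q) / `|complex.Im z|)%:C / `|z| ^+ (2 * q).
Proof.
have y0 : 0 < `|complex.Im z| by rewrite normr_gt0.
have [mI mR] := moderate_resolvent (complex.Re z) y0.
have [cI cR] := is_cvg_emp_avg_resolvent c0 b0 n0 cA cB cG growth (complex.Re z) y0.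
have mRe : moderate (fun s => complex.Re (z - s%:C)^-1).
  by under eq_fun do rewrite Re_resolvent.
have mIm : moderate (fun s => complex.Im (z - s%:C)^-1).
  by under eq_fun do rewrite Im_resolvent//; exact: moderateZ.
have [LR cLR] : exists L : R, E (fun s => complex.Re (z - s%:C)^-1) x @[x --> F] --> L.
  rewrite (_ : (fun s => complex.Re (z - s%:C)^-1) = fun s => (complex.Re z - s) /
    ((complex.Re z - s) ^+ 2 + `|complex.Im z| ^+ 2)); first by eexists; exact: cR.
  by apply/funext => s; exact: Re_resolvent.
have [LI cLI] : exists L : R, E (fun s => complex.Im (z - s%:C)^-1) x @[x --> F] --> L.
  pose k := - (complex.Im z / `|complex.Im z|).
  pose e x := E (fun s => `|complex.Im z| /
    ((complex.Re z - s) ^+ 2 + `|complex.Im z| ^+ 2)) x.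
  have cZ : k * e x @[x --> F] --> k * lim (e x @[x --> F]).
    by apply: cvgM; [exact: cvg_cst|exact: cI].
  exists (k * lim (e x @[x --> F])).
  apply: cvg_trans cZ; apply: near_eq_cvg; near=> x.
  have cx : 0 < c x by near: x.
  have bx : 0 < b x by near: x.
  rewrite /e -emp_avgZ//; congr emp_avg; apply/funext => s.
  by rewrite Im_resolvent.
exists (LR +i* LI)%C; split; first exact: cvg_complex.
move=> q.
have RR := remainder_limit q Re_add Re_scale (@normc_ge_Re R) mRe cLR.
have RI := remainder_limit q Im_add Im_scale normc_ge_Im mIm cLI.
have e0 : \sum_(p < q) (moment A G (2 * p))%:C / z ^+ (2 * p).+1 =
    \sum_(k < 2 * q) (moment A G k)%:C * z ^- k.+1.
  rewrite (even_sum (f := fun k => (moment A G k)%:C * z ^- k.+1))// => k ok.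
  by rewrite moment_odd// mul0r.
have ReS : complex.Re (\sum_(k < 2 * q) (moment A G k)%:C * z ^- k.+1) =
    \sum_(k < 2 * q) complex.Re (z ^- k.+1) * moment A G k.
  rewrite (big_morph _ Re_add (erefl : complex.Re 0 = 0)).
  by apply: eq_bigr => k _; rewrite Re_scale mulrC.
have ImS : complex.Im (\sum_(k < 2 * q) (moment A G k)%:C * z ^- k.+1) =
    \sum_(k < 2 * q) complex.Im (z ^- k.+1) * moment A G k.
  rewrite (big_morph _ Im_add (erefl : complex.Im 0 = 0)).
  by apply: eq_bigr => k _; rewrite Im_scale mulrC.
rewrite e0 (le_trans (normc_le_ReIm _))//.
set S := \sum_(_ < _) _ in ReS ImS *.
have -> : complex.Re ((LR +i* LI)%C - S) = LR - complex.Re S by case: (S).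
have -> : complex.Im ((LR +i* LI)%C - S) = LI - complex.Im S by case: (S).
rewrite ReS ImS; apply: (@le_trans _ _ ((nu ^+ (2 * q) * `|complex.Im z|)^-1 * moment A G (2 * q) +
  (nu ^+ (2 * q) * `|complex.Im z|)^-1 * moment A G (2 * q))%:C).
  by rewrite lecR lerD.
rewrite le_eqVlt; apply/orP; left; apply/eqP.
rewrite [in RHS]normcE_real -/nu -rmorphXn -rmorphV; last first.
  by rewrite unitfE expf_neq0// (gt_eqF nu_gt0).
rewrite -rmorphM; congr (_%:C); field.
by rewrite expf_neq0 ?gt_eqF.
Unshelve. all: by end_near.
Qed.

End resolvent_limit.

(** * The two limits of the one-point function *)

Section one_point_average.
Context {R : realType}.
Local Notation C := R[i].
Local Notation RT := (measurableTypeR R).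

Lemma moderate_Re_resolvent (z : C) : complex.Im z != 0 ->
  moderate (fun s => complex.Re (z - s%:C)^-1).
Proof.
move=> z0; have y0 : 0 < `|complex.Im z| by rewrite normr_gt0.
have [_ mR] := moderate_resolvent (complex.Re z) y0.
by under eq_fun do rewrite Re_resolvent.
Qed.

Lemma moderate_Im_resolvent (z : C) : complex.Im z != 0 ->
  moderate (fun s => complex.Im (z - s%:C)^-1).
Proof.
move=> z0; have y0 : 0 < `|complex.Im z| by rewrite normr_gt0.
have [mI _] := moderate_resolvent (complex.Re z) y0.
by under eq_fun do rewrite Im_resolvent//; exact: moderateZ.
Qed.

Lemma gauss_avg_linear_statistic (c b : R) n (g : R -> R) :
  0 < c -> 0 < b -> (0 < n)%N -> moderate g ->
  gauss_avg c b (fun t : n.-tuple RT => \sum_(j < n) g (tnth t j)) =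
  n%:R * emp_avg c b n g.
Proof.
move=> c0 b0 n0 mg; rewrite /emp_avg -gauss_avgZ//.
  congr gauss_avg; apply/funext => t.
  by rewrite mulVKf// pnatr_eq0 -lt0n.
by apply: tameZ; apply: tame_sum => i _; exact: moderate_tame.
Qed.

Lemma one_pointE (c b : R) n (z : C) :
  0 < c -> 0 < b -> (0 < n)%N -> complex.Im z != 0 ->
  one_point (fun l => expR (- (c * l ^+ 2 / 2))) b n z =
  n%:R * (emp_avg c b n (fun s => complex.Re (z - s%:C)^-1) +i*
          emp_avg c b n (fun s => complex.Im (z - s%:C)^-1)).
Proof.
move=> c0 b0 n0 z0.
have nC : n%:R = (n%:R : R)%:C :> C by rewrite rmorph_nat.
rewrite nC [RHS](_ : _ = (n%:R * emp_avg c b n (fun s => complex.Re (z - s%:C)^-1)) +i*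
  (n%:R * emp_avg c b n (fun s => complex.Im (z - s%:C)^-1))); last first.
  by apply/eqP; rewrite eq_complex /= !mul0r subr0 addr0 !eqxx.
rewrite -!gauss_avg_linear_statistic//;
  [|exact: moderate_Im_resolvent|exact: moderate_Re_resolvent].
rewrite /one_point; congr (_ +i* _); congr ME_average; apply/funext => t.
  by rewrite (big_morph _ Re_add (erefl : complex.Re 0 = 0)).
by rewrite (big_morph _ Im_add (erefl : complex.Im 0 = 0)).
Qed.

End one_point_average.

Section moment_growth_limits.
Context {R : realType}.

(** Since [(k!)^2 <= (2 k)!], the sequence is dominated by the terms of the exponential series of
    [w^2 D]. *)
Lemma growth_of_factorial_bound (A G C D : R) :
  (forall k, 0 <= moment A G (2 * k) <= C * (D ^+ k * k`!%:R)) -> 0 <= D ->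
  forall w : R,
  w ^+ (2 * k) / (2 * k)`!%:R * moment A G (2 * k) @[k --> \oo] --> (0 : R).
Proof.
move=> mb D0 w.
have C0 : 0 <= C.
  by have /andP[m0 m1] := mb 0%N; have := le_trans m0 m1; rewrite expr0 !mulr1.
have lim0 : C * exp_coeff (w ^+ 2 * D) k @[k --> \oo] --> (0 : R).
  rewrite -[X in _ --> X](mulr0 C); apply: cvgM; first exact: cvg_cst.
  by apply: cvg_series_cvg_0; exact: is_cvg_series_exp_coeff.
apply: (squeeze_cvgr _ (cvg_cst 0) lim0); apply: nearW => k.
have /andP[m0 m1] := mb k.
have w0 : 0 <= w ^+ (2 * k) by rewrite exprM exprn_ge0// sqr_ge0.
rewrite mulr_ge0 ?divr_ge0//=.
apply: (le_trans (ler_wpM2l (divr_ge0 w0 (ler0n _ _)) m1)).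
rewrite /exp_coeff /= exprMn -exprM.
have f0 : 0 < (2 * k)`!%:R :> R by rewrite ltr0n fact_gt0.
have g0 : 0 < k`!%:R :> R by rewrite ltr0n fact_gt0.
have fg : k`!%:R * k`!%:R <= (2 * k)`!%:R :> R.
  rewrite -natrM ler_nat -(bin_fact (leq_pmull k (isT : 0 < 2)%N)).
  by rewrite mul2n -addnn addnK leq_pmull// bin_gt0 leq_addr.
rewrite [leLHS](_ : _ = C * (w ^+ (2 * k) * D ^+ k) * (k`!%:R / (2 * k)`!%:R)); last first.
  by ring.
rewrite [leRHS](_ : _ = C * (w ^+ (2 * k) * D ^+ k) * (k`!%:R)^-1); last by ring.
rewrite ler_wpM2l ?(mulr_ge0 C0 (mulr_ge0 w0 (exprn_ge0 k D0)))//.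
by rewrite ler_pdivrMr// mulrC ler_pdivlMr.
Qed.

Lemma growth_high (alpha : R) : 0 <= alpha -> forall w : R,
  w ^+ (2 * k) / (2 * k)`!%:R * moment 1 alpha (2 * k) @[k --> \oo] --> (0 : R).
Proof.
move=> a0; apply: (growth_of_factorial_bound (C := 1) (D := 2 * (1 + alpha))).
  move=> k; have := moment_factorial_bound (2 * k) a0.
  by rewrite mul1r mul2n doubleK.
by rewrite mulr_ge0// addr_ge0.
Qed.

End moment_growth_limits.

(** * The low temperature limit *)

Section low_temperature.
Context {R : realType} (N : nat) (N0 : (0 < N)%N).
Local Notation C := R[i].
Local Notation mom k := (moment (- 2^-1) (N%:R / 2 : R) k).

Let NR : 0 < N%:R :> R. Proof. by rewrite ltr0n. Qed.

Let pos : \forall x \near +oo, 0 < (x : R).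
Proof. exact: nbhs_pinfty_gt. Qed.

Let posn : \forall x \near (+oo : set_system R), (0 < (fun=> N) x)%N.
Proof. by apply: nearW. Qed.

Let cA : (1 - x / 2) / x @[x --> +oo] --> (- 2^-1 : R).
Proof.
have H : x^-1 - 2^-1 @[x --> +oo] --> (0 - 2^-1 : R).
  apply: cvgB; last exact: cvg_cst.
  by apply/gtr0_cvgV0; [exact: pos|exact: cvg_id].
rewrite sub0r in H; apply: cvg_trans H; apply: near_eq_cvg; near=> x.
have x0 : 0 < x by near: x.
by field; rewrite gt_eqF.
Unshelve. all: by end_near.
Qed.

Let cB : (x * N%:R)^-1 @[x --> +oo] --> (0 : R).
Proof.
have H : N%:R^-1 * x^-1 @[x --> +oo] --> (N%:R^-1 * 0 : R).
  apply: cvgM; first exact: cvg_cst.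
  by apply/gtr0_cvgV0; [exact: pos|exact: cvg_id].
rewrite mulr0 in H; apply: cvg_trans H; apply: near_eq_cvg; near=> x.
by rewrite invfM mulrC.
Unshelve. all: by end_near.
Qed.

Let cG : x * N%:R / (2 * x) @[x --> +oo] --> (N%:R / 2 : R).
Proof.
apply: cvg_near_cst; near=> x.
have x0 : 0 < x by near: x.
by field; rewrite gt_eqF.
Unshelve. all: by end_near.
Qed.

(** Not visible in the recursion, whose first coefficient is negative: the even moments are limits
    of averages of nonnegative functions. *)
Lemma low_moment_ge0 k : 0 <= mom k.
Proof.
case: (boolP (odd k)) => ok; first by rewrite moment_odd.
apply: (@closed_cvg _ _ _ _ (fun x : R => emp_avg x x N (fun s => s ^+ k))
  (fun y : R => 0 <= y) (@closed_ge R 0)); last first.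
  exact: (@cvg_emp_avgX R R +oo _ id id (fun=> N) _ _ pos pos posn cA cB cG k).
near=> x.
have x0 : 0 < x by near: x.
  (* Positivity of the average, read off from [emp_avg_dist] for two zero functions. *)
  apply: (le_trans (normr_ge0 _) (@emp_avg_dist R x x N x0 x0 (fun=> 0) (fun=> 0) _
    (moderate_cst 0) (moderate_cst 0) (moderateX k) _)).
  move=> s; rewrite subrr normr0 -(even_halfK ok) -muln2 exprM.
  by rewrite exprn_even_ge0.
exact: proper_pinfty_nbhs.
Unshelve. all: by end_near.
Qed.

(** [moment_geometric_bound] at [x = 1 / (2 N)], where [4 g x^2 = 1 / (2 N) <= 1]. *)
Lemma low_moment_le k : mom k <= 2 * (2 * N%:R) ^+ k.
Proof.
have N20 : 0 < 2 * N%:R :> R by rewrite mulr_gt0.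
rewrite -ler_pdivrMr ?exprn_gt0// -exprVn; apply: moment_geometric_bound.
- by rewrite oppr_le0 invr_ge0.
- by rewrite divr_ge0.
- by rewrite invr_ge0 ltW.
- rewrite [leLHS](_ : _ = (2 * N%:R)^-1); last by field; rewrite gt_eqF.
  by rewrite invf_le1// -natrM ler1n muln_gt0.
- exact: low_moment_ge0.
Qed.

Lemma growth_low (w : R) :
  w ^+ (2 * k) / (2 * k)`!%:R * mom (2 * k) @[k --> \oo] --> (0 : R).
Proof.
apply: (growth_of_factorial_bound (C := 2) (D := (2 * N%:R) ^+ 2)); last exact: sqr_ge0.
move=> k; rewrite low_moment_ge0/= (le_trans (low_moment_le _))//.
rewrite ler_wpM2l// exprM ler_peMr ?exprn_ge0 ?sqr_ge0//.
by rewrite ler1n fact_gt0.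
Qed.

Lemma W1_G_limit (z : C) : complex.Im z != 0 -> exists W : C,
  W1_G N z beta @[beta --> +oo] --> (N%:R * W : C^o) /\
  forall q, `|W - \sum_(p < q) (mom (2 * p))%:C / z ^+ (2 * p).+1| <=
    (2 * mom (2 * q) / `|complex.Im z|)%:C / `|z| ^+ (2 * q).
Proof.
move=> z0.
have [W [cW WE]] := @emp_avg_resolvent_limit R R +oo _ id id (fun=> N) _ _
  pos pos posn cA cB cG growth_low z z0.
exists W; split; last exact: WE.
pose e (x : R) : C^o := (emp_avg x x N (fun s => complex.Re (z - s%:C)^-1) +i*
  emp_avg x x N (fun s => complex.Im (z - s%:C)^-1))%C.
have H : (N%:R : C^o) * e x @[x --> +oo] --> (N%:R : C^o) * (W : C^o).
  by apply: cvgM; [exact: cvg_cst|exact: cW].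
apply: cvg_trans H; apply: near_eq_cvg; near=> x.
have x0 : 0 < x by near: x.
rewrite /W1_G one_pointE; [reflexivity|exact: x0|exact: x0|exact: N0|exact: z0].
Unshelve. all: by end_near.
Qed.

End low_temperature.

(** * The high temperature limit *)

Section high_temperature.
Context {R : realType} (alpha : R) (alpha0 : 0 < alpha).
Local Notation C := R[i].

Let posn : \forall n \near \oo, (0 < n)%N.
Proof. by exists 1%N. Qed.

Let posb : \forall n \near \oo, 0 < 2 * alpha / n%:R.
Proof. by near=> n; rewrite divr_gt0 ?mulr_gt0// ltr0n; near: n.
Unshelve. all: by end_near. Qed.

Let posc : \forall n \near \oo, 0 < (fun=> 1 : R) (n : nat).
Proof. by apply: nearW => n; exact: ltr01. Qed.

Let natV : (n%:R)^-1 @[n --> \oo] --> (0 : R).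
Proof.
apply/gtr0_cvgV0; last exact: cvgr_idn.
by near=> n; rewrite ltr0n; near: n.
Unshelve. all: by end_near. Qed.

Let cA : (1 - 2 * alpha / n%:R / 2) / 1 @[n --> \oo] --> (1 : R).
Proof.
have H : 1 - alpha * n%:R^-1 @[n --> \oo] --> (1 - alpha * 0 : R).
  apply: cvgB; first exact: cvg_cst.
  by apply: cvgM => //; exact: cvg_cst.
rewrite mulr0 subr0 in H; apply: cvg_trans H; apply: near_eq_cvg; near=> n.
have n0 : n%:R != 0 :> R by rewrite pnatr_eq0 -lt0n; near: n.
by field.
Unshelve. all: by end_near. Qed.

Let cB : (1 * n%:R)^-1 @[n --> \oo] --> (0 : R).
Proof. by under eq_fun do rewrite mul1r. Qed.

Let cG : 2 * alpha / n%:R * n%:R / (2 * 1) @[n --> \oo] --> alpha.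
Proof.
apply: cvg_near_cst; near=> n.
have n0 : n%:R != 0 :> R by rewrite pnatr_eq0 -lt0n; near: n.
by field.
Unshelve. all: by end_near. Qed.

Lemma W1_G_high_limit (z : C) : complex.Im z != 0 -> exists W : C,
  W1_G_high alpha z n @[n --> \oo] --> (W : C^o) /\
  forall q, `|W - \sum_(p < q) (moment 1 alpha (2 * p))%:C / z ^+ (2 * p).+1| <=
    (2 * moment 1 alpha (2 * q) / `|complex.Im z|)%:C / `|z| ^+ (2 * q).
Proof.
move=> z0.
have [W [cW WE]] := @emp_avg_resolvent_limit R nat \oo _ (fun=> 1)
  (fun n => 2 * alpha / n%:R) id _ _ posc posb posn cA cB cG
  (growth_high (ltW alpha0)) z z0.
exists W; split; last exact: WE.
apply: cvg_trans cW; apply: near_eq_cvg; near=> n.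
have n0 : (0 < n)%N by near: n.
have b0 : 0 < 2 * alpha / n%:R by near: n.
rewrite /W1_G_high (_ : (fun l => expR (- (l ^+ 2 / 2))) =
  fun l => expR (- (1 * l ^+ 2 / 2))); last by apply/funext => l; rewrite mul1r.
rewrite one_pointE; [|exact: ltr01|exact: b0|exact: n0|exact: z0].
by rewrite mulKf// pnatr_eq0 -lt0n.
Unshelve. all: by end_near.
Qed.

End high_temperature.

(** * Uniqueness of the moments *)

Section expansions_along_imaginary_axis.
Context {R : realType}.
Local Notation C := R[i].

(** A common weakening of the two notions of expansion, restricted to the positive imaginary axis,
    that still determines the coefficients. *)
Definition axis_expansion (f : C -> C) (m : nat -> R) : Prop :=
  forall (n : nat) (delta : R), 0 < delta -> exists r : R, forall y : R,
    0 < y -> r < y ->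
    `|f ('i%C * y%:C) - \sum_(p < n.+1) (m p)%:C / ('i%C * y%:C) ^+ (2 * p).+1|
      <= (delta / y ^+ (2 * n).+1)%:C.

Lemma normi : `|'i%C : C| = 1.
Proof. by rewrite normc_def /= expr0n expr1n add0r sqrtr1. Qed.

Lemma norm_axis (y : R) : 0 < y -> `|'i%C * y%:C| = y%:C.
Proof. by move=> y0; rewrite normrM normi mul1r normc_real gtr0_norm. Qed.

Lemma norm_axis_term (a y : R) k : 0 < y ->
  `|a%:C / ('i%C * y%:C) ^+ k| = (`|a| / y ^+ k)%:C.
Proof.
move=> y0; rewrite normrM normfV normrX norm_axis// normc_real.
by rewrite [RHS]rmorphM /= fmorphV rmorphXn.
Qed.

(** Once the lower coefficients agree, the truncations differ by a single term of modulus
    [|a n - b n| / y^(2n+1)], while both errors are [o(1 / y^(2n+1))]. *)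
Lemma axis_expansion_unique (f : C -> C) (a b : nat -> R) :
  axis_expansion f a -> axis_expansion f b -> a =1 b.
Proof.
move=> fa fb; elim/ltn_ind => n IH; apply/eqP; rewrite -subr_eq0 -normr_le0.
apply/ler_addgt0Pr => e e0; rewrite add0r.
have e2 : 0 < e / 2 by rewrite divr_gt0.
have [r1 H1] := fa n _ e2; have [r2 H2] := fb n _ e2.
pose y := 1 + `|r1| + `|r2|.
have y0 : 0 < y by rewrite !ltr_pwDl.
have ry1 : r1 < y.
  by rewrite /y addrAC (le_lt_trans (ler_norm r1))// ltrDr ltr_pwDl.
have ry2 : r2 < y.
  by rewrite /y (le_lt_trans (ler_norm r2))// ltrDr ltr_pwDl.
have := lerD (H1 _ y0 ry1) (H2 _ y0 ry2).
rewrite distrC => /(le_trans (ler_normD _ _)).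
rewrite addrA subrK !big_ord_recr /=.
under eq_bigr do rewrite IH//.
rewrite opprD addrACA subrr add0r -mulrBl -rmorphB /= norm_axis_term//.
rewrite -rmorphD /= lecR -mulrDl ler_pM2r ?invr_gt0 ?exprn_gt0//.
by rewrite -splitr.
Qed.

(** Keeping the subtracted end term makes the induction close: since [rho^2 <= 1/2], twice the
    decrement covers each new term. *)
Lemma geometric_tail (M rho : R) n q : 0 <= M -> 0 <= rho -> rho ^+ 2 <= 2^-1 ->
  (n <= q)%N -> \sum_(n <= p < q) M * rho ^+ (2 * p).+1 <=
    2 * M * (rho ^+ (2 * n).+1 - rho ^+ (2 * q).+1).
Proof.
move=> M0 rho0 rho2; elim: q => [|q IH].
  by rewrite leqn0 => /eqP ->; rewrite big_nil subrr mulr0.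
rewrite leq_eqVlt => /orP[/eqP ->|]; first by rewrite big_geq// subrr mulr0.
rewrite ltnS => nq; rewrite big_nat_recr//= (le_trans (lerD (IH nq) (lexx _)))//.
have -> : (2 * q.+1).+1 = (2 + (2 * q).+1)%N by rewrite mulnS addnS.
rewrite exprD.
set u := rho ^+ (2 * q).+1; have u0 : 0 <= M * u by rewrite mulr_ge0// exprn_ge0.
have := ler_wpM2l u0 rho2; nra.
Qed.

(** Convergence at the one point [i s] bounds [|m p|] by [M s^(2p+1)], so for [y >= 2 s] the tail is
    dominated by a geometric series. *)
Lemma axis_expansion_of_cvg (f : C -> C^o) (m : nat -> R) (D : set C) :
  (forall y : R, 0 < y -> D ('i%C * y%:C)) -> expands_at_infty D f m ->
  axis_expansion f m.
Proof.
move=> DI [r Hr] n delta delta0.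
pose s := 1 + `|r|; have s0 : 0 < s by rewrite ltr_pwDl.
have rs : r < s by rewrite /s (le_lt_trans (ler_norm r))// ltrDr.
have cvs y : s <= y ->
    series (fun p => (m p)%:C / ('i%C * y%:C) ^+ (2 * p).+1 : C^o) @ \oo -->
    f ('i%C * y%:C).
  move=> sy; have y0 := lt_le_trans s0 sy.
  by apply: Hr; [exact: DI|rewrite norm_axis// ltcR (lt_le_trans rs)].
have [M M0 HM] : exists2 M : R, 0 < M & forall p, `|m p| <= M * s ^+ (2 * p).+1.
  have /cvgP/cvg_series_cvg_0 H0 := cvs _ (lexx s).
  have /cvgrPdist_lt/(_ 1 ltr01)[K _ HK] := H0.
  (* The 1 covers the terms beyond [K], the sum the finitely many earlier ones. *)
  exists (1 + \sum_(p < K) `|m p| / s ^+ (2 * p).+1).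
    by rewrite ltr_pwDl// sumr_ge0// => p _; rewrite divr_ge0// exprn_ge0// ltW.
  move=> p; rewrite -ler_pdivrMr ?exprn_gt0//.
  case: (ltnP p K) => pK.
    rewrite (bigD1 (Ordinal pK))//= addrCA lerDl addr_ge0// sumr_ge0// => i _.
    by rewrite divr_ge0// exprn_ge0// ltW.
  have := HK p pK; rewrite sub0r normrN norm_axis_term// (ltcR _ 1) => /ltW.
  move=> /le_trans; apply; rewrite lerDl sumr_ge0// => i _.
  by rewrite divr_ge0// exprn_ge0// ltW.
(* The tail is at most [delta B / y^(2n+3)], and [B <= y <= y^2] as soon as [y >= B] and
   [y >= 1]. *)
pose B := 2 * M * s ^+ (2 * n.+1).+1 / delta.
have B0 : 0 < B by rewrite divr_gt0// mulr_gt0 ?exprn_gt0// mulr_gt0.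
exists (1 + 2 * s + B) => y y0 yB.
have sy : s <= y by lra.
have s2y : 2 * s <= y by lra.
pose rho := s / y.
have rho0 : 0 < rho by rewrite divr_gt0.
have rho1 : rho <= 2^-1 by rewrite ler_pdivrMr// mulrC ler_pdivlMr// mulrC.
have rho2 : rho ^+ 2 <= 2^-1 by rewrite expr2; nra.
set S := \sum_(p < _) _.
have tail q : (n.+1 <= q)%N ->
    `|series (fun p => (m p)%:C / ('i%C * y%:C) ^+ (2 * p).+1 : C^o) q - S| <=
    (2 * M * rho ^+ (2 * n.+1).+1)%:C.
  move=> nq; have -> : S = series
    (fun p => (m p)%:C / ('i%C * y%:C) ^+ (2 * p).+1 : C^o) n.+1.
    by rewrite /series /= big_mkord.
  rewrite (sub_series_geq _ nq).
  apply: (le_trans (ler_norm_sum _ _ _)).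
  have H := geometric_tail (ltW M0) (ltW rho0) rho2 nq.
  apply: (@le_trans _ _ (\sum_(n.+1 <= p < q) M * rho ^+ (2 * p).+1)%:C).
    rewrite rmorph_sum /=; apply: ler_sum => p _.
    rewrite norm_axis_term// lecR ler_pdivrMr ?exprn_gt0//.
    by rewrite -mulrA -exprMn divfK ?gt_eqF.
  rewrite lecR (le_trans H)// ler_wpM2l ?mulr_ge0 ?(ltW M0)//.
  by rewrite lerBlDr lerDl exprn_ge0// ltW.
have lim_tail : `|f ('i%C * y%:C) - S| <= (2 * M * rho ^+ (2 * n.+1).+1)%:C.
  apply/ler_addgt0Pr => e e0.
  have /cvgrPdist_lt/(_ _ e0)[K _ HK] := cvs _ sy.
  pose q := maxn K n.+1.
  have h1 := HK q (leq_maxl _ _); have h2 := tail q (leq_maxr _ _).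
  have := ler_normD (f ('i%C * y%:C) -
    series (fun p => (m p)%:C / ('i%C * y%:C) ^+ (2 * p).+1 : C^o) q)
    (series (fun p => (m p)%:C / ('i%C * y%:C) ^+ (2 * p).+1 : C^o) q - S).
  rewrite addrA subrK => /le_trans; apply.
  by rewrite addrC lerD// ltW.
apply: (le_trans lim_tail); rewrite lecR /rho expr_div_n.
have nE : (2 * n.+1).+1 = ((2 * n).+1 + 2)%N by rewrite mulnS addnC addSn.
rewrite nE.
have -> : 2 * M * (s ^+ ((2 * n).+1 + 2) / y ^+ ((2 * n).+1 + 2)) =
    delta * B / y ^+ ((2 * n).+1 + 2).
  rewrite /B nE; by field; rewrite !gt_eqF// exprn_gt0.
rewrite ler_pdivrMr ?exprn_gt0// exprD [leRHS]mulrA divfK ?gt_eqF ?exprn_gt0//.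
rewrite ler_wpM2l ?(ltW delta0)// expr2.
have y1 : 1 <= y by lra.
have By : B <= y by lra.
by rewrite (le_trans By)// ler_peMl// ltW.
Qed.

Lemma axis_expansion_of_asymptotic (f : C -> C^o) (m : nat -> R) :
  asymptotic_at_infty f m -> axis_expansion f m.
Proof.
(* On the imaginary axis [|Im x| = |x|], so the sector with [eps = 1] is enough. *)
move=> /(_ 1 ltr01) H n delta /(H n)[r Hr]; exists r => y y0 ry.
have := Hr ('i%C * y%:C); rewrite norm_axis// (_ : complex.Im _ = y); last first.
  by rewrite /= mul0r mul1r add0r.
rewrite mul1r (gtr0_norm y0) ltcR => /(_ (lexx _) ry) /le_trans; apply.
by rewrite [leRHS]rmorphM /= fmorphV rmorphXn.
Qed.

End expansions_along_imaginary_axis.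

Lemma moment_eval (R : comNzRingType) (a : R) k :
  (moment 1 'X k).[a] = moment 1 a k.
Proof.
rewrite -[LHS]/(horner_eval a _) rmorph_moment rmorph1.
by congr moment; exact: hornerX.
Qed.

(** * Existence of the expansions *)

Section limits_of_one_point_functions.
Context {R : realType}.
Local Notation C := R[i].

Let C_hausdorff : hausdorff_space C^o.
Proof. exact: norm_hausdorff. Qed.

(** The factor [N] undoes the normalisation of the empirical average, because [W1_G] sums over the
    eigenvalues without dividing. *)
Definition low_moment (N p : nat) : R :=
  N%:R * moment (- 2^-1) (N%:R / 2) (2 * p).

Lemma W1_G_cvg (N : nat) (z : C) : (0 < N)%N -> complex.Im z != 0 ->
  cvg (W1_G N z beta @[beta --> +oo]).
Proof. by move=> N0 z0; have [W [/cvgP cW _]] := W1_G_limit N0 z0. Qed.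

Lemma W1_G_high_cvg (alpha : R) (z : C) : 0 < alpha -> complex.Im z != 0 ->
  cvg (W1_G_high alpha z n @[n --> \oo]).
Proof. by move=> a0 z0; have [W [/cvgP cW _]] := W1_G_high_limit a0 z0. Qed.

Lemma is_moments_low_moment (N : nat) : (0 < N)%N ->
  @is_moments_G R N (low_moment N).
Proof.
move=> N0; exists (2 * N%:R) => z /= z0 rz.
have [W [cW WE]] := W1_G_limit N0 z0.
have -> : W10_G N z = N%:R * W.
  by apply: cvg_lim => //; exact: cW.
pose nu := complex.Re `|z|.
have zE : `|z| = nu%:C by exact: normcE_real.
rewrite zE ltcR in rz.
have N2 : 0 < 2 * N%:R :> R by rewrite mulr_gt0// ltr0n.
have nu0 : 0 < nu by exact: lt_trans rz.
have iz : 0 < `|complex.Im z| by rewrite normr_gt0.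
(* From [N * 2 * mom (2 q) / |Im z|] with [mom (2 q) <= 2 (2 N)^(2 q)]; the power of [2 N] goes into
   [rho]. *)
pose K : R := 4 * N%:R / `|complex.Im z|.
pose rho := ((2 * N%:R) / nu) ^+ 2.
have rho1 : `|rho| < 1.
  rewrite ger0_norm ?exprn_ge0 ?divr_ge0 ?(ltW N2) ?(ltW nu0)//.
  by rewrite exprn_ilt1// ?divr_ge0 ?(ltW N2) ?(ltW nu0)// ltr_pdivrMr// mul1r.
have bound q : `|N%:R * W - series (fun p => (low_moment N p)%:C /
    z ^+ (2 * p).+1 : C^o) q| <= (K * rho ^+ q)%:C.
  have -> : series (fun p => (low_moment N p)%:C / z ^+ (2 * p).+1 : C^o) q =
      N%:R * \sum_(p < q) (moment (- 2^-1) (N%:R / 2 : R) (2 * p))%:C /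
        z ^+ (2 * p).+1.
    rewrite /series /= big_mkord mulr_sumr; apply: eq_bigr => p _.
    by rewrite /low_moment rmorphM /= rmorph_nat mulrA.
  rewrite -mulrBr normrM normr_nat.
  apply: le_trans (ler_wpM2l (ler0n _ _) (WE q)) _.
  rewrite zE -rmorphXn /= -fmorphV -rmorphM /= -(rmorph_nat (real_complex R)).
  rewrite -rmorphM /= lecR /K /rho -exprM expr_div_n.
  rewrite mulrA [leRHS]mulrA ler_pM2r ?invr_gt0 ?exprn_gt0//.
  rewrite mulrA [leRHS]mulrAC ler_pM2r ?invr_gt0//.
  have : moment (- 2^-1) (N%:R / 2 : R) (2 * q) <= _ := low_moment_le N0 (2 * q).
  have := ler0n R N; nra.
apply/cvgrPdist_lt => e e0.
have eE : e = (complex.Re e)%:C by rewrite RRe_real// ger0_real// ltW.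
have e1 : 0 < complex.Re e by rewrite -ltcR -eE.
have : K * rho ^+ q @[q --> \oo] --> K * 0.
  by apply: cvgM; [exact: cvg_cst|exact: cvg_expr].
rewrite mulr0 => /cvgrPdist_lt/(_ _ e1) H; near=> q.
apply: le_lt_trans (bound q) _; rewrite eE ltcR.
apply: le_lt_trans (ler_norm _) _; rewrite -normrN -sub0r; near: q; exact: H.
Unshelve. all: by end_near. Qed.

(** In the sector, the remainder bound at order [n + 1] is at most [2 M / (eps |z|^(2n+3))], two
    powers of [|z|] better than the target scale. One power absorbs [2 M / (eps delta)], the other
    is at least 1. *)
Lemma is_moments_high_moment :
  @is_moments_Gstar R (fun p => moment 1 'X (2 * p)).
Proof.
move=> alpha alpha0 eps eps0 n delta delta0.
pose M : R := moment 1 alpha (2 * n.+1).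
have e0 : 0 < eps * delta by rewrite mulr_gt0.
exists (1 + `|2 * M / (eps * delta)|) => z ez rz.
pose nu := complex.Re `|z|.
have zE : `|z| = nu%:C by exact: normcE_real.
rewrite zE ltcR in rz.
have nu0 : 0 < nu by rewrite (le_lt_trans _ rz)// addr_ge0.
rewrite zE -rmorphM /= lecR in ez.
have iz : 0 < `|complex.Im z| by rewrite (lt_le_trans _ ez)// mulr_gt0.
have z0 : complex.Im z != 0 by rewrite -normr_gt0.
have [W [cW WE]] := W1_G_high_limit alpha0 z0.
have -> : W10_Gstar alpha z = W.
  by apply: cvg_lim => //; exact: cW.
under eq_bigr do rewrite moment_eval.
apply: le_trans (WE n.+1) _.
rewrite zE -!rmorphXn /= -!fmorphV -!rmorphM /= lecR -/M.
rewrite ler_pdivrMr ?exprn_gt0// (_ : (2 * n.+1)%N = ((2 * n).+1 + 1)%N); last first.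
  by rewrite mulnS add2n addn1.
rewrite exprD expr1 mulrA divfK ?gt_eqF ?exprn_gt0// ler_pdivrMr//.
have : 2 * M / (eps * delta) < nu.
  by rewrite (le_lt_trans (ler_norm _))// (le_lt_trans _ rz)// lerDr.
rewrite ltr_pdivrMr// => /ltW/le_trans; apply.
have := ler_wpM2l (ltW (mulr_gt0 delta0 nu0)) ez.
have nu1 : 1 <= nu by rewrite (le_trans _ (ltW rz))// lerDl.
apply: le_trans; rewrite (_ : _ * (eps * nu) = nu * (nu * (eps * delta))).
  by rewrite ler_peMl// mulr_ge0// ltW.
by ring.
Qed.

End limits_of_one_point_functions.

Lemma low_moment_duality (R : realType) (N p : nat) :
  low_moment N p = N%:R * ((- 2)^-1 ^+ p * moment 1 (- N%:R) (2 * p)) :> R.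
Proof.
have pE : (2 * p)./2 = p by rewrite mul2n doubleK.
have := momentZ (- 2^-1 : R) 1 (- N%:R) (2 * p); rewrite pE invrN => <-.
by rewrite /low_moment mulr1 mulrNN [_^-1 * _]mulrC.
Qed.

Lemma moments_G_unique (R : realType) (N : nat) (m : nat -> R) : (0 < N)%N ->
  is_moments_G N m -> m =1 low_moment N.
Proof.
move=> N0 Hm; apply: (@axis_expansion_unique _ (W10_G N)).
  apply: axis_expansion_of_cvg Hm => y y0 /=.
  by rewrite mul0r mul1r add0r gt_eqF.
apply: axis_expansion_of_cvg (is_moments_low_moment N0) => y y0 /=.
by rewrite mul0r mul1r add0r gt_eqF.
Qed.

(** The difference vanishes at more points than its degree allows. Asymptotics are available for
    positive [alpha] only; this carries them to the value at [-N]. *)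
Lemma poly_eq_on_positive (R : realDomainType) (p q : {poly R}) :
  (forall a, 0 < a -> p.[a] = q.[a]) -> p = q.
Proof.
move=> H; apply/eqP; rewrite -subr_eq0; apply/eqP.
apply: (@roots_geq_poly_eq0 _ _ [seq k.+1%:R | k <- iota 0 (size (p - q))]).
- apply/allP => _ /mapP[k _ ->]; rewrite rootE hornerD hornerN H ?ltr0n//.
  by rewrite subrr.
- by rewrite map_inj_uniq ?iota_uniq// => i j /eqP; rewrite eqr_nat => /eqP[].
- by rewrite size_map size_iota.
Qed.

Lemma moments_Gstar_unique (R : realType) (m : nat -> {poly R}) :
  is_moments_Gstar m -> forall p, m p = moment 1 'X (2 * p).
Proof.
move=> Hm p; apply: poly_eq_on_positive => a a0.
have H1 := axis_expansion_of_asymptotic (Hm a a0).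
have H2 := axis_expansion_of_asymptotic (is_moments_high_moment a0).
exact: (axis_expansion_unique H1 H2 p).
Qed.

(** The first block guarantees that the limits behind [W10_G] and [W10_Gstar] exist and that
    expansions exist, so the second, about arbitrary expansions, is not vacuous. The set [Re x != 0]
    is where [i x / sqrt 2] is not real. *)
Theorem corollary2p3 (R : realType) :
  [/\ forall (N : nat) (x : R[i]), (0 < N)%N -> complex.Im x != 0 ->
        cvg (W1_G N x beta @[beta --> +oo]),
      forall (alpha : R) (x : R[i]), 0 < alpha -> complex.Im x != 0 ->
        cvg (W1_G_high alpha x N @[N --> \oo]),
      forall N : nat, (0 < N)%N -> exists mG : nat -> R, is_moments_G N mG &
      exists mGs : nat -> {poly R}, is_moments_Gstar mGs] /\
  forall (N : nat) (mG : nat -> R) (mGs : nat -> {poly R}),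
    (0 < N)%N -> is_moments_G N mG -> is_moments_Gstar mGs ->
    expands_at_infty [set x | complex.Re x != 0]
      (fun x => 'i%C / ((Num.sqrt 2)%:C * N%:R) *
                W10_G N ('i%C * x / (Num.sqrt 2)%:C))
      (fun p => (mGs p).[- N%:R]) /\
    forall p : nat, (- 2) ^+ p / N%:R * mG p = (mGs p).[- N%:R].
Proof.
split; first split.
- exact: W1_G_cvg.
- exact: W1_G_high_cvg.
- by move=> N N0; exists (low_moment N); exact: is_moments_low_moment.
- by exists (fun p => moment 1 'X (2 * p)); exact: is_moments_high_moment.
move=> N mG mGs N0 HG HGs.
have NR : N%:R != 0 :> R by rewrite pnatr_eq0 -lt0n.
have dual p : mG p = N%:R * ((- 2)^-1 ^+ p * (mGs p).[- N%:R]).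
  rewrite (moments_G_unique N0 HG) low_moment_duality.
  by rewrite (moments_Gstar_unique HGs) moment_eval.
split; last first.
  move=> p; rewrite dual -[_ / _ * _]mulrA mulKf// mulrA -exprMn mulfV ?expr1n ?mul1r//.
have [r Hr] := HG.
have s0 : 0 < Num.sqrt 2 :> R by rewrite sqrtr_gt0.
have sC0 : (Num.sqrt 2)%:C != 0 :> R[i] by rewrite (inj_eq (@complexI _)) gt_eqF.
have NC : N%:R != 0 :> R[i] by rewrite pnatr_eq0 -lt0n.
(* Since [|z| = |x| / sqrt 2], the radius is scaled by [sqrt 2]. *)
exists (Num.sqrt 2 * r) => x /= x0 rx.
set z := 'i%C * x / (Num.sqrt 2)%:C.
have xC0 : x != 0 by apply: contra_neq x0 => ->.
have zIm : complex.Im z != 0.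
  rewrite /z mulrC -fmorphV Im_scale (mulrC 'i%C) ImiRe.
  by rewrite mulf_neq0// invr_neq0// gt_eqF.
have rz : r%:C < `|z|.
  rewrite /z normrM normfV normrM normi mul1r normc_real (gtr0_norm s0).
  by rewrite ltr_pdivlMr ?ltcR// mulrC -rmorphM.
have z2 : z ^+ 2 = - (2^-1 * x ^+ 2).
  rewrite /z expr_div_n exprMn sqr_i -rmorphXn /= sqr_sqrtr ?ler0n//.
  by rewrite rmorph_nat mulN1r mulNr mulrC.
set c := 'i%C / _.
(* The two series agree term by term: [z^2 = - x^2 / 2] turns [z^(2p)] into [(-2)^(-p) x^(2p)],
   which cancels the power of [-2] in [dual], and [c] cancels [N] and the remaining factor
   [i / sqrt 2] of [z]. *)
have -> : series (fun p => ((mGs p).[- N%:R])%:C / x ^+ (2 * p).+1 : R[i]^o) =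
    fun q => c *: series (fun p => (mG p)%:C / z ^+ (2 * p).+1 : R[i]^o) q.
  apply/funext => q; rewrite /series /= scaler_sumr; apply: eq_bigr => p _.
  have -> : z ^+ (2 * p).+1 = z * ((- 2)^-1 ^+ p * x ^+ (2 * p)).
    by rewrite exprS exprM z2 -mulNr -invrN exprMn -exprM.
  rewrite dual !rmorphM rmorphXn fmorphV rmorphN /= !rmorph_nat exprS /z /c.
  set w := _^-1 ^+ p; set X := x ^+ (2 * p); set v := (_.[_])%:C.
  have w0 : w != 0 by rewrite expf_neq0// invr_eq0 oppr_eq0 pnatr_eq0.
  have X0 : X != 0 by rewrite expf_neq0.
  have i0 : 'i%C != 0 :> R[i] by rewrite -normr_gt0 normi.
  transitivity ('i%C / ((Num.sqrt 2)%:C * N%:R) *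
      (N%:R * (w * v) / ('i%C * x / (Num.sqrt 2)%:C * (w * X)))) => //.
  move: sC0 NC; move: (Num.sqrt 2)%:C (N%:R : R[i]) => s nu sC0 NC.
  by field; rewrite w0 X0 i0 xC0 sC0 NC.
by apply: cvgZr; exact: Hr.
Qed.
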